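(* Let $X$ be a connected complex manifold of dimension $n \geq 2$ and let $F: X \to \mathbb{C}^n$ be a local biholomorphism. Fix a point $q \in F(X)$, and suppose that for every complex line $l \subset \mathbb{C}^n$ passing through $q$, the pre-image $F^{-1}(l)$ is conformal to a rigid domain $D_l \subset \mathbb{C}\mathbb{P}^1$. Then $q$ is assumed exactly once by $F$, i.e. $F^{-1}(q)$ consists of exactly one point.
   Context: A complex line in $\mathbb{C}^n$ is an affine complex line (a translate of a one-dimensional complex linear subspace). Since $F$ is a local biholomorphism, each non-empty pre-image $F^{-1}(l)$ is a one-dimensional complex submanifold of $X$; ''conformal to'' means biholomorphic to, for this induced complex structure. A rigid domain of $\mathbb{C}\mathbb{P}^1$ is a connected open set $U \subset \mathbb{C}\mathbb{P}^1$, with inclusion map $i: U \hookrightarrow \mathbb{C}\mathbb{P}^1$, such that for every holomorphic embedding (injective holomorphic map) $f: U \hookrightarrow \mathbb{C}\mathbb{P}^1$ there is an automorphism (Möbius transformation) $M$ of $\mathbb{C}\mathbb{P}^1$ with $f = M \circ i$. *)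

(* Defs.v *)
From HB Require Import structures.
From mathcomp Require Import all_boot all_order all_algebra.
From mathcomp Require Import complex.
From mathcomp Require Import all_classical all_reals all_analysis.

Set Implicit Arguments.
Unset Strict Implicit.
Unset Printing Implicit Defensive.

Import Order.TTheory GRing.Theory Num.Theory.
Import numFieldNormedType.Exports.

Local Open Scope classical_set_scope.
Local Open Scope ring_scope.

(* Keeping this constant folded lets R[i] inherit the normed topology that
   MathComp-Analysis puts on a numFieldType; `differentiable` between modules
   over Cplx R is then complex (Frechet) differentiability. *)
Definition Cplx (R : realType) : numClosedFieldType := R[i]%C.

(* The value of chart_map off chart_dom, and of chart_inv off the image
   chart_map @` chart_dom, is irrelevant. *)
Record chart (R : realType) (n : nat) (T : Type) := Chart {
  chart_dom : set T ;
  chart_map : T -> 'rV[Cplx R]_n ;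
  chart_inv : 'rV[Cplx R]_n -> T }.

Definition chart_codom (R : realType) (n : nat) (T : Type) (c : chart R n T) :
  set 'rV[Cplx R]_n := chart_map c @` chart_dom c.

Definition is_chart (R : realType) (n : nat) (T : topologicalType)
    (c : chart R n T) : Prop :=
  [/\ open (chart_dom c), open (chart_codom c),
      forall x, chart_dom c x -> chart_inv c (chart_map c x) = x,
      forall x, chart_dom c x -> {for x, continuous (chart_map c)} &
      forall v, chart_codom c v -> {for v, continuous (chart_inv c)}].

Definition holomorphic_transition (R : realType) (n : nat) (T : Type)
    (c d : chart R n T) : Prop :=
  forall v, (chart_map c @` (chart_dom c `&` chart_dom d)) v ->
    differentiable (chart_map d \o chart_inv c) v.

Definition compatible (R : realType) (n : nat) (T : Type)
    (c d : chart R n T) : Prop :=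
  holomorphic_transition c d /\ holomorphic_transition d c.

Record chartedSpace (R : realType) (n : nat) := ChartedSpace {
  carrier :> topologicalType ;
  atlas : set (chart R n carrier) }.

Arguments atlas {R n} _.

Definition complex_manifold (R : realType) (n : nat) (M : chartedSpace R n) :
    Prop :=
  [/\ hausdorff_space M, @second_countable M,
      forall c, atlas M c -> is_chart c,
      forall x : M, exists2 c, atlas M c & chart_dom c x &
      forall c d, atlas M c -> atlas M d -> compatible c d].

Definition maximal_atlas (R : realType) (n : nat) (M : chartedSpace R n) :
    set (chart R n M) :=
  [set c | is_chart c /\ forall d, atlas M d -> compatible c d].

Arguments maximal_atlas {R n} _.

Definition holomorphic (R : realType) (m n : nat) (M : chartedSpace R m)
    (N : chartedSpace R n) (f : M -> N) : Prop :=
  continuous f /\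
  forall x : M, exists c d, [/\ atlas M c, chart_dom c x, atlas N d,
    chart_dom d (f x) &
    differentiable (chart_map d \o f \o chart_inv c) (chart_map c x)].

Definition biholomorphism (R : realType) (m n : nat) (M : chartedSpace R m)
    (N : chartedSpace R n) (f : M -> N) : Prop :=
  holomorphic f /\
  exists g : N -> M, [/\ cancel f g, cancel g f & holomorphic g].

Definition biholomorphic (R : realType) (m n : nat) (M : chartedSpace R m)
    (N : chartedSpace R n) : Prop :=
  exists f : M -> N, biholomorphism f.

(* c is a slice chart for S: in its domain, S is the vanishing locus of the
   last n - k coordinates.  w *m pid_mx k : 'rV_n is w : 'rV_k padded with
   zeros, and v *m pid_mx k : 'rV_k below is the first k entries of v : 'rV_n.
   For k = n the condition says that the domain of c lies in S. *)
Definition slice_chart (R : realType) (k n : nat) (T : Type) (S : set T)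
    (c : chart R n T) : Prop :=
  forall x, chart_dom c x ->
    (S x <-> exists w : 'rV[Cplx R]_k, chart_map c x = w *m pid_mx k).

(* The subset S, with the subspace topology and the complex structure of
   dimension k whose charts are the first k coordinates of the slice charts.
   This is the induced structure of a k-dimensional complex submanifold S, and
   for k = n that of an open subset S. *)
Definition induced_space (R : realType) (k n : nat) (M : chartedSpace R n)
    (S : set M) : chartedSpace R k :=
  @ChartedSpace R k (set_type S)
    [set e | is_chart e /\
      exists c, [/\ maximal_atlas M c, slice_chart k S c,
        chart_dom e = set_val @^-1` chart_dom c &
        forall x, chart_dom e x ->
          chart_map e x = chart_map c (set_val x) *m pid_mx k]].

(* Euclidean space C^n, with the identity as its only chart. *)
Definition Cspace (R : realType) (n : nat) : chartedSpace R n :=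
  @ChartedSpace R n 'rV[Cplx R]_n [set Chart setT id id].

(* The Riemann sphere: Some z is [z : 1], and None is [1 : 0]. *)
Definition CP1_affine_chart (R : realType) :
    chart R 1 (one_point_compactification (Cplx R)) :=
  Chart (range Some) (fun p => const_mx (odflt 0 p)) (fun v => Some (v 0 0)).

Definition CP1_infty_chart (R : realType) :
    chart R 1 (one_point_compactification (Cplx R)) :=
  Chart [set p | p != Some 0]
    (fun p => const_mx (if p is Some z then z^-1 else 0))
    (fun v => if v 0 0 == 0 then None else Some (v 0 0)^-1).

Definition CP1 (R : realType) : chartedSpace R 1 :=
  @ChartedSpace R 1 (one_point_compactification (Cplx R))
    [set CP1_affine_chart R; CP1_infty_chart R].

Definition local_biholomorphism (R : realType) (m n : nat)
    (M : chartedSpace R m) (N : chartedSpace R n) (f : M -> N) : Prop :=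
  forall x : M, exists U : set M, [/\ open U, U x, open (f @` U) &
    exists2 h : induced_space m U -> induced_space n (f @` U), biholomorphism h &
      forall y, set_val (h y) = f (set_val y)].

Definition complex_line (R : realType) (n : nat) (l : set 'rV[Cplx R]_n) :
    Prop :=
  exists a v : 'rV[Cplx R]_n,
    v != 0 /\ l = [set a + t *: v | t in [set: Cplx R]].

Definition rigid_domain (R : realType) (D : set (CP1 R)) : Prop :=
  [/\ open D, connected D &
      forall f : induced_space 1 D -> CP1 R, injective f -> holomorphic f ->
        exists2 A : CP1 R -> CP1 R, biholomorphism A &
          forall x, f x = A (set_val x)].

(* Main.v *)
(* Suppose p1 <> p2 both lie over q. For a direction v, the curve F^-1(q + C v) embeds into
   the sphere by a map g with g(p1) = oo and g(p2) = 0, and by rigidity g is unique up to a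
   factor, because the automorphisms of the sphere fixing 0 and oo are linear. Let z be the
   coordinate q + z v of the curve. The number b(v) = (1/g)'(p1) g'(p2), with derivatives
   taken with respect to z, is therefore well defined and non-zero, and
   b(c v) = c^2 b(v). It depends continuously on v: suitably normalised maps g for v_i -> v
   converge along an ultrafilter, Hurwitz's theorem makes the limit injective, and rigidity
   identifies it with a map for v. On a sphere S^3 in a plane C^2 inside C^n the loop
   t |-> e^(it) v is contractible, yet b winds twice around 0 along it: a contradiction. *)

(* The overview does not say why the limit of the maps g is neither constant nor without a pole.
   Each g is scaled so that the minimum of |1/g| on the circle of radius r/4 about p1 is 1.
   Injectivity then bounds g away from p1, and z g near p1, by constants independent of v. A point
   of that circle where |z g| = r/4 survives in the limit, so by Hurwitz the limit of z g has no
   zero, and the limit of g has a simple pole at p1. Injectivity of the limit is not a local matter: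
   Hurwitz only shows that if two points have equal values, the limit is constant near one of them.
   Connectedness of the curve carries this constancy up to p1, where it contradicts the pole. The
   curves for different v are not identified with each other. A point is followed from one direction
   to the next by a local section of F, which does not depend on the line. Integrals are replaced by
   finite trapezoidal sums with bounds uniform in the number of steps, and normal families by
   pointwise limits along an ultrafilter. *)
Require Import Defs.
From HB Require Import structures.
From mathcomp Require Import all_boot all_order all_algebra.
From mathcomp Require Import complex ring lra.
From mathcomp Require Import all_classical all_reals all_analysis.

Set Implicit Arguments.
Unset Strict Implicit.
Unset Printing Implicit Defensive.

Import Order.TTheory GRing.Theory Num.Theory.
Import numFieldNormedType.Exports.

Local Open Scope classical_set_scope.
Local Open Scope ring_scope.

(** * Complex analysis by trapezoidal sums *)

Section Modulus.
Variable R : realType.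
Local Notation C := (Cplx R).
Implicit Types (x y z w : C).

Definition md (z : C) : R := Normc.normc z.
Definition rc (x : R) : C := (x%:C)%C.

Arguments md : simpl never.
Arguments rc : simpl never.

Lemma norm_md z : `|z| = rc (md z). Proof. by case: z. Qed.
Lemma md0 : md 0 = 0. Proof. exact: Normc.normc0. Qed.
Lemma md1 : md 1 = 1. Proof. exact: Normc.normc1. Qed.
Lemma mdM x y : md (x * y) = md x * md y. Proof. exact: Normc.normcM. Qed.
Lemma mdV x : md x^-1 = (md x)^-1. Proof. exact: Normc.normcV. Qed.
Lemma mdN x : md (- x) = md x. Proof. exact: (@normcN R). Qed.
Lemma mdD x y : md (x + y) <= md x + md y. Proof. exact: (@le_normcD R). Qed.
Lemma mdD3 x y z : md (x + y + z) <= md x + md y + md z.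
Proof. by apply: le_trans (mdD _ _) _; rewrite lerD2r mdD. Qed.
Lemma md_ge0 x : 0 <= md x. Proof. by case: x => a b; exact: sqrtr_ge0. Qed.
Lemma md_eq0 x : (md x == 0) = (x == 0).
Proof. by apply/eqP/eqP => [/Normc.eq0_normc//|->]; rewrite md0. Qed.
Lemma md_gt0 x : (0 < md x) = (x != 0).
Proof. by rewrite lt_def md_ge0 andbT md_eq0. Qed.
Lemma mdB x y : md (x - y) = md (y - x). Proof. by rewrite -mdN opprB. Qed.
Lemma md_tri y x z : md (x - z) <= md (x - y) + md (y - z).
Proof. by rewrite (_ : x - z = (x - y) + (y - z)) ?mdD //; ring. Qed.
Lemma mdX x n : md (x ^+ n) = md x ^+ n.
Proof. by elim: n => [|n IH]; rewrite ?expr0 ?md1// !exprS mdM IH. Qed.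
Lemma md_rc (a : R) : md (rc a) = `|a|.
Proof. by rewrite /md /= expr0n /= addr0 sqrtr_sqr. Qed.
Lemma md_dist x y : md x - md y <= md (x - y).
Proof. by rewrite lerBlDr -{1}(subrK y x) mdD. Qed.
(** Cauchy estimates need a closed disc, while hypotheses are given on open discs; half of the
    smaller radius serves for both. *)
Lemma smaller_radius (r s : R) : 0 < r -> 0 < s ->
  exists2 rho : R, 0 < rho & forall t : R, t <= rho -> t < r /\ t < s.
Proof.
move=> r0 s0; have m0 : 0 < Num.min r s by rewrite lt_min r0.
exists (Num.min r s / 2); first by lra.
move=> t h; have : t < Num.min r s by lra.
by rewrite lt_min => /andP.
Qed.
Lemma md_le_ReIm z : md z <= `|complex.Re z| + `|complex.Im z|.
Proof.
case: z => a b /=; rewrite -[leRHS]ger0_norm ?addr_ge0// -sqrtr_sqr.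
rewrite ler_sqrt ?sqr_ge0// -(normr_id a).
have := normr_ge0 a; have := normr_ge0 b.
rewrite -(real_normK (num_real a)) -(real_normK (num_real b)) normr_id.
by nra.
Qed.
Lemma Re_le_md z : `|complex.Re z| <= md z.
Proof.
case: z => a b /=; rewrite -sqrtr_sqr ler_sqrt ?addr_ge0 ?sqr_ge0//.
by rewrite lerDl sqr_ge0.
Qed.
Lemma Im_le_md z : `|complex.Im z| <= md z.
Proof.
case: z => a b /=; rewrite -sqrtr_sqr ler_sqrt ?addr_ge0 ?sqr_ge0//.
by rewrite lerDr sqr_ge0.
Qed.

Lemma rcD a b : rc (a + b) = rc a + rc b. Proof. exact: rmorphD. Qed.
Lemma rcM a b : rc (a * b) = rc a * rc b. Proof. exact: rmorphM. Qed.
Lemma rcB a b : rc (a - b) = rc a - rc b. Proof. exact: rmorphB. Qed.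
Lemma rcV a : rc a^-1 = (rc a)^-1. Proof. exact: fmorphV. Qed.
Lemma rc0 : rc 0 = 0. Proof. by []. Qed.
Lemma rc1 : rc 1 = 1. Proof. by []. Qed.
Lemma rc_eq0 a : (rc a == 0) = (a == 0). Proof. by rewrite -md_eq0 md_rc normr_eq0. Qed.
Lemma rc2 : rc 2 = 2. Proof. by rewrite /rc rmorph_nat. Qed.

End Modulus.

Arguments md {R} z : simpl never.
Arguments rc {R} x : simpl never.

(** * Complex derivatives *)

Section Derivative.
Variable R : realType.
Local Notation C := (Cplx R).
Implicit Types (z w u d : C) (f g : C -> C).

(** The derivative of [f] at [z] is [d], written without a quotient so that [w = z] need not be
    excluded. *)
Definition hd f z d := forall e : R, 0 < e ->
  exists2 r : R, 0 < r & forall w, md (w - z) < r ->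
    md (f w - f z - d * (w - z)) <= e * md (w - z).

Definition holo f z := exists d, hd f z d.

Lemma hd_cont f z d : hd f z d -> forall e : R, 0 < e ->
  exists2 r : R, 0 < r & forall w, md (w - z) < r -> md (f w - f z) < e.
Proof.
move=> h e e0; have [r r0 hr] := h 1 ltr01.
have K0 : 0 < md d + 1 by have := md_ge0 d; lra.
exists (Num.min r (e / (md d + 1))); first by rewrite lt_min r0 divr_gt0.
move=> w; rewrite lt_min => /andP[/hr h1]; rewrite ltr_pdivlMr// => h2.
rewrite (_ : f w - f z = (f w - f z - d * (w - z)) + d * (w - z)); last by ring.
apply: le_lt_trans (mdD _ _) _; rewrite mdM.
by apply: le_lt_trans h2; rewrite mul1r in h1; lra.
Qed.

Lemma hd_near f g z d (r : R) : 0 < r -> (forall w, md (w - z) < r -> f w = g w) ->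
  hd f z d -> hd g z d.
Proof.
move=> r0 fg h e e0; have [s s0 hs] := h e e0.
exists (Num.min r s); first by rewrite lt_min r0.
move=> w; rewrite lt_min => /andP[wr ws].
by rewrite -fg// -(fg z) ?subrr ?md0//; exact: hs.
Qed.

Lemma hd_cst c z : hd (fun=> c) z 0.
Proof.
move=> e e0; exists 1 => // w _.
by rewrite subrr mul0r subrr md0 mulr_ge0 ?md_ge0 ?ltW.
Qed.

Lemma hd_id z : hd id z 1.
Proof.
move=> e e0; exists 1 => // w _.
by rewrite mul1r subrr md0 mulr_ge0 ?md_ge0 ?ltW.
Qed.

Lemma hdD f g z d k : hd f z d -> hd g z k -> hd (fun w => f w + g w) z (d + k).
Proof.
move=> hf hg e e0; have e20 : 0 < e / 2 by lra.
have [r r0 hr] := hf _ e20; have [s s0 hs] := hg _ e20.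
exists (Num.min r s); first by rewrite lt_min r0.
move=> w; rewrite lt_min => /andP[/hr h1 /hs h2].
rewrite (_ : _ - _ = (f w - f z - d * (w - z)) + (g w - g z - k * (w - z))); last by ring.
by apply: le_trans (mdD _ _) _; lra.
Qed.

Lemma hdM f g z d k : hd f z d -> hd g z k ->
  hd (fun w => f w * g w) z (d * g z + f z * k).
Proof.
move=> hf hg e e0.
pose A := md (g z) + md d + md (f z) + 1.
have A0 : 0 < A by rewrite /A; have := md_ge0 (g z); have := md_ge0 d; have := md_ge0 (f z); lra.
(* The error of the product rule splits into three terms, each at most [A * e' * md (w - z)]. *)
pose e' := Num.min 1 (e / (3 * A)).
have e'0 : 0 < e' by rewrite lt_min ltr01 divr_gt0 ?mulr_gt0.
have e'1 : e' <= 1 by rewrite ge_min lexx.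
have e'2 : e' * (3 * A) <= e.
  by rewrite -ler_pdivlMr ?mulr_gt0// ge_min lexx orbT.
have [r r0 hr] := hf _ e'0; have [s s0 hs] := hg _ e'0.
have [t t0 ht] := hd_cont hg e'0.
exists (Num.min r (Num.min s t)); first by rewrite !lt_min r0 s0.
move=> w; rewrite !lt_min => /and3P[/hr h1 /hs h2 /ht h3].
rewrite (_ : _ - _ = (f w - f z - d * (w - z)) * g w
   + d * (w - z) * (g w - g z) + f z * (g w - g z - k * (w - z))); last by ring.
have h4 : md (g w) <= md (g z) + 1 by have := md_dist (g w) (g z); lra.
have n0 := md_ge0 (w - z).
apply: le_trans (mdD3 _ _ _) _; rewrite !mdM.
have : md (f w - f z - d * (w - z)) * md (g w) <= e' * md (w - z) * A.
  apply: ler_pM; rewrite ?md_ge0//; apply: le_trans h4 _.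
  by rewrite /A; have := md_ge0 d; have := md_ge0 (f z); lra.
have : md d * md (w - z) * md (g w - g z) <= A * md (w - z) * e'.
  apply: ler_pM (ltW h3); rewrite ?mulr_ge0 ?md_ge0// ler_wpM2r ?md_ge0//.
  by rewrite /A; have := md_ge0 (g z); have := md_ge0 (f z); lra.
have : md (f z) * md (g w - g z - k * (w - z)) <= A * (e' * md (w - z)).
  apply: ler_pM; rewrite ?md_ge0//.
  by rewrite /A; have := md_ge0 (g z); have := md_ge0 d; lra.
have : e' * (3 * A) * md (w - z) <= e * md (w - z) by rewrite ler_wpM2r.
by nra.
Qed.

Lemma hd_comp f g z d k : hd f z d -> hd g (f z) k -> hd (g \o f) z (k * d).
Proof.
move=> hf hg e e0.
pose A := md d + md k + 2.
have A0 : 0 < A by rewrite /A; have := md_ge0 d; have := md_ge0 k; lra.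
pose e' := Num.min 1 (e / (2 * A)).
have e'0 : 0 < e' by rewrite lt_min ltr01 divr_gt0 ?mulr_gt0.
have e'1 : e' <= 1 by rewrite ge_min lexx.
have e'2 : e' * (2 * A) <= e.
  by rewrite -ler_pdivlMr ?mulr_gt0// ge_min lexx orbT.
have [r r0 hr] := hf _ e'0; have [s s0 hs] := hg _ e'0.
have [t t0 ht] := hd_cont hf s0.
exists (Num.min r t); first by rewrite !lt_min r0.
move=> w; rewrite !lt_min => /andP[/hr h1 /ht/hs h2] /=.
rewrite (_ : _ - _ = (g (f w) - g (f z) - k * (f w - f z))
   + k * (f w - f z - d * (w - z))); last by ring.
have n0 := md_ge0 (w - z).
have h4 : md (f w - f z) <= (md d + 1) * md (w - z).
  rewrite (_ : f w - f z = (f w - f z - d * (w - z)) + d * (w - z)); last by ring.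
  apply: le_trans (mdD _ _) _; rewrite mdM; nra.
apply: le_trans (mdD _ _) _; rewrite mdM.
have : md k * md (f w - f z - d * (w - z)) <= md k * (e' * md (w - z)).
  by rewrite ler_wpM2l ?md_ge0.
have : e' * md (f w - f z) <= e' * ((md d + 1) * md (w - z)).
  exact: (ler_wpM2l (ltW e'0)).
have : e' * (2 * A) * md (w - z) <= e * md (w - z) by rewrite ler_wpM2r.
have : 0 <= e' * md (w - z) by apply: mulr_ge0 => //; exact: ltW.
have := md_ge0 d; have := md_ge0 k; rewrite /A; nra.
Qed.

Lemma hdV z : z != 0 -> hd (fun w => w^-1) z (- (z ^- 2)).
Proof.
move=> z0 e e0; have mz : 0 < md z by rewrite md_gt0.
(* The first radius gives [md w > md z / 2]; the second then bounds the error, which is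
   [(w - z) ^+ 2 / (w * z ^+ 2)]. *)
exists (Num.min (md z / 2) (e * md z ^+ 3 / 2)).
  by rewrite lt_min !divr_gt0// mulr_gt0// exprn_gt0.
move=> w; rewrite lt_min => /andP[h1 h2].
have mw : md z / 2 < md w by have := md_dist z w; rewrite mdB; lra.
have w0 : w != 0 by rewrite -md_gt0; lra.
rewrite (_ : _ - _ = (w - z) * (w - z) / (w * z ^+ 2)); last by field; rewrite z0 w0.
rewrite !mdM mdV mdM mdX mulrAC ler_wpM2r ?md_ge0//.
rewrite ler_pdivrMr ?mulr_gt0 ?exprn_gt0 //; last by lra.
apply: le_trans (ltW h2) _.
have -> : e * md z ^+ 3 / 2 = e * (md z / 2 * md z ^+ 2) by field.
by apply: (ler_wpM2l (ltW e0)); rewrite ler_wpM2r ?sqr_ge0// ltW.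
Qed.

Lemma hd_uniq f z d k : hd f z d -> hd f z k -> d = k.
Proof.
move=> h1 h2; apply/eqP; rewrite -subr_eq0 -md_eq0 eq_le md_ge0 andbT.
apply/ler_addgt0Pl => e e0; rewrite addr0.
have e2 : 0 < e / 2 by lra.
have [r r0 hr] := h1 _ e2; have [s s0 hs] := h2 _ e2.
pose m := Num.min r s; have m0 : 0 < m by rewrite lt_min r0.
pose w := z + rc (m / 2).
have wz : md (w - z) = m / 2 by rewrite /w addrAC subrr add0r md_rc ger0_norm //; lra.
have mr : m <= r by rewrite ge_min lexx.
have ms : m <= s by rewrite ge_min lexx orbT.
have := hr w; have := hs w; rewrite !wz => /(_ ltac:(lra)) a /(_ ltac:(lra)) b.
have : md ((d - k) * (w - z)) <= e * (m / 2).
  rewrite (_ : (d - k) * (w - z) = (f w - f z - k * (w - z)) - (f w - f z - d * (w - z))); last by ring.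
  by apply: le_trans (mdD _ _) _; rewrite mdN; lra.
by rewrite mdM wz ler_pM2r//; lra.
Qed.

Lemma holo_near f g z (r : R) : 0 < r -> (forall w, md (w - z) < r -> f w = g w) ->
  holo f z -> holo g z.
Proof. by move=> r0 fg [d h]; exists d; exact: hd_near r0 fg h. Qed.
Lemma holo_cst c z : holo (fun=> c) z. Proof. by exists 0; exact: hd_cst. Qed.
Lemma holo_id z : holo id z. Proof. by exists 1; exact: hd_id. Qed.
Lemma holoD f g z : holo f z -> holo g z -> holo (fun w => f w + g w) z.
Proof. by move=> [d h] [k l]; exists (d + k); exact: hdD. Qed.
Lemma holoM f g z : holo f z -> holo g z -> holo (fun w => f w * g w) z.
Proof. by move=> [d h] [k l]; eexists; apply: hdM h l. Qed.
Lemma hdZ c f z d : hd f z d -> hd (fun w => c * f w) z (c * d).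
Proof.
by move=> h; have := hdM (hd_cst c z) h; rewrite mul0r add0r.
Qed.
Lemma holo_comp f g z : holo f z -> holo g (f z) -> holo (fun w => g (f w)) z.
Proof. by move=> [d h] [k l]; eexists; apply: (hd_comp h l). Qed.
Lemma holoN f z : holo f z -> holo (fun w => - f w) z.
Proof.
move=> h; apply: (@holo_near (fun w => -1 * f w) _ _ 1) => //.
  by move=> w _; rewrite mulN1r.
by apply: holoM => //; exact: holo_cst.
Qed.
Lemma holoB f g z : holo f z -> holo g z -> holo (fun w => f w - g w) z.
Proof. by move=> h k; apply: holoD => //; exact: holoN. Qed.
Lemma holoV f z : f z != 0 -> holo f z -> holo (fun w => (f w)^-1) z.
Proof.
by move=> f0 h; apply: (holo_comp h); eexists; exact: hdV.
Qed.
Lemma holoX f z n : holo f z -> holo (fun w => f w ^+ n) z.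
Proof.
move=> h; elim: n => [|n IH]; first exact: holo_cst.
by apply: (@holo_near (fun w => f w * f w ^+ n) _ _ 1) => //; [move=> w _; rewrite exprS|exact: holoM].
Qed.

End Derivative.

(** * Goursat's theorem for trapezoidal sums *)

Section Goursat.
Variable R : realType.
Local Notation C := (Cplx R).
Implicit Types (z u : C) (s t : R) (H K : C -> C) (c : R -> C).

Definition trapezoid H u (w : C) : C := (H u + H w) / 2 * (w - u).

(* The integral of [H] along [c], approximated by the trapezoidal rule on [2 ^ d] steps,
   which is exact for affine [H]. *)
Fixpoint trap (d : nat) H c (x y : R) : C :=
  if d is d'.+1 then trap d' H c x ((x + y) / 2) + trap d' H c ((x + y) / 2) y
  else trapezoid H (c x) (c y).

Lemma trapD d H K c x y :
  trap d (fun z => H z + K z) c x y = trap d H c x y + trap d K c x y.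
Proof.
elim: d x y => [|d IH] x y /=; first by rewrite /trapezoid; field.
by rewrite !IH; ring.
Qed.

Lemma trapZ d H c k x y : trap d (fun z => k * H z) c x y = k * trap d H c x y.
Proof.
elim: d x y => [|d IH] x y /=; first by rewrite /trapezoid; field.
by rewrite !IH; ring.
Qed.

Lemma eq_trap d H K c e x y : x <= y ->
  (forall t, x <= t <= y -> H (c t) = K (e t)) ->
  (forall s t, c t - c s = e t - e s) ->
  trap d H c x y = trap d K e x y.
Proof.
elim: d x y => [|d IH] x y xy HK ce /=.
  by rewrite /trapezoid !HK ?ce ?lexx ?xy.
rewrite (IH x) ?(IH _ y) // ?midf_le//; try lra.
- by move=> t ht; apply: HK; lra.
- by move=> t ht; apply: HK; lra.
Qed.

Lemma trap_affine d a b c x y : trap d (fun z => a + b * z) c x y =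
  a * (c y - c x) + b * (c y ^+ 2 - c x ^+ 2) / 2.
Proof.
elim: d x y => [|d IH] x y /=; first by rewrite /trapezoid; field.
by rewrite !IH; field.
Qed.

(** The bound of an integral by maximum times length. It is uniform in [d], so no integral has to be
    shown to exist: later statements concern all large [d]. *)
Lemma trap_bound d H c (M L x y : R) : 0 <= M -> x <= y ->
  (forall t, x <= t <= y -> md (H (c t)) <= M) ->
  (forall s t, x <= s <= y -> x <= t <= y -> md (c s - c t) <= L * `|s - t|) ->
  md (trap d H c x y) <= M * L * (y - x).
Proof.
elim: d x y => [|d IH] x y M0 xy hM hL /=.
  rewrite /trapezoid mdM -mulrA; apply: ler_pM; rewrite ?md_ge0//.
    rewrite mdM mdV -(rc2 R) md_rc (ger0_norm (_ : 0 <= 2))// ler_pdivrMr//.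
    apply: le_trans (mdD _ _) _.
    by have := hM x; have := hM y; rewrite !lexx xy => /(_ isT) a /(_ isT) b; lra.
  have := hL y x; rewrite !lexx xy => /(_ isT isT)/le_trans; apply.
  by rewrite ger0_norm ?subr_ge0.
apply: le_trans (mdD _ _) _.
have h1 := IH x ((x + y) / 2) M0; have h2 := IH ((x + y) / 2) y M0.
have {}h1 := h1 ltac:(lra); have {}h2 := h2 ltac:(lra).
apply: le_trans (lerD (h1 _ _) (h2 _ _)) _.
- by move=> t ht; apply: hM; lra.
- by move=> s t hs ht; apply: hL; lra.
- by move=> t ht; apply: hM; lra.
- by move=> s t hs ht; apply: hL; lra.
by rewrite le_eqVlt; apply/orP; left; apply/eqP; field.
Qed.

Definition square_trap d H (F : R -> R -> C) s t (w : R) : C :=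
  trap d H (F ^~ t) s (s + w) + trap d H (F (s + w)) t (t + w)
  - trap d H (F ^~ (t + w)) s (s + w) - trap d H (F s) t (t + w).

(** The inner edges cancel. Halving the sides uses up one level of depth, which is why [trap] works
    by bisection. *)
Lemma square_trap_split d H F s t w :
  square_trap d.+1 H F s t w =
  square_trap d H F s t (w / 2) + square_trap d H F (s + w / 2) t (w / 2) +
  square_trap d H F s (t + w / 2) (w / 2) +
  square_trap d H F (s + w / 2) (t + w / 2) (w / 2).
Proof.
rewrite /square_trap /=.
have mid a : (a + (a + w)) / 2 = a + w / 2 by field.
have dbl a : a + w / 2 + w / 2 = a + w by field.
by rewrite !mid !dbl; ring.
Qed.

Lemma square_trapD d H K F s t w : square_trap d (fun z => H z + K z) F s t w =
  square_trap d H F s t w + square_trap d K F s t w.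
Proof. by rewrite /square_trap !trapD; ring. Qed.

Lemma square_trap_affine d a b F s t w :
  square_trap d (fun z => a + b * z) F s t w = 0.
Proof. by rewrite /square_trap !trap_affine; field. Qed.

(** If [P] failed on the unit square, it would fail on nested squares that shrink to a point,
    against the second hypothesis at that point. Besides Goursat's theorem, this yields the uniform
    grid size in [no_winding_homotopy]. *)
Lemma square_ind (P : R -> R -> R -> Prop) :
  (forall s t w, 0 < w -> P s t (w / 2) -> P (s + w / 2) t (w / 2) ->
     P s (t + w / 2) (w / 2) -> P (s + w / 2) (t + w / 2) (w / 2) -> P s t w) ->
  (forall x y, 0 <= x <= 1 -> 0 <= y <= 1 -> exists2 e : R, 0 < e &
     forall s t w, 0 < w < e -> 0 <= s -> s + w <= 1 -> 0 <= t -> t + w <= 1 ->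
       s <= x <= s + w -> t <= y <= t + w -> P s t w) -> P 0 0 1.
Proof.
move=> Psplit Ploc; apply: contrapT => nP.
pose T : Type := {p : R * R * R | 0 < p.2 /\ ~ P p.1.1 p.1.2 p.2}.
pose sub (p q : R * R * R) := [/\ q.2 = p.2 / 2, p.1.1 <= q.1.1 /\
   q.1.1 + q.2 <= p.1.1 + p.2 & p.1.2 <= q.1.2 /\ q.1.2 + q.2 <= p.1.2 + p.2].
have step (p : T) : exists q : T, sub (sval p) (sval q).
  case: p => -[[s t] w] /= [w0 nPp].
  have w20 : 0 < w / 2 by lra.
  apply: contrapT => nq.
  have loc s' t' : s <= s' -> s' <= s + w / 2 -> t <= t' -> t' <= t + w / 2 ->
      P s' t' (w / 2).
    move=> h1 h2 h3 h4; apply: contrapT => nPq; apply: nq.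
    by exists (exist _ (s', t', w / 2) (conj w20 nPq)); split=> //=; split; lra.
  by apply: nPp; apply: Psplit => //; apply: loc; lra.
have [nxt hnxt] := choice step.
pose p0 : T := exist _ (0, 0, 1) (conj ltr01 nP).
pose p k := sval (iter k nxt p0).
have psub k : sub (p k) (p k.+1) by exact: hnxt.
have pw k : (p k).2 = 2 ^- k.
  elim: k => [|k IH]; first by rewrite expr0 invr1.
  by have [-> _ _] := psub k; rewrite IH exprSr invfM.
have pw0 k : 0 < (p k).2 by rewrite pw invr_gt0 exprn_gt0.
(* Nested intervals, for either coordinate [c] of the corners: the supremum of the left ends lies in
   all of them. *)
have main (c : R * R * R -> R) :
    c (p 0%N) = 0 ->
    (forall k, c (p k) <= c (p k.+1) /\ c (p k.+1) + (p k.+1).2 <= c (p k) + (p k).2) ->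
    exists2 x, 0 <= x <= 1 & forall k, [/\ 0 <= c (p k), c (p k) + (p k).2 <= 1 &
      c (p k) <= x <= c (p k) + (p k).2].
  move=> c0 hc.
  have inc j k : (j <= k)%N -> c (p j) <= c (p k).
    elim: k => [|k IH]; first by rewrite leqn0 => /eqP->.
    rewrite leq_eqVlt => /orP[/eqP->//|]; rewrite ltnS => /IH h.
    by apply: le_trans h _; case: (hc k).
  have dec j k : (j <= k)%N -> c (p k) + (p k).2 <= c (p j) + (p j).2.
    elim: k => [|k IH]; first by rewrite leqn0 => /eqP->.
    rewrite leq_eqVlt => /orP[/eqP->//|]; rewrite ltnS => /IH h.
    by apply: le_trans h; case: (hc k).
  have ub k j : c (p j) <= c (p k) + (p k).2.
    have [jk|/ltnW kj] := leqP j k.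
      by apply: le_trans (inc _ _ jk) _; rewrite lerDl ltW.
    by apply: le_trans (dec _ _ kj); rewrite lerDl ltW.
  have hs : has_sup (range (c \o p)).
    split; first by exists (c (p 0%N)); exists 0%N.
    by exists (c (p 0%N) + (p 0%N).2) => _ [j _ <-]; exact: ub.
  have sup1 k : c (p k) <= sup (range (c \o p)) by apply: sup_upper_bound => //; exists k.
  have sup2 k : sup (range (c \o p)) <= c (p k) + (p k).2.
    by apply: ge_sup; [case: hs|move=> _ [j _ <-]; exact: ub].
  have p02 : (p 0%N).2 = 1 by [].
  exists (sup (range (c \o p))).
    by have := sup1 0%N; have := sup2 0%N; rewrite c0 p02; lra.
  move=> k; split; [by rewrite -c0 inc| |by rewrite sup1 sup2].
  by have := dec 0%N k (leq0n k); rewrite c0 p02 add0r.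
have [||x x01 hx] := main (fun q => q.1.1) => //.
  by move=> k; case: (psub k).
have [||y y01 hy] := main (fun q => q.1.2) => //.
  by move=> k; case: (psub k).
have [e e0 he] := Ploc x y x01 y01.
have [k hk] : exists k : nat, (p k).2 < e.
  exists (Num.truncn e^-1).+1; rewrite pw -[ltRHS]invrK ltf_pV2 ?posrE ?invr_gt0 ?exprn_gt0//.
  apply: lt_le_trans (truncnS_gt _) _.
  by rewrite -natrX ler_nat ltnW// ltn_expl.
have [_ nPk] : 0 < (p k).2 /\ ~ P (p k).1.1 (p k).1.2 (p k).2.
  by rewrite /p; case: (iter k nxt p0).
apply: nPk; have [? ? ?] := hx k; have [? ? ?] := hy k.
by apply: he => //; rewrite pw0.
Qed.

Definition vanishes (x : nat -> C) := forall e : R, 0 < e ->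
  exists d0, forall d, (d0 <= d)%N -> md (x d) <= e.

Lemma vanishesD x y : vanishes x -> vanishes y -> vanishes (fun d => x d + y d).
Proof.
move=> hx hy e e0; have [|m hm] := hx (e / 2); first lra.
have [|n hn] := hy (e / 2); first lra.
exists (maxn m n) => d; rewrite geq_max => /andP[/hm h1 /hn h2].
by apply: le_trans (mdD _ _) _; lra.
Qed.

Lemma vanishesZ k x : vanishes x -> vanishes (fun d => k * x d).
Proof.
move=> hx e e0; have k0 : 0 < md k + 1 by have := md_ge0 k; lra.
have [|m hm] := hx (e / (md k + 1)); first by rewrite divr_gt0.
exists m => d /hm; rewrite ler_pdivlMr// mdM => h.
by have := md_ge0 (x d); nra.
Qed.

(** Near a point the integrand is affine up to a small error, and the sums of affine functions
    around a square vanish exactly. [F] is only Lipschitz, so that a homotopy of circles can be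
    taken for it. *)
Theorem goursat H F (L : R) :
  (forall s t, 0 <= s <= 1 -> 0 <= t <= 1 -> holo H (F s t)) ->
  (forall s t s' t', 0 <= s <= 1 -> 0 <= t <= 1 -> 0 <= s' <= 1 -> 0 <= t' <= 1 ->
     md (F s t - F s' t') <= L * (`|s - s'| + `|t - t'|)) ->
  vanishes (fun d => square_trap d H F 0 0 1).
Proof.
move=> Hh FL e e0.
(* A bound proportional to the area adds up over the four quarters of a square. *)
pose P s t w := exists d0, forall d, (d0 <= d)%N -> md (square_trap d H F s t w) <= e * w ^+ 2.
suff [d0 h] : P 0 0 1 by exists d0 => d /h; rewrite expr1n mulr1.
apply: square_ind.
  move=> s t w w0 [d1 h1] [d2 h2] [d3 h3] [d4 h4].
  exists (maxn (maxn d1 d2) (maxn d3 d4)).+1 => -[//|d]; rewrite ltnS !geq_max.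
  case/andP => /andP[/h1 {}h1 /h2 {}h2] /andP[/h3 {}h3 /h4 {}h4].
  rewrite square_trap_split.
  apply: le_trans (mdD _ _) _; apply: le_trans (lerD (mdD3 _ _ _) (lexx _)) _.
  have -> : e * w ^+ 2 = e * (w / 2) ^+ 2 + e * (w / 2) ^+ 2 + e * (w / 2) ^+ 2 + e * (w / 2) ^+ 2 by field.
  by lra.
move=> x y x01 y01; have [k hk] := Hh x y x01 y01.
have L0 : 0 <= L.
  have := FL 1 0 0 0 ltac:(lra) ltac:(lra) ltac:(lra) ltac:(lra).
  rewrite subr0 subrr normr1 normr0 addr0 mulr1; apply: le_trans; exact: md_ge0.
(* Each of the four edges contributes at most [e / A * (2 * L * w) * (L * w)]; [L + 1] keeps [A]
   positive. *)
pose A := 8 * (L + 1) ^+ 2.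
have A0 : 0 < A by rewrite /A; nra.
have e'0 : 0 < e / A by rewrite divr_gt0.
have [r r0 hr] := hk _ e'0.
exists (r / (2 * (L + 1))); first by rewrite divr_gt0//; lra.
move=> s t w /andP[w0 wr] s0 s1 t0 t1 sx ty; exists 0%N => d _.
have wr' : 2 * (L + 1) * w < r by move: wr; rewrite ltr_pdivlMr; [rewrite mulrC|lra].
pose H0 z := H z - H (F x y) - k * (z - F x y).
have -> : square_trap d H F s t w = square_trap d H0 F s t w.
  have HE : H = fun z => H0 z + ((H (F x y) - k * F x y) + k * z).
    by apply/funext => z; rewrite /H0; ring.
  by rewrite {1}HE square_trapD square_trap_affine addr0.
have near s' t' : s <= s' <= s + w -> t <= t' <= t + w -> md (F s' t' - F x y) <= 2 * L * w.
  move=> hs ht; apply: le_trans (FL _ _ _ _ _ _ _ _) _; try lra.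
  rewrite [_ * L]mulrC -mulrA; apply: (ler_wpM2l L0).
  have : `|s' - x| <= w by rewrite ler_norml; lra.
  have : `|t' - y| <= w by rewrite ler_norml; lra.
  by lra.
have H0b s' t' : s <= s' <= s + w -> t <= t' <= t + w -> md (H0 (F s' t')) <= e / A * (2 * L * w).
  move=> hs ht; have n := near _ _ hs ht.
  apply: le_trans (hr _ _) _; first by apply: le_lt_trans n _; nra.
  exact: (ler_wpM2l (ltW e'0)).
have side c a : 0 <= a -> a + w <= 1 ->
    (forall t', a <= t' <= a + w -> md (H0 (c t')) <= e / A * (2 * L * w)) ->
    (forall t' t'', 0 <= t' <= 1 -> 0 <= t'' <= 1 -> md (c t' - c t'') <= L * `|t' - t''|) ->
    md (trap d H0 c a (a + w)) <= e / A * (2 * L * w) * L * w.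
  move=> a0 a1 hb hl.
  have := @trap_bound d H0 c (e / A * (2 * L * w)) L a (a + w).
  rewrite (_ : a + w - a = w); last by ring.
  apply; [|lra|done|by move=> ? ? ? ?; apply: hl; lra].
  by rewrite mulr_ge0 ?(ltW e'0)// mulr_ge0 ?(ltW w0)// mulr_ge0.
have b1 : md (trap d H0 (F ^~ t) s (s + w)) <= e / A * (2 * L * w) * L * w.
  apply: side => // [t' ht'|t' t'' h1 h2]; first by apply: H0b => //; lra.
  by apply: le_trans (FL _ _ _ _ _ _ _ _) _; rewrite ?subrr ?normr0 ?addr0//; lra.
have b2 : md (trap d H0 (F (s + w)) t (t + w)) <= e / A * (2 * L * w) * L * w.
  apply: side => // [t' ht'|t' t'' h1 h2]; first by apply: H0b => //; lra.
  by apply: le_trans (FL _ _ _ _ _ _ _ _) _; rewrite ?subrr ?normr0 ?add0r//; lra.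
have b3 : md (trap d H0 (F ^~ (t + w)) s (s + w)) <= e / A * (2 * L * w) * L * w.
  apply: side => // [t' ht'|t' t'' h1 h2]; first by apply: H0b => //; lra.
  by apply: le_trans (FL _ _ _ _ _ _ _ _) _; rewrite ?subrr ?normr0 ?addr0//; lra.
have b4 : md (trap d H0 (F s) t (t + w)) <= e / A * (2 * L * w) * L * w.
  apply: side => // [t' ht'|t' t'' h1 h2]; first by apply: H0b => //; lra.
  by apply: le_trans (FL _ _ _ _ _ _ _ _) _; rewrite ?subrr ?normr0 ?add0r//; lra.
rewrite /square_trap.
apply: le_trans (mdD _ _) _; apply: le_trans (lerD (mdD3 _ _ _) (lexx _)) _; rewrite !mdN.
have -> : e * w ^+ 2 = e / A * (A * w ^+ 2) by field; rewrite gt_eqF.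
have : e / A * (4 * (2 * L * w) * L * w) <= e / A * (A * w ^+ 2).
  apply: (ler_wpM2l (ltW e'0)).
  rewrite (_ : 4 * (2 * L * w) * L * w = 8 * L ^+ 2 * w ^+ 2); last by ring.
  apply: ler_wpM2r; first exact: sqr_ge0.
  rewrite /A (_ : 8 * (L + 1) ^+ 2 = 8 * L ^+ 2 + (16 * L + 8)); last by ring.
  by lra.
by lra.
Qed.

End Goursat.

(** * Circles and Cauchy's formula *)

Section Circle.
Variable R : realType.
Local Notation C := (Cplx R).
Implicit Types (a z w u : C) (f g H : C -> C) (s t : R).

Definition cis t : C := Complex (cos (2 * pi * t)) (sin (2 * pi * t)).

Lemma cis0 : cis 0 = 1. Proof. by rewrite /cis mulr0 cos0 sin0. Qed.
Lemma cis1 : cis 1 = 1.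
Proof. by rewrite /cis mulr1 mulr_natl cos2pi sin2pi. Qed.
Lemma cisD s t : cis (s + t) = cis s * cis t.
Proof.
rewrite /cis mulrDr cosD sinD; apply/eqP; rewrite eq_complex /=.
by apply/andP; split; apply/eqP; ring.
Qed.
Lemma md_cis t : md (cis t) = 1.
Proof. by rewrite /md /= cos2Dsin2 sqrtr1. Qed.
Lemma cis_neq0 t : cis t != 0. Proof. by rewrite -md_eq0 md_cis oner_eq0. Qed.
Lemma cisN t : cis (- t) = (cis t)^-1.
Proof.
by apply: (mulfI (cis_neq0 t)); rewrite -cisD subrr cis0 mulfV ?cis_neq0.
Qed.
Lemma cis_half : cis (2^-1) = -1.
Proof.
rewrite /cis (_ : 2 * pi * 2^-1 = pi); last by field.
by rewrite cospi sinpi; apply/eqP; rewrite eq_complex /= oppr0 !eqxx.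
Qed.

Lemma lip_of_derive1 (f df : R -> R) (x y : R) :
  (forall t, is_derive t 1 f (df t)) -> (forall t, `|df t| <= 1) ->
  `|f x - f y| <= `|x - y|.
Proof.
move=> fd db; wlog xy : x y / x <= y => [W|].
  by have [/W//|/ltW/W] := leP x y; rewrite distrC [`|y - x|]distrC.
have [|c _ h] := @MVT_segment _ f df x y xy (fun t _ => fd t).
  by apply: derivable_within_continuous => t _; have [] := fd t.
by rewrite distrC [`|x - y|]distrC h normrM ler_piMl.
Qed.

(** The real and the imaginary part contribute [2 * pi <= 8] each. *)
Lemma cis_lip s t : md (cis s - cis t) <= 16 * `|s - t|.
Proof.
apply: le_trans (md_le_ReIm _) _ => /=.
have h1 : `|cos (2 * pi * s) - cos (2 * pi * t)| <= `|2 * pi * s - 2 * pi * t|.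
  apply: (@lip_of_derive1 _ (fun t => - sin t)) => x.
  by rewrite normrN ler_norml sin_geN1 sin_le1.
have h2 : `|sin (2 * pi * s) - sin (2 * pi * t)| <= `|2 * pi * s - 2 * pi * t|.
  apply: (@lip_of_derive1 _ cos) => x.
  by rewrite ler_norml cos_geN1 cos_le1.
have h3 : `|2 * pi * s - 2 * pi * t| <= 8 * `|s - t|.
  rewrite -mulrBr normrM ler_wpM2r// ger0_norm ?mulr_ge0 ?pi_ge0//.
  by have := pihalf_lt2 R; lra.
by lra.
Qed.

Definition circle a (r : R) t : C := a + rc r * cis t.

Lemma md_circle a r t : 0 <= r -> md (circle a r t - a) = r.
Proof. by move=> r0; rewrite /circle addrAC subrr add0r mdM md_cis md_rc mulr1 ger0_norm. Qed.

Lemma circle_lip a r s t : 0 <= r -> md (circle a r s - circle a r t) <= 16 * r * `|s - t|.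
Proof.
move=> r0; rewrite /circle (_ : _ - _ = rc r * (cis s - cis t)); last by ring.
by rewrite mdM md_rc ger0_norm// -mulrA mulrCA ler_wpM2l// cis_lip.
Qed.

Definition circle_trap d H a r := trap d H (circle a r) 0 1.

Lemma circle_trap_bound d H a r M : 0 <= M -> 0 <= r ->
  (forall t, md (H (circle a r t)) <= M) -> md (circle_trap d H a r) <= M * (16 * r).
Proof.
move=> M0 r0 hM; have := @trap_bound _ d H (circle a r) M (16 * r) 0 1 M0 ler01.
rewrite subr0 mulr1; apply => [t _|s t _ _]; [exact: hM|exact: circle_lip].
Qed.

(* Approximates [2 * pi * i]; the lower bound [4] below is all that is needed. *)
Definition winding_trap d := trap d (fun z => z^-1) cis 0 1.

(** A trapezoid of [1 / w] does not change when both its ends are scaled, so already the finite sums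
    are independent of the radius. *)
Lemma circle_trap_inv d z r : 0 < r ->
  circle_trap d (fun w => (w - z)^-1) z r = winding_trap d.
Proof.
move=> r0; rewrite /circle_trap /winding_trap.
have rr : rc r != 0 by rewrite rc_eq0 gt_eqF.
elim: d 0 1 => [|d IH] x y /=; last by rewrite !IH.
rewrite /trapezoid /circle; have := cis_neq0 x; have := cis_neq0 y => ey exx.
have E t : z + rc r * cis t - z = rc r * cis t by ring.
by rewrite !E; field; rewrite ey exx rr.
Qed.

(** The trapezoid over a chord of parameter length [h] is [(cis h - cis (- h)) / 2], and the
    [2 ^+ d] chords are equal. *)
Lemma trap_inv_cis d x h : trap d (fun z => z^-1) cis x (x + h) =
  Complex 0 (2 ^+ d * sin (2 * pi * (h / 2 ^+ d))).
Proof.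
elim: d x h => [|d IH] x h /=.
  rewrite /trapezoid expr0 mul1r divr1.
  have -> : ((cis x)^-1 + (cis (x + h))^-1) / 2 * (cis (x + h) - cis x) = (cis h - cis (- h)) / 2.
    by rewrite cisN cisD; have := cis_neq0 x; have := cis_neq0 h => e1 e2; field; rewrite e1 e2.
  rewrite /cis mulrN cosN sinN -rc2 -rcV; apply/eqP; rewrite eq_complex /=.
  by apply/andP; split; apply/eqP; field.
rewrite (_ : (x + (x + h)) / 2 = x + h / 2); last by field.
rewrite IH (_ : x + h = x + h / 2 + h / 2); last by field.
rewrite IH; apply/eqP; rewrite eq_complex /= addr0 eqxx /=; apply/eqP.
rewrite (_ : h / 2 / 2 ^+ d = h / 2 ^+ d.+1); last by rewrite exprS; field; rewrite expf_neq0.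
by rewrite exprS; ring.
Qed.

Lemma md_im (y : R) : md (Complex 0 y) = `|y|.
Proof. by rewrite /md /= expr0n /= add0r sqrtr_sqr. Qed.

(** The modulus is [2 ^+ d * sin (2 * pi / 2 ^+ d)], which is 4 at [d = 2] and does not decrease,
    because [sin (2 * x) <= 2 * sin x] for [x] between 0 and [pi]. *)
Lemma winding_trap_ge4 d : (2 <= d)%N -> 4 <= md (winding_trap d).
Proof.
rewrite /winding_trap -[1]add0r trap_inv_cis md_im mul1r => d2.
apply: le_trans (ler_norm _).
elim: d d2 => // d IH; rewrite leq_eqVlt => /orP[/eqP[<-]|].
  rewrite (_ : 2 * pi * 2 ^- 2 = pi / 2 :> R); last by field.
  by rewrite sin_pihalf; lra.
rewrite ltnS => d2; apply: le_trans (IH d2) _.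
have p2 : 0 < 2 ^+ d.+1 :> R by rewrite exprn_gt0.
have p1 : 0 < 2 ^+ d :> R by rewrite exprn_gt0.
set x : R := 2 * pi * 2 ^- d.+1.
have -> : 2 * pi * 2 ^- d = x *+ 2 :> R by rewrite /x mulr2n exprS; field; rewrite gt_eqF.
rewrite sin_mulr2n.
have x0 : 0 <= x by rewrite /x !mulr_ge0 ?pi_ge0// invr_ge0 ltW.
have xpi : x <= pi.
  rewrite /x ler_pdivrMr// mulrC ler_wpM2l ?pi_ge0// exprS.
  by rewrite ler_peMr// exprn_ege1//; lra.
have s0 : 0 <= sin x by apply: sin_ge0_pi; rewrite x0 xpi.
have h : cos x * sin x <= sin x by rewrite ler_piMl// cos_le1.
rewrite exprS mulr2n; have := ler_wpM2l (ltW p1) h; lra.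
Qed.

(** Centre and radius move linearly from [(a, r)] to [(z, e)]. The circles stay in the disc and
    avoid [z], since at time [s] the radius exceeds the distance [(1 - s) * md (z - a)] of [z] from
    the centre. They are closed, so the edges [t = 0] and [t = 1] cancel in Goursat's theorem. *)
Lemma circle_homotopy H a z (r e : R) : 0 < e -> md (z - a) + e <= r ->
  (forall w, w != z -> md (w - a) <= r -> holo H w) ->
  vanishes (fun d => circle_trap d H a r - circle_trap d H z e).
Proof.
move=> e0 zr hH; have m0 := md_ge0 (z - a).
pose F (s t : R) : C := a + rc s * (z - a) + rc (r + s * (e - r)) * cis t.
have h : vanishes (fun d => square_trap d H F 0 0 1).
  (* The Lipschitz constant is at most [2 * r] in [s], from centre and radius, and [16 * r] in [t],
     from [cis_lip]. *)
  apply: (@goursat R H F (18 * r)) => [s t s01 t01|s t s' t' s01 t01 s01' t01'].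
    have R0 : 0 <= r + s * (e - r) by nra.
    apply: hH.
      rewrite -subr_eq0 -md_gt0 (_ : F s t - z = rc (r + s * (e - r)) * cis t - rc (1 - s) * (z - a)); last first.
        by rewrite /F rcB rc1; ring.
      apply: lt_le_trans (md_dist _ _); rewrite !mdM md_cis !md_rc !ger0_norm //; last by lra.
      by nra.
    rewrite (_ : F s t - a = rc s * (z - a) + rc (r + s * (e - r)) * cis t); last by rewrite /F; ring.
    apply: le_trans (mdD _ _) _; rewrite !mdM md_cis !md_rc !ger0_norm//; last by lra.
    by nra.
  rewrite (_ : F s t - F s' t' = rc (s - s') * (z - a) + rc ((s - s') * (e - r)) * cis t +
    rc (r + s' * (e - r)) * (cis t - cis t')); last by rewrite /F !rcD !rcM !rcB; ring.
  apply: le_trans (mdD3 _ _ _) _; rewrite !mdM md_cis !md_rc mulr1 normrM.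
  have h1 : `|e - r| <= r by rewrite ler_norml; lra.
  have h2 : `|r + s' * (e - r)| <= r by rewrite ler_norml; apply/andP; split; nra.
  have h3 := cis_lip t t'; have a1 := normr_ge0 (s - s'); have a2 := normr_ge0 (t - t').
  have r0 : 0 <= r by lra.
  have h4 : `|r + s' * (e - r)| * md (cis t - cis t') <= r * (16 * `|t - t'|).
    by apply: ler_pM; rewrite ?md_ge0.
  have h5 : `|s - s'| * md (z - a) <= `|s - s'| * r by apply: ler_wpM2l => //; lra.
  have h6 : `|s - s'| * `|e - r| <= `|s - s'| * r by apply: ler_wpM2l.
  have := mulr_ge0 r0 a1; have := mulr_ge0 r0 a2.
  by lra.
move=> x x0; have [d0 hd0] := vanishesZ (-1) h x0.
exists d0 => d /hd0; rewrite mulN1r /square_trap add0r.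
have -> : F^~ 1 = F^~ 0 by apply/funext => s; rewrite /F cis0 cis1.
have -> : F 1 = circle z e.
  by apply/funext => t; rewrite /F /circle rc1 !mul1r (addrC r) subrK; ring.
have -> : F 0 = circle a r.
  by apply/funext => t; rewrite /F /circle !mul0r !addr0.
rewrite /circle_trap; apply: le_trans; rewrite le_eqVlt; apply/orP; left; apply/eqP; congr md.
by ring.
Qed.

(** Both [H], the difference quotient of [f] at [z], and [1 / (w - z)] are moved to a circle of
    small radius [b] about [z]. There [H] is bounded, so its sum is small, and the other sum is
    [winding_trap] exactly. *)
Theorem cauchy_formula f a r z : md (z - a) < r ->
  (forall w, md (w - a) <= r -> holo f w) ->
  vanishes (fun d => f z * winding_trap d - circle_trap d (fun w => f w / (w - z)) a r).
Proof.
move=> zr hf e e0.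
have m0 := md_ge0 (z - a).
have [k hk] := hf z (ltW zr); have [x x0 hx] := hk 1 ltr01.
pose K := md k + 1; have K0 : 0 < K by rewrite /K; have := md_ge0 k; lra.
pose H w := (f w - f z) / (w - z).
(* The last term makes the sum of [H] over the small circle, at most [16 * K * b], no larger than
   [e / 4]. *)
pose b := Num.min (x / 2) (Num.min ((r - md (z - a)) / 2) (e / (64 * K))).
have b0 : 0 < b.
  rewrite !lt_min; apply/and3P; split; [lra|lra|].
  by rewrite divr_gt0// mulr_gt0.
have bx : b < x by apply: (@le_lt_trans _ _ (x / 2)); [rewrite ge_min lexx|lra].
have br : md (z - a) + b <= r.
  have : b <= (r - md (z - a)) / 2 by rewrite ge_min ge_min lexx orbT.
  by lra.
have be : b * (64 * K) <= e.
  by rewrite -ler_pdivlMr ?mulr_gt0// ge_min ge_min lexx !orbT.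
have hH w : w != z -> md (w - a) <= r -> holo H w.
  move=> wz wr; apply: holoM; first by apply: holoB; [exact: hf|exact: holo_cst].
  apply: holoV; first by rewrite subr_eq0.
  by apply: holoB; [exact: holo_id|exact: holo_cst].
have hI w : w != z -> md (w - a) <= r -> holo (fun w => (w - z)^-1) w.
  move=> wz wr; apply: holoV; first by rewrite subr_eq0.
  by apply: holoB; [exact: holo_id|exact: holo_cst].
have e2 : 0 < e / 2 by lra.
have [d1 h1] := vanishesD (circle_homotopy b0 br hH) (vanishesZ (f z) (circle_homotopy b0 br hI)) e2.
exists d1 => d /h1; rewrite circle_trap_inv//.
have : md (circle_trap d H z b) <= K * (16 * b).
  apply: circle_trap_bound; [exact: ltW|exact: ltW|move=> t].
  have mc := md_circle z t (ltW b0).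
  rewrite /H mdM mdV mc ler_pdivrMr//.
  have := hx (circle z b t); rewrite mc mul1r => /(_ bx) h.
  rewrite (_ : f _ - f z = (f (circle z b t) - f z - k * (circle z b t - z)) + k * (circle z b t - z)); last by ring.
  by apply: le_trans (mdD _ _) _; rewrite mdM mc /K mulrDl mul1r addrC lerD2l.
have -> : circle_trap d (fun w => f w / (w - z)) a r =
   circle_trap d H a r + f z * circle_trap d (fun w => (w - z)^-1) a r.
  by rewrite /circle_trap -trapZ -trapD; congr trap; apply/funext => w; rewrite /H; ring.
set A := circle_trap d H a r; set B := circle_trap d H z b; set D := circle_trap d _ a r.
set W := winding_trap d => h2 h3.
rewrite (_ : _ - _ = - ((A - B) + f z * (D - W)) - B); last by ring.
by apply: le_trans (mdD _ _) _; rewrite !mdN; lra.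
Qed.

(** This divides Cauchy's formula by [winding_trap], for which the lower bound 4 suffices. *)
Lemma vanishes_bound (y : C) (x : nat -> C) (B : R) :
  vanishes (fun d => y * winding_trap d - x d) -> (forall d, md (x d) <= 4 * B) -> md y <= B.
Proof.
move=> hv hx; apply/ler_addgt0Pl => e e0.
have e4 : 0 < 4 * e by lra.
have [d0 h] := hv _ e4.
have := h (maxn d0 2) (leq_maxl _ _); have := winding_trap_ge4 (leq_maxr d0 2).
have := hx (maxn d0 2); set W := winding_trap _; set X := x _ => h1 h2 h3.
have : md y * 4 <= md (y * W).
  by rewrite mdM ler_wpM2l ?md_ge0.
have := md_dist (y * W) X; lra.
Qed.

End Circle.

(** * Cauchy estimates *)

Section Estimates.
Variable R : realType.
Local Notation C := (Cplx R).
Implicit Types (a z w u : C) (f g H : C -> C).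

(* Unlike differentiability, a bound on [dd f] passes to pointwise limits, and it
   implies differentiability. *)
Definition dd f z w u : C := (u - z) * (f w - f z) - (w - z) * (f u - f z).

(** The second divided difference of [f] is at most [B] in modulus; it is multiplied out so that
    points may coincide. *)
Definition dd_bounded f a (r B : R) := forall z w u,
  md (z - a) <= r -> md (w - a) <= r -> md (u - a) <= r ->
  md (dd f z w u) <= B * (md (u - z) * md (w - z) * md (w - u)).

(** Cauchy's formula at one point, as a hypothesis of its own: [removable] uses the estimates before
    [f] is known to be differentiable at [a]. *)
Definition cauchy_at f a (r : R) z :=
  vanishes (fun d => f z * winding_trap R d - circle_trap d (fun w => f w / (w - z)) a r).

Lemma circle_kernel a r t z : 0 < r -> md (z - a) <= r / 2 ->
  circle a r t - z != 0 /\ md (circle a r t - z)^-1 <= 2 / r.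
Proof.
move=> r0 zr; have h : r / 2 <= md (circle a r t - z).
  have := md_circle a t (ltW r0); have := md_tri z (circle a r t) a; lra.
have h0 : 0 < md (circle a r t - z) by lra.
rewrite -md_gt0 h0 mdV; split=> //.
by rewrite -[2 / r]invf_div lef_pV2 ?posrE//; lra.
Qed.

Lemma circle_trapD d H1 H2 a (r : R) :
  circle_trap d (fun w => H1 w + H2 w) a r = circle_trap d H1 a r + circle_trap d H2 a r.
Proof. exact: trapD. Qed.

Lemma circle_trapZ d k H a (r : R) :
  circle_trap d (fun w => k * H w) a r = k * circle_trap d H a r.
Proof. exact: trapZ. Qed.

Lemma eq_circle_trap d H1 H2 a (r : R) :
  (forall t, H1 (circle a r t) = H2 (circle a r t)) ->
  circle_trap d H1 a r = circle_trap d H2 a r.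
Proof. by move=> h; apply: eq_trap. Qed.

(** The constant 8 is [16 * r], the bound for the length, times the bound [2 / r] for the kernel,
    divided by 4. *)
Lemma cauchy_at_bound f a r M z : 0 < r -> 0 <= M -> md (z - a) <= r / 2 ->
  (forall t, md (f (circle a r t)) <= M) -> cauchy_at f a r z -> md (f z) <= 8 * M.
Proof.
move=> r0 M0 zr fM h; apply: vanishes_bound h _ => d.
have := @circle_trap_bound _ d (fun w => f w / (w - z)) a r (M * (2 / r)).
have -> : M * (2 / r) * (16 * r) = 4 * (8 * M) by field; rewrite gt_eqF.
apply; [by rewrite mulr_ge0// divr_ge0// ltW|exact: ltW|move=> t].
have [_ k] := circle_kernel t r0 zr.
by rewrite mdM; apply: ler_pM; rewrite ?md_ge0.
Qed.

Lemma cauchy_at_lip f a r M z w : 0 < r -> 0 <= M ->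
  md (z - a) <= r / 2 -> md (w - a) <= r / 2 ->
  (forall t, md (f (circle a r t)) <= M) -> cauchy_at f a r z -> cauchy_at f a r w ->
  md (f w - f z) <= 16 * M / r * md (w - z).
Proof.
move=> r0 M0 zr wr fM hz hw.
have := vanishesD hw (vanishesZ (-1) hz).
set x := (X in vanishes X); have -> : x = fun d => (f w - f z) * winding_trap R d -
   (w - z) * circle_trap d (fun x => f x * ((x - w)^-1 * (x - z)^-1)) a r.
  apply/funext => d; rewrite /x.
  rewrite -circle_trapZ.
  have -> : circle_trap d (fun x => (w - z) * (f x * ((x - w)^-1 * (x - z)^-1))) a r =
    circle_trap d (fun x => f x / (x - w) + (-1) * (f x / (x - z))) a r.
    apply: eq_circle_trap => t.
    have [n1 _] := circle_kernel t r0 zr; have [n2 _] := circle_kernel t r0 wr.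
    by field; rewrite n1 n2.
  by rewrite circle_trapD circle_trapZ; ring.
move=> h; apply: vanishes_bound h _ => d; rewrite mdM.
have := @circle_trap_bound _ d (fun x => f x * ((x - w)^-1 * (x - z)^-1)) a r (M * (2 / r * (2 / r))).
set T := circle_trap _ _ _ _ => h.
have -> : 4 * (16 * M / r * md (w - z)) = md (w - z) * (M * (2 / r * (2 / r)) * (16 * r)) by field; rewrite gt_eqF.
rewrite ler_wpM2l ?md_ge0// h; [done|by rewrite !mulr_ge0 ?invr_ge0 // ltW|exact: ltW|move=> t].
have [_ k1] := circle_kernel t r0 zr; have [_ k2] := circle_kernel t r0 wr.
by rewrite !mdM; do ![apply: ler_pM; rewrite ?mulr_ge0 ?md_ge0//].
Qed.

Lemma cauchy_at_dd f a r M z w u : 0 < r -> 0 <= M ->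
  md (z - a) <= r / 2 -> md (w - a) <= r / 2 -> md (u - a) <= r / 2 ->
  (forall t, md (f (circle a r t)) <= M) ->
  cauchy_at f a r z -> cauchy_at f a r w -> cauchy_at f a r u ->
  md (dd f z w u) <= 32 * M / r ^+ 2 * (md (u - z) * md (w - z) * md (w - u)).
Proof.
move=> r0 M0 zr wr ur fM hz hw hu.
(* Partial fractions: the combination of the three kernels that produces [dd f z w u] is
   [P / ((x - w) * (x - z) * (x - u))]. *)
have := vanishesD (vanishesD (vanishesZ (u - z) hw) (vanishesZ (- (w - z)) hu)) (vanishesZ (w - u) hz).
set x := (X in vanishes X).
pose K x := f x * ((x - w)^-1 * (x - z)^-1 * (x - u)^-1).
pose P := (u - z) * (w - z) * (w - u).
have -> : x = fun d => dd f z w u * winding_trap R d - P * circle_trap d K a r.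
  apply/funext => d; rewrite /x -circle_trapZ.
  have -> : circle_trap d (fun x => P * K x) a r =
    circle_trap d (fun x => (u - z) * (f x / (x - w)) + (- (w - z)) * (f x / (x - u)) + (w - u) * (f x / (x - z))) a r.
    apply: eq_circle_trap => t; rewrite /P /K.
    have [n1 _] := circle_kernel t r0 zr; have [n2 _] := circle_kernel t r0 wr.
    have [n3 _] := circle_kernel t r0 ur.
    by field; rewrite n1 n2 n3.
  by rewrite !circle_trapD !circle_trapZ /dd; ring.
move=> h; apply: vanishes_bound h _ => d; rewrite mdM /P !mdM.
have := @circle_trap_bound _ d K a r (M * (2 / r * (2 / r) * (2 / r))).
set T := circle_trap _ _ _ _ => h.
have -> : 4 * (32 * M / r ^+ 2 * (md (u - z) * md (w - z) * md (w - u))) =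
  md (u - z) * md (w - z) * md (w - u) * (M * (2 / r * (2 / r) * (2 / r)) * (16 * r)).
  by field; rewrite gt_eqF.
rewrite ler_wpM2l ?mulr_ge0 ?md_ge0// h; [done|by rewrite !mulr_ge0 ?invr_ge0 // ltW|exact: ltW|move=> t].
have [_ k1] := circle_kernel t r0 zr; have [_ k2] := circle_kernel t r0 wr.
have [_ k3] := circle_kernel t r0 ur.
by rewrite /K !mdM; do ![apply: ler_pM; rewrite ?mulr_ge0 ?md_ge0//].
Qed.

Section HoloDisc.
Variables (f : C -> C) (a : C) (r M : R).
Hypotheses (r0 : 0 < r) (M0 : 0 <= M) (fh : forall w, md (w - a) <= r -> holo f w)
  (fM : forall t, md (f (circle a r t)) <= M).

Let cf z : md (z - a) <= r / 2 -> cauchy_at f a r z.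
Proof.
move=> zr; apply: cauchy_formula fh; apply: le_lt_trans zr _.
by move: r0 => ?; lra.
Qed.

Lemma cauchy_bound z : md (z - a) <= r / 2 -> md (f z) <= 8 * M.
Proof. by move=> h; exact: (cauchy_at_bound r0 M0 h fM (cf h)). Qed.

Lemma cauchy_lip z w : md (z - a) <= r / 2 -> md (w - a) <= r / 2 ->
  md (f w - f z) <= 16 * M / r * md (w - z).
Proof. by move=> h k; exact: (cauchy_at_lip r0 M0 h k fM (cf h) (cf k)). Qed.

Lemma cauchy_dd : dd_bounded f a (r / 2) (32 * M / r ^+ 2).
Proof. by move=> z w u h k l; exact: (cauchy_at_dd r0 M0 h k l fM (cf h) (cf k) (cf l)). Qed.

End HoloDisc.

End Estimates.

(** * Limits along an ultrafilter *)

Section UltraLimits.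
Variables (R : realType) (I : Type) (U : set_system I).
Context {UU : UltraFilter U}.
Local Notation C := (Cplx R).
Implicit Types (x y : I -> C) (l m : C).

Let PU : ProperFilter U := ultra_proper.
Local Existing Instance PU.

(** Every bounded family has such a limit ([ulim_ex]). One ultrafilter serves all points of a curve
    at once, where subsequences would call for a diagonal argument. *)
Definition ulim x l := forall e : R, 0 < e -> U [set i | md (x i - l) < e].

Lemma ulim_ex_real (x : I -> R) (M : R) : U [set i | `|x i| <= M] ->
  exists l : R, forall e, 0 < e -> U [set i | `|x i - l| < e].
Proof.
move=> h; pose F : set_system R := x @ U.
have UF : UltraFilter F.
  split; first exact: fmap_proper_filter.
  move=> G PG FG; apply/seteqP; split=> [A GA|]; last exact: FG.
  have [//|h1] := in_ultra_setVsetC (x @^-1` A) UU.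
  have : G (~` A) by exact: FG.
  by move=> GnA; have [y []] := filter_ex (filterI GA GnA).
have := @segment_compact R (- M) M; rewrite compact_ultra => /(_ F UF).
case.
  by move: h; apply: (@filterS I U) => i; rewrite /preimage /= in_itv /= ler_norml.
move=> l [_ hl]; exists l => e e0.
have := hl _ (nbhsx_ballx l e e0).
by apply: (@filterS I U) => i; rewrite /preimage /ball /= distrC.
Qed.

Lemma ulim_ex x (M : R) : U [set i | md (x i) <= M] -> exists l, ulim x l.
Proof.
move=> h.
have [|a ha] := @ulim_ex_real (fun i => complex.Re (x i)) M.
  by apply: filterS h => i /=; apply: le_trans; exact: Re_le_md.
have [|b hb] := @ulim_ex_real (fun i => complex.Im (x i)) M.
  by apply: filterS h => i /=; apply: le_trans; exact: Im_le_md.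
exists (Complex a b) => e e0; have e2 : 0 < e / 2 by lra.
apply: filterS (filterI (ha _ e2) (hb _ e2)) => i [/= h1 h2].
apply: le_lt_trans (md_le_ReIm _) _.
by case: (x i) h1 h2 => c d /= h1 h2; lra.
Qed.

Lemma ulim_eq x y l : U [set i | x i = y i] -> ulim x l -> ulim y l.
Proof. by move=> h k e /k; apply: filterS2 h => i /= ->. Qed.

Lemma ulim_cst l : ulim (fun=> l) l.
Proof. by move=> e e0; apply: filterS filterT => i _ /=; rewrite subrr md0. Qed.

Lemma ulim_ge x l (M : R) : U [set i | M <= md (x i)] -> ulim x l -> M <= md l.
Proof.
move=> h k; apply/ler_addgt0Pl => e e0.
have [i [/= h1 h2]] := filter_ex (filterI h (k _ e0)).
by have := md_dist (x i) l; lra.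
Qed.

Lemma ulim_le x l (M : R) : U [set i | md (x i) <= M] -> ulim x l -> md l <= M.
Proof.
move=> h k; apply/ler_addgt0Pl => e e0.
have [i [/= h1 h2]] := filter_ex (filterI h (k _ e0)).
by have := md_dist l (x i); rewrite mdB; lra.
Qed.

Lemma ulimD x y l m : ulim x l -> ulim y m -> ulim (fun i => x i + y i) (l + m).
Proof.
move=> h k e e0; have e2 : 0 < e / 2 by lra.
apply: filterS (filterI (h _ e2) (k _ e2)) => i [/= h1 h2].
rewrite (_ : _ - _ = (x i - l) + (y i - m)); last by ring.
by apply: le_lt_trans (mdD _ _) _; lra.
Qed.

Lemma ulimM x y l m : ulim x l -> ulim y m -> ulim (fun i => x i * y i) (l * m).
Proof.
move=> h k e e0.
pose A := md l + md m + 1.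
have A0 : 0 < A by rewrite /A; have := md_ge0 l; have := md_ge0 m; lra.
pose e' := Num.min 1 (e / (2 * A)).
have e'0 : 0 < e' by rewrite lt_min ltr01 divr_gt0 ?mulr_gt0.
have e'1 : e' <= 1 by rewrite ge_min lexx.
have e'2 : e' * (2 * A) <= e by rewrite -ler_pdivlMr ?mulr_gt0// ge_min lexx orbT.
apply: filterS (filterI (h _ e'0) (k _ e'0)) => i [/= h1 h2].
rewrite (_ : _ - _ = (x i - l) * y i + l * (y i - m)); last by ring.
apply: le_lt_trans (mdD _ _) _; rewrite !mdM.
have h3 : md (y i) <= A by rewrite /A; have := md_dist (y i) m; have := md_ge0 l; lra.
have h4 : md (x i - l) * md (y i) <= md (x i - l) * A by rewrite ler_wpM2l ?md_ge0.
have h5 : md l * md (y i - m) <= A * md (y i - m).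
  by rewrite ler_wpM2r ?md_ge0// /A; have := md_ge0 m; lra.
have h6 : A * md (x i - l) < A * e' by rewrite ltr_pM2l.
have h7 : A * md (y i - m) < A * e' by rewrite ltr_pM2l.
by lra.
Qed.

Lemma ulimB x y l m : ulim x l -> ulim y m -> ulim (fun i => x i - y i) (l - m).
Proof.
move=> h k; have := ulimD h (ulimM (ulim_cst (-1)) k); rewrite mulN1r.
by apply: ulim_eq; apply: filterS filterT => i _ /=; rewrite mulN1r.
Qed.

Lemma ulim_uniq x l m : ulim x l -> ulim x m -> l = m.
Proof.
move=> h k; apply/eqP; rewrite -subr_eq0 -md_eq0 eq_le md_ge0 andbT.
apply: ulim_le (ulimB h k); apply: filterS filterT => i _ /=; by rewrite subrr md0.
Qed.

Lemma ulimV x l : l != 0 -> ulim x l -> ulim (fun i => (x i)^-1) l^-1.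
Proof.
move=> l0 h e e0; have m0 : 0 < md l by rewrite md_gt0.
have m2 : 0 < md l / 2 by lra.
have m3 : 0 < e * (md l / 2 * md l) by rewrite !mulr_gt0.
apply: filterS (filterI (h _ m2) (h _ m3)) => i [/= h1 h2].
have h3 : md l / 2 < md (x i) by have := md_dist l (x i); rewrite mdB; lra.
have x0 : x i != 0 by rewrite -md_gt0; lra.
rewrite (_ : _ - _ = (l - x i) / (x i * l)); last by field; rewrite l0 x0.
rewrite mdM mdV mdM mdB ltr_pdivrMr; last by rewrite mulr_gt0 ?md_gt0.
apply: lt_le_trans h2 _; apply: (ler_wpM2l (ltW e0)).
by rewrite ler_wpM2r// ltW.
Qed.

Lemma ulim_zero x y (K : R) : U [set i | md (x i) <= K * md (y i)] -> ulim y 0 -> ulim x 0.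
Proof.
move=> h k e e0; have [K0|K0] := leP K 0.
  apply: filterS h => i /= h; rewrite subr0; apply: le_lt_trans h _.
  by apply: le_lt_trans e0; rewrite mulr_le0_ge0 ?md_ge0.
have eK : 0 < e / K by rewrite divr_gt0.
apply: filterS (filterI h (k _ eK)) => i /= []; rewrite !subr0 => h1.
by rewrite ltr_pdivlMr// mulrC; exact: le_lt_trans.
Qed.

End UltraLimits.

(** * From divided differences to derivatives *)

Section DividedDifferences.
Variable R : realType.
Local Notation C := (Cplx R).
Implicit Types (a z w u d : C) (f g : C -> C).

Lemma exists_small_point z (e : R) : 0 < e -> exists2 u, u != z & md (u - z) < e.
Proof.
move=> e0; exists (z + rc (e / 2)).
  rewrite -subr_eq0 (_ : _ - z = rc (e / 2)); last by ring.
  by rewrite rc_eq0 gt_eqF// divr_gt0.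
rewrite (_ : _ - z = rc (e / 2)); last by ring.
by rewrite md_rc ger0_norm; lra.
Qed.

(** Divide the bound on [dd f z w u] by [u - z] and let [u] tend to [z]. *)
Lemma dd_bounded_quad f a (r B : R) z d w : dd_bounded f a r B -> 0 <= B ->
  md (z - a) < r -> hd f z d -> md (w - a) <= r ->
  md (f w - f z - d * (w - z)) <= B * md (w - z) ^+ 2.
Proof.
move=> hB B0 zr hf wr; apply/ler_addgt0Pr => e e0.
have n0 := md_ge0 (w - z).
pose K := md (w - z) * (B + 1) + 1; have K0 : 0 < K by rewrite /K; nra.
have eK : 0 < e / K by rewrite divr_gt0.
have [s s0 hs] := hf _ eK.
have rz : 0 < r - md (z - a) by lra.
have [u uz us] := @exists_small_point z (Num.min s (Num.min (r - md (z - a)) (e / K))) ltac:(rewrite !lt_min s0 rz eK//).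
move: us; rewrite !lt_min => /and3P[/hs h1 h2 h3].
have ur : md (u - a) <= r by have := md_tri z u a; lra.
have := hB z w u (ltW zr) wr ur; rewrite /dd.
have uz0 : 0 < md (u - z) by rewrite md_gt0 subr_eq0.
set X := f w - f z - _; set Y := f u - f z - d * (u - z) in h1 *.
rewrite (_ : _ - _ = (u - z) * X - (w - z) * Y); last by rewrite /X /Y; ring.
move=> h4; have h5 := md_dist ((u - z) * X) ((w - z) * Y).
have h6 : md (u - z) * md X <= md (u - z) * (B * md (w - z) ^+ 2 + e).
  rewrite -mdM.
  have wu : md (w - u) <= md (w - z) + md (u - z).
    by have := md_tri z w u; rewrite [md (z - u)]mdB.
  have h7 : md ((w - z) * Y) <= md (w - z) * (e / K * md (u - z)) by rewrite mdM ler_wpM2l.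
  have h8 : B * (md (u - z) * md (w - z) * md (w - u)) <=
     B * (md (u - z) * md (w - z) * (md (w - z) + md (u - z))).
    by rewrite ler_wpM2l// ler_wpM2l// mulr_ge0// ltW.
  have h9 : e / K * K = e by field; rewrite gt_eqF.
  have h10 : md (u - z) * (md (w - z) * (B * md (u - z) + e / K)) <= md (u - z) * e.
    apply: (ler_wpM2l (ltW uz0)); rewrite -[leRHS]h9.
    set q := e / K in eK h3 *.
    have : md (w - z) * (B * md (u - z)) <= md (w - z) * (B * q).
      by apply: (ler_wpM2l n0); apply: (ler_wpM2l B0); exact: ltW.
    by rewrite /K; lra.
  nra.
by rewrite ler_pM2l in h6.
Qed.

(** The difference quotients with steps [h n] are bounded, so they have a limit [l] along an
    ultrafilter; the bound on [dd] passes to this limit and makes [l] the derivative. *)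
Lemma dd_bounded_holo f a (r B : R) z : dd_bounded f a r B -> 0 <= B ->
  md (z - a) < r -> holo f z.
Proof.
move=> hB B0 zr.
pose rho := r - md (z - a); have rho0 : 0 < rho by rewrite /rho; lra.
have [U [UU hU]] := @ultraFilterLemma nat \oo _.
have PU := @ultra_proper _ _ UU.
(* With [n.+2] in the denominator, [z + h n] lies in the disc already for [n = 0]. *)
pose h n : C := rc (rho / (n.+2)%:R).
have h0 n : h n != 0 by rewrite rc_eq0 gt_eqF// divr_gt0.
have mh n : md (h n) = rho / n.+2%:R by rewrite md_rc ger0_norm// ltW// divr_gt0.
have hlt n : md (h n) < rho by rewrite mh ltr_pdivrMr// ltr_pMr// ltr1n.
have ulh : ulim U h 0.
  move=> e e0; apply: hU; exists (Num.truncn (rho / e)) => // n ln /=.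
  rewrite subr0 mh ltr_pdivrMr// mulrC -ltr_pdivrMr//.
  apply: lt_le_trans (truncnS_gt _) _; rewrite ler_nat.
  by apply: leq_trans (leqnSn _); rewrite ltnS.
pose q n := (f (z + h n) - f z) / h n.
have inr n : md (z + h n - a) <= r.
  rewrite (_ : z + h n - a = h n + (z - a)); last by ring.
  by apply: le_trans (mdD _ _) _; have := hlt n; rewrite /rho; lra.
have main w n : md (w - a) <= r ->
    md (f w - f z - q n * (w - z)) <= B * md (w - z) * md (w - z - h n).
  move=> wr; have := hB z w (z + h n) (ltW zr) wr (inr n).
  have m0 : 0 < md (h n) by rewrite md_gt0.
  rewrite (_ : dd _ _ _ _ = h n * (f w - f z - q n * (w - z))); last first.
    by rewrite /dd /q; move: (h n) (h0 n) => k k0; field.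
  rewrite (_ : z + h n - z = h n); last by ring.
  rewrite (_ : w - (z + h n) = w - z - h n); last by ring.
  rewrite mdM (_ : B * _ = md (h n) * (B * md (w - z) * md (w - z - h n))); last by ring.
  by rewrite ler_pM2l.
have [l hl] : exists l, ulim U q l.
  (* Any fixed point of the disc other than [z] turns [main] into a bound for [q n]. *)
  pose w := z + h 0%N.
  have w0 : w - z = h 0%N by rewrite /w; ring.
  have mw : 0 < md (w - z) by rewrite w0 md_gt0.
  pose K := md (f w - f z) + B * md (w - z) * (md (w - z) + rho).
  apply: (@ulim_ex R nat U UU q (K / md (w - z))).
  apply: filterS filterT => n _ /=; rewrite ler_pdivlMr// -mdM.
  have := main w n (inr 0%N).
  have := md_dist (q n * (w - z)) (f w - f z); rewrite [md (_ - (f w - f z))]mdB.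
  have : B * md (w - z) * md (w - z - h n) <= B * md (w - z) * (md (w - z) + rho).
    rewrite ler_wpM2l ?mulr_ge0 ?md_ge0//.
    by apply: le_trans (mdD _ _) _; rewrite mdN; have := hlt n; lra.
  by rewrite /K; lra.
have lim w : md (w - a) <= r -> md (f w - f z - l * (w - z)) <= B * md (w - z) ^+ 2.
  move=> wr; apply/ler_addgt0Pr => e e0.
  have n0 := md_ge0 (w - z).
  have k0 : 0 < e / (B * md (w - z) + 1) by rewrite divr_gt0//; nra.
  have hl' : ulim U (fun n => f w - f z - q n * (w - z)) (f w - f z - l * (w - z)).
    by apply: ulimB; [exact: ulim_cst|apply: ulimM => //; exact: ulim_cst].
  apply: ulim_le hl'; apply: filterS (ulh _ k0) => n /=; rewrite subr0 ltr_pdivlMr ?ltr_wpDl ?mulr_ge0// => hn.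
  apply: le_trans (main _ n wr) _.
  have := mdD (w - z) (- h n); rewrite mdN => t.
  have : B * md (w - z) * md (w - z - h n) <= B * md (w - z) * (md (w - z) + md (h n)).
    by rewrite ler_wpM2l// mulr_ge0.
  by have := md_ge0 (h n); nra.
exists l => e e0.
exists (Num.min rho (e / (B + 1))); first by rewrite lt_min rho0 divr_gt0//; lra.
move=> w; rewrite lt_min => /andP[h1]; rewrite ltr_pdivlMr; last by lra.
move=> h2; apply: le_trans (lim _ _) _.
  by have := md_tri z w a; rewrite /rho in h1; lra.
have := md_ge0 (w - z) => n0; rewrite expr2 mulrA ler_wpM2r//; nra.
Qed.

End DividedDifferences.

(** * Limits of bounded families of holomorphic functions *)

Section LimitsOfHolomorphic.
Variables (R : realType) (I : Type) (U : set_system I).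
Context {UU : UltraFilter U}.
Local Notation C := (Cplx R).
Implicit Types (a z w u d : C) (g : C -> C).

Let PU : ProperFilter U := ultra_proper.
Local Existing Instance PU.

Variables (f : I -> C -> C) (a : C) (r M : R).
Hypotheses (M0 : 0 <= M)
  (fh : U [set i | forall w, md (w - a) < r -> holo (f i) w /\ md (f i w) <= M]).

Lemma holo_ulim_ex : exists g, forall z, md (z - a) < r -> ulim U (f ^~ z) (g z).
Proof.
have h z : exists l, md (z - a) < r -> ulim U (f ^~ z) l.
  have [zr|] := ltP (md (z - a)) r; last by exists 0.
  have [|l hl] := @ulim_ex R I U UU (f ^~ z) M; last by exists l.
  by apply: filterS fh => i /= /(_ _ zr) [].
by have [g hg] := choice h; exists g.
Qed.

Variable g : C -> C.
Hypothesis fg : forall z, md (z - a) < r -> ulim U (f ^~ z) (g z).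

(** Cauchy estimates on the disc of radius [2 * s] about [z], which stays inside the given one.
    Their constants do not depend on [i]. *)
Let sub z : md (z - a) < r -> exists2 s : R, 0 < s & U [set i |
  dd_bounded (f i) z s (32 * M / (2 * s) ^+ 2) /\
  (forall x y, md (x - z) <= s -> md (y - z) <= s ->
     md (f i y - f i x) <= 16 * M / (2 * s) * md (y - x))] /\
  forall w, md (w - z) <= s -> md (w - a) < r.
Proof.
move=> zr; pose s := (r - md (z - a)) / 4.
have s0 : 0 < s by rewrite /s; lra.
have h w : md (w - z) <= 2 * s -> md (w - a) < r.
  by have := md_tri z w a; rewrite /s; lra.
exists s => //; split; last by move=> w k; apply: h; lra.
apply: filterS fh => i /= hi.
have s20 : 0 < 2 * s by lra.
have h1 : forall w, md (w - z) <= 2 * s -> holo (f i) w by move=> w /h /hi [].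
have h2 : forall t, md (f i (circle z (2 * s) t)) <= M.
  by move=> t; have [] := hi (circle z (2 * s) t) _ => //; apply: h; rewrite md_circle // ltW.
have e : 2 * s / 2 = s by field.
split; first by have := cauchy_dd s20 M0 h1 h2; rewrite e.
by move=> x y hx hy; apply: (cauchy_lip s20 M0 h1 h2); rewrite e.
Qed.

Lemma dd_bounded_ulim z s B : (forall w, md (w - z) <= s -> md (w - a) < r) ->
  U [set i | dd_bounded (f i) z s B] -> dd_bounded g z s B.
Proof.
move=> hs h x y u hx hy hu.
have hl : ulim U (fun i => dd (f i) x y u) (dd g x y u).
  have fx := fg (hs x hx); have fy := fg (hs y hy); have fu := fg (hs u hu).
  apply: ulimB; apply: ulimM; try exact: ulim_cst; exact: ulimB.
by apply: ulim_le hl; apply: filterS h => i /= hi; exact: hi.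
Qed.

Lemma holo_ulim z : md (z - a) < r -> holo g z.
Proof.
move=> zr; have [s s0 [h hs]] := sub zr.
apply: (@dd_bounded_holo _ g z s (32 * M / (2 * s) ^+ 2)); rewrite ?subrr ?md0//.
  by apply: dd_bounded_ulim => //; apply: filterS h => i /= [].
by rewrite divr_ge0 ?mulr_ge0 ?exprn_ge0 ?mulr_ge0// ltW.
Qed.

(** Derivatives converge too: at a single nearby point [w], both [f i] and [g] agree with their
    linear parts up to [B * md (w - z) ^+ 2]. *)
Lemma hd_ulim z (df : I -> C) d : md (z - a) < r -> U [set i | hd (f i) z (df i)] ->
  hd g z d -> ulim U df d.
Proof.
move=> zr hdf hg; have [s s0 [h hs]] := sub zr.
set B := 32 * M / (2 * s) ^+ 2 in h.
have B0 : 0 <= B by rewrite divr_ge0 ?mulr_ge0 ?exprn_ge0 ?mulr_ge0// ltW.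
have gB : dd_bounded g z s B.
  by apply: dd_bounded_ulim => //; apply: filterS h => i /= [].
have zz : md (z - z) < s by rewrite subrr md0.
move=> e e0.
(* The two quadratic errors and the two differences of values are at most [t * e / 4] each. *)
pose t := Num.min s (e / (4 * (B + 1))).
have B1 : 0 < 4 * (B + 1) by lra.
have t0 : 0 < t by rewrite lt_min s0 divr_gt0.
have ts : t <= s by rewrite ge_min lexx.
have te : t * (4 * (B + 1)) <= e by rewrite -ler_pdivlMr// ge_min lexx orbT.
pose w := z + rc t.
have wz : md (w - z) = t by rewrite /w (_ : _ - z = rc t) ?md_rc ?ger0_norm ?ltW //; ring.
have ws : md (w - z) <= s by rewrite wz.
have k0 : 0 < t * e / 4 by rewrite divr_gt0// mulr_gt0.
apply: filterS (filterI (filterI hdf h) (filterI (fg (hs w ws) k0) (fg zr k0))).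
move=> i [[/= h1 [h2 _]] [/= h3 h4]].
have q1 := dd_bounded_quad h2 B0 zz h1 ws.
have q2 := dd_bounded_quad gB B0 zz hg ws.
have : md ((df i - d) * (w - z)) < e * t.
  rewrite (_ : _ * _ = (g w - g z - d * (w - z)) - (f i w - f i z - df i * (w - z))
    + ((f i w - g w) - (f i z - g z))); last by ring.
  apply: le_lt_trans (mdD _ _) _.
  apply: le_lt_trans (lerD (mdD _ _) (mdD _ _)) _; rewrite !mdN.
  rewrite wz in q1 q2.
  have : B * t ^+ 2 <= t * e / 4.
    have : t * (t * (4 * (B + 1))) <= t * e by rewrite ler_pM2l.
    by have := sqr_ge0 t; nra.
  have te0 : 0 < t * e by rewrite mulr_gt0.
  by lra.
by rewrite mdM wz ltr_pM2r.
Qed.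

(** The Lipschitz constants from [sub] are common to all [f i], so the argument may move with
    [i]. *)
Lemma ulim_diag z (zi : I -> C) : md (z - a) < r -> ulim U zi z ->
  ulim U (fun i => f i (zi i)) (g z).
Proof.
move=> zr hz; have [s s0 [h hs]] := sub zr.
have hd0 : ulim U (fun i => f i (zi i) - f i z) 0.
  apply: (@ulim_zero _ _ _ _ _ (fun i => zi i - z) (16 * M / (2 * s))).
    apply: filterS (filterI h (hz _ s0)) => i [/= [_ h2] h3].
    by apply: h2; [rewrite subrr md0 ltW|exact: ltW].
  by rewrite -(subrr z); apply: ulimB => //; exact: ulim_cst.
pose proof (ulimD hd0 (fg zr)) as h0; rewrite add0r in h0.
refine (ulim_eq _ h0).
by apply: filterS filterT => i _ /=; ring.
Qed.

End LimitsOfHolomorphic.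

(** * Removable singularities and isolated zeros *)

Section Removable.
Variable R : realType.
Local Notation C := (Cplx R).
Implicit Types (a z w u : C) (f g : C -> C).

Lemma winding_trap_bound d : md (winding_trap R d) <= 16.
Proof.
rewrite -(circle_trap_inv d 0 ltr01).
have -> : 16 = 1 * (16 * 1) :> R by ring.
apply: circle_trap_bound => // t; rewrite subr0 mdV.
by rewrite -{1}[circle _ _ _]subr0 md_circle// invr1.
Qed.

(* [(w - a) ^+ 2 * f w] is differentiable at [a], and Cauchy's formula for it can be
   divided by [(w - a) ^+ 2]. *)
Lemma removable f a (r : R) : 0 < r ->
  (forall w, w != a -> md (w - a) < r -> holo f w) ->
  (forall e, 0 < e -> exists2 s : R, 0 < s & forall w, md (w - a) < s -> md (f w - f a) < e) ->
  holo f a.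
Proof.
move=> r0 fh fc; have [s s0 hs] := fc 1 ltr01.
pose K := md (f a) + 1.
have K0 : 0 < K by rewrite /K; have := md_ge0 (f a); lra.
have [rho rho0 rhos] := smaller_radius s0 r0.
have fK w : md (w - a) <= rho -> md (f w) <= K.
  move=> /rhos[/hs h _]; have := md_dist (f w) (f a).
  by rewrite /K; lra.
pose g w := (w - a) ^+ 2 * f w.
have gh w : md (w - a) <= rho -> holo g w.
  have [-> _|wa wr] := eqVneq w a; last first.
    apply: holoM; last by apply: fh => //; case: (rhos _ wr).
    by apply: holoX; apply: holoB; [exact: holo_id|exact: holo_cst].
  exists 0 => e e0; exists (Num.min rho (e / K)); first by rewrite lt_min rho0 divr_gt0.
  move=> x; rewrite lt_min => /andP[/ltW h1]; rewrite ltr_pdivlMr// => h2.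
  rewrite mul0r subr0 /g subrr expr0n mul0r subr0 mdM mdX.
  have := fK _ h1; have := md_ge0 (x - a); have := md_ge0 (f x) => p q h.
  rewrite expr2 -mulrA mulrC ler_wpM2r//.
  apply: le_trans (ltW h2); exact: ler_wpM2l.
have circa t : circle a rho t - a != 0.
  by rewrite -md_gt0 md_circle // ltW.
have aa : md (a - a) < rho by rewrite subrr md0.
pose T0 d := circle_trap d f a rho.
pose T z d := circle_trap d (fun w => f w / (w - z)) a rho.
have step z : z != a -> md (z - a) <= rho / 2 ->
   vanishes (fun d => (z - a) ^+ 2 * (f z * winding_trap R d - T z d) - (z - a) * T0 d).
  move=> za zr.
  have := vanishesD (cauchy_formula (_ : md (z - a) < rho) gh)
     (vanishesZ (-1) (cauchy_formula aa gh)).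
  move=> /(_ ltac:(lra)).
  set x := (X in vanishes X) => hx; suff <- : x = fun d => (z - a) ^+ 2 * (f z * winding_trap R d - T z d) - (z - a) * T0 d by [].
  apply/funext => d; rewrite /x /T /T0.
  have -> : circle_trap d (fun w => g w / (w - z)) a rho =
    circle_trap d (fun w => (z - a) ^+ 2 * (f w / (w - z)) + (g w / (w - a) + (z - a) * f w)) a rho.
    apply: eq_circle_trap => t; rewrite /g; move: (circa t) => c1.
    have [c2 _] := circle_kernel t rho0 zr.
    by field; rewrite c1 c2.
  have ga : g a = 0 by rewrite /g subrr expr0n mul0r.
  have gz : g z = (z - a) ^+ 2 * f z by [].
  by rewrite !circle_trapD !circle_trapZ ga gz; ring.
(* By [step], [T0] is at most [md (z - a) * (48 * K)] up to a vanishing term, and [z] may be taken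
   close to [a]. The constant adds [16 * K] for [f z * winding_trap] and [32 * K] for [T z]. *)
have T0v : vanishes T0.
  move=> e e0.
  have [z za zs] := @exists_small_point R a (Num.min (rho / 2) (e / (2 * (48 * K)))) ltac:(rewrite lt_min; apply/andP; split; [lra|rewrite divr_gt0// mulr_gt0//; lra]).
  move: zs; rewrite lt_min => /andP[/ltW zr]; rewrite ltr_pdivlMr; last by lra.
  move=> zs; have mz : 0 < md (z - a) by rewrite md_gt0 subr_eq0.
  have mze : 0 < md (z - a) * (e / 2) by rewrite mulr_gt0; lra.
  have [d0 hd0] := step z za zr _ mze; exists d0 => d /hd0.
  set A := f z * _ - _ => h.
  have hA : md A <= 48 * K.
    rewrite /A; apply: le_trans (mdD _ _) _; rewrite mdN mdM.
    have h1 : md (f z) * md (winding_trap R d) <= K * 16.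
      apply: ler_pM; rewrite ?md_ge0//; first by apply: fK; lra.
      exact: winding_trap_bound.
    have := @circle_trap_bound _ d (fun w => f w / (w - z)) a rho (K * (2 / rho)).
    have -> : K * (2 / rho) * (16 * rho) = 32 * K by field; rewrite gt_eqF.
    move=> h2; have : md (T z d) <= 32 * K; last by lra.
    apply: h2; [by rewrite !mulr_ge0 ?invr_ge0// ltW|exact: ltW|move=> t].
    have [_ k] := circle_kernel t rho0 zr.
    rewrite mdM; apply: ler_pM; rewrite ?md_ge0//; apply: fK.
    by rewrite md_circle// ltW.
  have h4 : md ((z - a) * T0 d) <= md (z - a) * (e / 2) + md (z - a) ^+ 2 * md A.
    have := md_dist ((z - a) * T0 d) ((z - a) ^+ 2 * A).
    have -> : md (z - a) ^+ 2 * md A = md ((z - a) ^+ 2 * A) by rewrite mdM mdX.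
    by rewrite mdB; lra.
  rewrite mdM expr2 -mulrA -mulrDr ler_pM2l// in h4.
  apply: le_trans h4 _.
  have : md (z - a) * md A <= md (z - a) * (48 * K) by rewrite ler_wpM2l// ltW.
  by lra.
have cz z : z != a -> md (z - a) <= rho / 2 -> cauchy_at f a rho z.
  move=> za zr; have za0 : z - a != 0 by rewrite subr_eq0.
  have := vanishesZ ((z - a) ^- 2) (vanishesD (step z za zr) (vanishesZ (z - a) T0v)).
  rewrite /cauchy_at; set x := (X in vanishes X) => hx.
  set y := (X in vanishes X); suff -> : y = x by [].
  by apply/funext => d; rewrite /y /x /T; field.
(* Continuity carries Cauchy's formula from a nearby [z] to [a]. The choices of [s1] and [z] bound
   the changes of the two terms by [e / 6] and [e / 4]. *)
have ca : cauchy_at f a rho a.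
  move=> e e0; have k0 : 0 < e / 96 by lra.
  have [s1 s10 hs1] := fc _ k0.
  have k1 : 0 < e * rho / (K * 256).
    by apply: divr_gt0; [exact: mulr_gt0|rewrite (pmulr_rgt0 _ K0) ltr0n].
  have [z za zs] := @exists_small_point R a (Num.min s1 (Num.min (rho / 2) (e * rho / (K * 256)))) ltac:(rewrite !lt_min s10 k1 divr_gt0//).
  move: zs; rewrite !lt_min => /and3P[/hs1 h1 /ltW zr h2].
  have e2 : 0 < e / 2 by lra.
  have [d0 hd0] := cz z za zr _ e2; exists d0 => d /hd0.
  set W := winding_trap R d.
  set Tz := circle_trap _ _ _ _; set Ta := circle_trap _ (fun w => f w / (w - a)) _ _.
  move=> h.
  rewrite (_ : _ - _ = (f z * W - Tz) - ((f z - f a) * W + (Ta - Tz))); last by ring.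
  apply: le_trans (mdD _ _) _; rewrite mdN.
  have := mdD ((f z - f a) * W) (Ta - Tz).
  have h3 : md ((f z - f a) * W) <= e / 96 * 16.
    by rewrite mdM; apply: ler_pM; rewrite ?md_ge0//; [exact: ltW|exact: winding_trap_bound].
  suff : md (Ta - Tz) <= e / 4 by lra.
  have -> : Ta - Tz = (a - z) * circle_trap d (fun w => f w * ((w - a)^-1 * (w - z)^-1)) a rho.
    rewrite -circle_trapZ.
    rewrite (_ : Ta - Tz = Ta + (-1) * Tz); last by ring.
    rewrite -circle_trapZ -circle_trapD; apply: eq_circle_trap => t.
    move: (circa t) => c1; have [c2 _] := circle_kernel t rho0 zr.
    by field; rewrite c1 c2.
  rewrite mdM mdB.
  have ar : md (a - a) <= rho / 2 by rewrite subrr md0; lra.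
  have := @circle_trap_bound _ d (fun w => f w * ((w - a)^-1 * (w - z)^-1)) a rho (K * (2 / rho * (2 / rho))).
  have -> : K * (2 / rho * (2 / rho)) * (16 * rho) = 64 * K / rho by field; rewrite gt_eqF.
  move=> h5; have {}h5 : md (circle_trap d (fun w => f w * ((w - a)^-1 * (w - z)^-1)) a rho) <= 64 * K / rho.
    apply: h5; [by rewrite !mulr_ge0 ?invr_ge0// ltW|exact: ltW|move=> t].
    have [_ k] := circle_kernel t rho0 zr; have [_ k'] := circle_kernel t rho0 ar.
    rewrite !mdM; do ![apply: ler_pM; rewrite ?mulr_ge0 ?md_ge0//].
    by apply: fK; rewrite md_circle// ltW.
  have h6 : md (z - a) * (64 * K / rho) <= e * rho / (K * 256) * (64 * K / rho).
    by apply: ler_wpM2r; [rewrite !mulr_ge0 ?invr_ge0// ltW|exact: ltW].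
  have : e * rho / (K * 256) * (64 * K / rho) = e / 4 by field; rewrite !gt_eqF.
  have : md (z - a) * md (circle_trap d (fun w => f w * ((w - a)^-1 * (w - z)^-1)) a rho) <= md (z - a) * (64 * K / rho).
    by apply: ler_wpM2l; rewrite ?md_ge0.
  by lra.
have call z : md (z - a) <= rho / 2 -> cauchy_at f a rho z.
  by have [->|/cz] := eqVneq z a.
apply: (@dd_bounded_holo _ f a (rho / 2) (32 * K / rho ^+ 2)).
- move=> z w u h1 h2 h3; apply: (cauchy_at_dd rho0 (ltW K0) h1 h2 h3 _ (call _ h1) (call _ h2) (call _ h3)).
  by move=> t; apply: fK; rewrite md_circle// ltW.
- by apply: divr_ge0; [apply: mulr_ge0 => //; exact: ltW|exact: sqr_ge0].
- by rewrite subrr md0; lra.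
Qed.

Lemma removable_ext f a (r : R) (l : C) : 0 < r ->
  (forall w, w != a -> md (w - a) < r -> holo f w) ->
  (forall e, 0 < e -> exists2 s : R, 0 < s &
     forall w, w != a -> md (w - a) < s -> md (f w - l) < e) ->
  forall w, md (w - a) < r -> holo (fun w => if w == a then l else f w) w.
Proof.
move=> r0 fh fl w; set g := fun w => _.
have gh w' : w' != a -> md (w' - a) < r -> holo g w'.
  move=> wa wr; have m0 : 0 < md (w' - a) by rewrite md_gt0 subr_eq0.
  apply: (holo_near m0) (fh _ wa wr) => x hx; rewrite /g.
  have [xa|//] := eqVneq x a; by move: hx; rewrite xa mdB ltxx.
have [->|wa] := eqVneq w a; last exact: gh.
move=> _; apply: (removable r0 gh) => e e0.
have [s s0 hs] := fl e e0; exists s => // x xs; rewrite /g eqxx.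
by have [_|xa] := eqVneq x a; [rewrite subrr md0|exact: hs].
Qed.

Lemma holo_division f a (r : R) : 0 < r -> (forall w, md (w - a) < r -> holo f w) ->
  exists2 g, forall w, md (w - a) < r -> holo g w & forall w, f w - f a = (w - a) * g w.
Proof.
move=> r0 fh; have [|d hd] := fh a; first by rewrite subrr md0.
exists (fun w => if w == a then d else (f w - f a) / (w - a)).
  apply: removable_ext => // [w wa wr|e e0].
    apply: holoM; first by apply: holoB; [exact: fh|exact: holo_cst].
    apply: holoV; first by rewrite subr_eq0.
    by apply: holoB; [exact: holo_id|exact: holo_cst].
  have e2 : 0 < e / 2 by lra.
  have [s s0 hs] := hd _ e2; exists s => // w wa ws.
  have m0 : 0 < md (w - a) by rewrite md_gt0 subr_eq0.
  have wa0 : w - a != 0 by rewrite subr_eq0.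
  rewrite (_ : _ - d = (f w - f a - d * (w - a)) / (w - a)); last by field.
  rewrite mdM mdV ltr_pdivrMr//; apply: le_lt_trans (hs _ ws) _.
  by rewrite ltr_pM2r//; lra.
move=> w; case: eqVneq => [->|wa]; first by rewrite !subrr mul0r.
by field; rewrite subr_eq0.
Qed.

Lemma locally_bounded f z : holo f z -> exists2 s : R, 0 < s &
  forall w, md (w - z) < s -> md (f w) <= md (f z) + 1.
Proof.
move=> [d h]; have [s s0 hs] := hd_cont h ltr01; exists s => // w /hs k.
by have := md_dist (f w) (f z); lra.
Qed.

(** Accumulating zeros make [f] divisible by every power of [w - a]. Cauchy's bound for the quotient
    gives [md (f w) <= 8 * (md (w - a) / rho) ^+ m] for all [m], which forces [f w = 0] on half the
    radius. *)
Lemma isolated_zeros f a (r : R) : 0 < r -> (forall w, md (w - a) < r -> holo f w) ->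
  (forall s, 0 < s -> exists w, [/\ w != a, md (w - a) < s & f w = 0]) ->
  exists2 s : R, 0 < s & forall w, md (w - a) < s -> f w = 0.
Proof.
move=> r0 fh fz.
have zero g : holo g a ->
    (forall s, 0 < s -> exists w, [/\ w != a, md (w - a) < s & g w = 0]) -> g a = 0.
  move=> [d gd] gz; apply/eqP; rewrite -md_eq0 eq_le md_ge0 andbT.
  apply/ler_addgt0Pr => e e0; have [s s0 hs] := hd_cont gd e0.
  have [w [_ /hs h gw]] := gz s s0; move: h; rewrite gw sub0r mdN; lra.
have aa : md (a - a) < r by rewrite subrr md0.
have pw m : exists2 g, forall w, md (w - a) < r -> holo g w & forall w, f w = (w - a) ^+ m * g w.
  elim: m => [|m [g gh fg]]; first by exists f => // w; rewrite expr0 mul1r.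
  have ga : g a = 0.
    apply: zero; first exact: gh.
    move=> s s0; have [w [wa ws fw]] := fz s s0; exists w; split => //.
    move/eqP: fw; rewrite fg mulf_eq0 expf_eq0 subr_eq0 (negbTE wa) andbF /=.
    by move/eqP.
  have [k kh gk] := holo_division r0 gh; exists k => // w.
  by rewrite fg exprSr -mulrA -gk ga subr0.
have fa : f a = 0 by apply: zero => //; exact: fh.
have [s s0 hs] := locally_bounded (fh _ aa).
have [rho rho0 rhos] := smaller_radius s0 r0.
exists (rho / 2); first by lra.
move=> w wr; apply/eqP; rewrite -md_eq0 eq_le md_ge0 andbT.
have bd m : md (f w) <= 8 * (2^-1) ^+ m.
  have [g gh fg] := pw m.
  have rm : 0 < rho ^+ m by rewrite exprn_gt0.
  have gb : md (g w) <= 8 * (rho ^+ m)^-1.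
    apply: (@cauchy_bound _ g a rho) => //; [by rewrite invr_ge0 ltW|by move=> x /rhos[_]; exact: gh| |exact: ltW].
    move=> t; have mc := md_circle a t (ltW rho0).
    have := hs (circle a rho t); rewrite fa md0 add0r fg mdM mdX mc => h.
    rewrite -[_^-1]mul1r ler_pdivlMr// mulrC; apply: h.
    by case: (rhos (md (circle a rho t - a))); rewrite mc.
  rewrite fg mdM mdX.
  have h1 : md (w - a) ^+ m <= (rho / 2) ^+ m.
    by apply: lerXn2r; rewrite ?nnegrE ?md_ge0//; [rewrite divr_ge0// ltW|exact: ltW].
  apply: (@le_trans _ _ ((rho / 2) ^+ m * (8 * (rho ^+ m)^-1))).
    by apply: ler_pM; rewrite ?md_ge0// exprn_ge0// md_ge0.
  by rewrite exprMn mulrCA mulrAC mulfV ?mul1r// gt_eqF.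
apply/ler_addgt0Pr => e e0; rewrite add0r.
apply: le_trans (bd (Num.truncn (8 / e)).+1) _.
rewrite exprVn ler_pdivrMr ?exprn_gt0// mulrC -ler_pdivrMr//.
apply: le_trans (ltW (truncnS_gt _)) _; rewrite -natrX ler_nat.
exact: ltnW (ltn_expl _ _).
Qed.

End Removable.

(** * Hurwitz's theorem and derivatives of injective maps *)

Section Hurwitz.
Variable R : realType.
Local Notation C := (Cplx R).
Implicit Types (a z w u : C) (f g : C -> C).

(** The disc is convex, so the vanishing can be continued along the segment from [z0] to [z]; [T] is
    the last parameter reached, and [f] vanishes around [c T]. *)
Lemma zero_on_disc f a (r : R) z0 : (forall w, md (w - a) < r -> holo f w) ->
  (forall w, md (w - a) < r -> f w = 0 ->
     exists2 s : R, 0 < s & forall x, md (x - w) < s -> f x = 0) ->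
  md (z0 - a) < r -> f z0 = 0 -> forall z, md (z - a) < r -> f z = 0.
Proof.
move=> fh fz z0r fz0 z zr.
pose c (t : R) : C := z0 + rc t * (z - z0).
have cr t : 0 <= t <= 1 -> md (c t - a) < r.
  move=> /andP[t0 t1].
  rewrite (_ : c t - a = rc (1 - t) * (z0 - a) + rc t * (z - a)); last first.
    by rewrite /c rcB rc1; ring.
  apply: le_lt_trans (mdD _ _) _; rewrite !mdM !md_rc !ger0_norm ?subr_ge0//.
  have : Num.max (md (z0 - a)) (md (z - a)) < r by rewrite gt_max z0r.
  apply: le_lt_trans; set m := Num.max _ _.
  have mA : md (z0 - a) <= m by rewrite le_max lexx.
  have mB : md (z - a) <= m by rewrite le_max lexx orbT.
  by nra.
have cc s t : md (c s - c t) = `|s - t| * md (z - z0).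
  by rewrite (_ : c s - c t = rc (s - t) * (z - z0)) ?mdM ?md_rc// /c rcB; ring.
pose K := md (z - z0) + 1; have K0 : 0 < K by rewrite /K; have := md_ge0 (z - z0); lra.
have cK s t e : 0 < e -> `|s - t| < e / K -> md (c s - c t) < e.
  move=> e0; rewrite ltr_pdivlMr// cc /K => h.
  by apply: le_lt_trans h; rewrite ler_wpM2l//; lra.
pose S := [set t : R | 0 <= t <= 1 /\ forall s, 0 <= s <= t -> f (c s) = 0].
have S0 : S 0.
  split; first by rewrite lexx ler01.
  move=> s s0; have -> : s = 0 by lra.
  rewrite /c rc0 mul0r addr0; exact: fz0.
have hS : has_sup S by split; [exists 0|exists 1 => t [/andP[]]].
set T := sup S.
have T01 : 0 <= T <= 1.
  by apply/andP; split; [exact: sup_upper_bound|apply: ge_sup => [|t [/andP[]]//]; exists 0].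
have below s : 0 <= s -> s < T -> f (c s) = 0.
  move=> s0 sT; have [|t St st] := @sup_adherent _ S (T - s) _ hS; first by lra.
  by case: St => _ /(_ s); apply; rewrite s0 /=; move: st; rewrite -/T; lra.
have fT : f (c T) = 0.
  have [|d hd] := fh (c T); first exact: cr.
  have [->|T0] := eqVneq T 0; first by case: S0 => _ /(_ 0); apply; rewrite lexx.
  apply/eqP; rewrite -md_eq0 eq_le md_ge0 andbT; apply/ler_addgt0Pr => e e0.
  have [s s0 hs] := hd_cont hd e0.
  pose t := Num.max 0 (T - s / K / 2).
  have sK : 0 < s / K by rewrite divr_gt0.
  have Tp : 0 < T by rewrite lt_def T0; case/andP: T01.
  have t0 : 0 <= t by rewrite le_max lexx.
  have tT : t < T by rewrite gt_max Tp /=; lra.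
  have tT' : T - s / K / 2 <= t by rewrite le_max lexx orbT.
  have := hs (c t); rewrite below// sub0r mdN add0r => h; apply: ltW; apply: h.
  by apply: cK => //; rewrite ltr_norml; lra.
have [|s s0 hs] := fz (c T) _ fT; first exact: cr.
have sK : 0 < s / K by rewrite divr_gt0.
pose t := Num.min 1 (T + s / K / 2).
have tT : t <= T.
  apply: sup_upper_bound => //; split.
    by rewrite ge_min lexx le_min ler01 /=; lra.
  move=> x /andP[x0 xt]; have [xT|xT] := ltP x T; first exact: below.
  apply: hs; apply: cK => //.
  have : x <= T + s / K / 2 by apply: le_trans xt _; rewrite ge_min lexx orbT.
  by rewrite ltr_norml; lra.
have T1 : T = 1.
  by move: tT; rewrite /t ge_min => /orP[h|h]; lra.
by move: fT; rewrite T1 /c rc1 mul1r addrC subrK.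
Qed.

Section Sequence.
Variables (I : Type) (U : set_system I).
Context {UU : UltraFilter U}.

Let PU : ProperFilter U := ultra_proper.
Local Existing Instance PU.

(* By the mean value bound for [1 / f i], each small circle around a zero [w] of [g]
   has a point where [f i] is at most [9 * md (f i w)], so the zeros of [g] accumulate. *)
Theorem hurwitz (f : I -> C -> C) g a (r M : R) z0 : 0 <= M ->
  U [set i | forall w, md (w - a) < r -> holo (f i) w /\ md (f i w) <= M] ->
  (forall z, md (z - a) < r -> ulim U (f ^~ z) (g z)) ->
  U [set i | forall w, md (w - a) < r -> f i w != 0] ->
  md (z0 - a) < r -> g z0 = 0 -> forall z, md (z - a) < r -> g z = 0.
Proof.
move=> M0 fh fg fn0 z0r gz0.
apply: (zero_on_disc (z0 := z0)) => // [w wr|w wr gw]; first exact: holo_ulim M0 fh _ fg _ wr.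
pose s := r - md (w - a); have s0 : 0 < s by rewrite /s; lra.
have sr x : md (x - w) < s -> md (x - a) < r by have := md_tri w x a; rewrite /s; lra.
apply: (@isolated_zeros _ g w s) => // [x xs|e e0].
  by apply: holo_ulim M0 fh _ fg _ _; exact: sr.
have [d d0 hd] := smaller_radius e0 s0; have [de ds] := hd d (lexx d).
have [t ht] : exists t : I -> R, U [set i | md (f i (circle w d (t i))) <= 9 * md (f i w)].
  pose good i := (forall w, md (w - a) < r -> holo (f i) w /\ md (f i w) <= M) /\
      (forall w, md (w - a) < r -> f i w != 0).
  suff h i : exists t : R, good i -> md (f i (circle w d t)) <= 9 * md (f i w).
    by have [t ht] := choice h; exists t; apply: filterS (filterI fh fn0) => i /ht.
  apply: contrapT => /forallNP nt.
  have [hi ni] : good i.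
    by apply: contrapT => h; apply: (nt 0) => /h.
  have big t : 9 * md (f i w) < md (f i (circle w d t)).
    by rewrite ltNge; apply/negP => h; apply: (nt t).
  have w0 : 0 < md (f i w) by rewrite md_gt0; apply: ni.
  have w9 : 0 < 9 * md (f i w) by rewrite mulr_gt0.
  have dr x : md (x - w) <= d -> md (x - a) < r by move=> h; apply: sr; exact: le_lt_trans ds.
  have := @cauchy_bound _ (fun x => (f i x)^-1) w d (9 * md (f i w))^-1 d0 _ _ _ w.
  rewrite subrr md0 mdV => /(_ _ _ _ ltac:(lra)).
  have -> : 8 * (9 * md (f i w))^-1 = 8 / 9 * (md (f i w))^-1 by field; rewrite gt_eqF.
  have wi : 0 < (md (f i w))^-1 by rewrite invr_gt0.
  move=> h; suff : (md (f i w))^-1 <= 8 / 9 * (md (f i w))^-1 by lra.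
  apply: h; first by rewrite invr_ge0 ltW.
    by move=> x /dr xr; apply: holoV; [exact: ni|case: (hi _ xr)].
  by move=> t; rewrite mdV lef_pV2 ?posrE// ?ltW//; apply: lt_trans (big t).
have mcd t' : md (circle w d t' - w) = d by rewrite md_circle // ltW.
(* The chosen points of the circle converge to a point [x] of the circle, and [g x = 0] because
   [f i w] tends to [g w = 0]. *)
have [|x hx] := @ulim_ex R I U UU (fun i => circle w d (t i)) (md w + d).
  apply: filterS filterT => i _ /=.
  have := md_dist (circle w d (t i)) w; rewrite mcd; lra.
have xw : md (x - w) = d.
  have h : ulim U (fun i => circle w d (t i) - w) (x - w) by apply: ulimB => //; exact: ulim_cst.
  apply/eqP; rewrite eq_le; apply/andP; split.
    by apply: ulim_le h; apply: filterS filterT => i _ /=; rewrite mcd.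
  by apply: ulim_ge h; apply: filterS filterT => i _ /=; rewrite mcd.
exists x; split; [by rewrite -subr_eq0 -md_gt0 xw|by rewrite xw|].
have xr : md (x - a) < r by apply: sr; rewrite xw.
have h1 : ulim U (fun i => f i (circle w d (t i))) (g x) by apply: ulim_diag M0 fh _ fg _ _ xr hx.
have h2 : ulim U (fun i => f i (circle w d (t i))) 0.
  by apply: ulim_zero ht _; rewrite -gw; exact: fg.
exact: ulim_uniq h1 h2.
Qed.

End Sequence.

(** By injectivity the quotients [q n] have no zeros, and they tend to the derivative. If the
    derivative vanished at [a], Hurwitz's theorem would make it vanish on a disc, and [f] would be
    constant there. *)
Lemma injective_hd_neq0 f a (r : R) d : 0 < r -> (forall w, md (w - a) < r -> holo f w) ->
  (forall z w, md (z - a) < r -> md (w - a) < r -> f z = f w -> z = w) ->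
  hd f a d -> d != 0.
Proof.
move=> r0 fh finj hd0; apply/eqP => d0; rewrite {d}d0 in hd0.
have aa : md (a - a) < r by rewrite subrr md0.
have [s s0 hs] := locally_bounded (fh _ aa).
pose M := md (f a) + 1; have M0 : 0 <= M by rewrite /M; have := md_ge0 (f a); lra.
have [rho rho0 rhos] := smaller_radius s0 r0.
have fh' w : md (w - a) <= rho -> holo f w by move=> /rhos[_]; exact: fh.
have fM t : md (f (circle a rho t)) <= M.
  by have [|/hs//] := rhos (md (circle a rho t - a)); rewrite md_circle // ltW.
have flip := cauchy_lip rho0 M0 fh' fM; have fdd := cauchy_dd rho0 M0 fh' fM.
have [U [UU hU]] := @ultraFilterLemma nat \oo _.
have PU := @ultra_proper _ _ UU.
pose h (n : nat) : C := rc (rho / 4 / n.+1%:R).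
have k0 (n : nat) : 0 < rho / 4 / n.+1%:R by apply: divr_gt0 => //; exact: divr_gt0.
have h0 n : h n != 0 by rewrite rc_eq0 gt_eqF.
have mh n : md (h n) = rho / 4 / n.+1%:R by rewrite md_rc ger0_norm// ltW.
have hle n : md (h n) <= rho / 4.
  by rewrite mh ler_pdivrMr// ler_peMr ?ler1n// divr_ge0 ?ltW.
have ulh e : 0 < e -> U [set n | md (h n) < e].
  move=> e0; apply: hU; exists (Num.truncn (rho / 4 / e)) => // n ln /=.
  rewrite mh ltr_pdivrMr// [e * _]mulrC -ltr_pdivrMr//.
  by apply: lt_le_trans (truncnS_gt _) _; rewrite ler_nat ltnS.
pose q n w := (f (w + h n) - f w) / h n.
have wh n w : md (w - a) < rho / 4 -> md (w + h n - a) <= rho / 2 /\ md (w - a) <= rho / 2.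
  move=> wr; split; last by lra.
  rewrite (_ : w + h n - a = h n + (w - a)); last by ring.
  by apply: le_trans (mdD _ _) _; have := hle n; lra.
have hdf0 w : exists k, md (w - a) < rho / 4 -> hd f w k.
  have [wr|] := ltP (md (w - a)) (rho / 4); last by exists 0.
  by have [|k hk] := fh' w; [lra|exists k].
have [df hdf] := choice hdf0.
have dfa : df a = 0.
  by apply: hd_uniq (hdf a _) hd0; rewrite subrr md0; lra.
have dfz z : md (z - a) < rho / 4 -> df z = 0.
  apply: (@hurwitz nat U UU q df a (rho / 4) (16 * M / rho) a) => //.
  - by rewrite !mulr_ge0 ?invr_ge0// ltW.
  - apply: filterS filterT => n _ /= w wr; have [w1 w2] := wh n w wr; split.
      apply: holoM; last exact: holo_cst.
      apply: holoB; last by apply: fh'; lra.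
      apply: (@holo_comp _ (fun w => w + h n) f); last by apply: fh'; lra.
      by apply: holoD; [exact: holo_id|exact: holo_cst].
    rewrite mdM mdV ler_pdivrMr ?md_gt0//.
    have := flip w (w + h n) w2 w1.
    by rewrite (_ : w + h n - w = h n); last by ring.
  - move=> w wr e e0; have [s1 s10 hs1] := hdf w wr (e / 2) ltac:(lra).
    apply: filterS (ulh _ s10) => n /= hn.
    have := hs1 (w + h n); rewrite (_ : w + h n - w = h n); last by ring.
    move=> /(_ hn) k; have hn0 : h n != 0 := h0 n.
    rewrite (_ : q n w - df w = (f (w + h n) - f w - df w * h n) / h n); last first.
      by rewrite /q; move: (h n) hn0 => x x0; field.
    rewrite mdM mdV ltr_pdivrMr ?md_gt0//; apply: le_lt_trans k _.
    by rewrite ltr_pM2r ?md_gt0//; lra.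
  - apply: filterS filterT => n _ /= w wr; have [w1 w2] := wh n w wr.
    rewrite /q mulf_neq0 ?invr_eq0// subr_eq0; apply/eqP => /finj e.
    have : h n = 0.
      rewrite -(subrr w) -{1}e; [by ring| |]; apply: (proj2 (rhos _ _)); lra.
    by apply/eqP.
  - by rewrite subrr md0; lra.
set B := 32 * M / rho ^+ 2 in fdd.
have B0 : 0 <= B by apply: divr_ge0; [exact: mulr_ge0|exact: sqr_ge0].
have quad z w : md (z - a) < rho / 4 -> md (w - a) < rho / 4 -> md (f w - f z) <= B * md (w - z) ^+ 2.
  move=> zr wr; have zr' : md (z - a) < rho / 2 by lra.
  have := dd_bounded_quad fdd B0 zr' (hdf z zr) (ltW (lt_trans wr _)).
  by rewrite dfz// mul0r subr0; apply; lra.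
pose x := rc (rho / 8) : C.
have mx : md x = rho / 8 by rewrite md_rc ger0_norm//; lra.
(* Where the derivative is 0, [f] changes at most quadratically; the path to [a + x] is cut into
   [N.+1] steps. *)
have chain N : md (f (a + x) - f a) <= B * md x ^+ 2 / N.+1%:R.
  pose p (k : nat) := a + rc (k%:R / N.+1%:R) * x.
  have pr k : (k <= N.+1)%N -> md (p k - a) < rho / 4.
    move=> kN; rewrite (_ : p k - a = rc (k%:R / N.+1%:R) * x); last by rewrite /p; ring.
    rewrite mdM md_rc ger0_norm ?divr_ge0// mx.
    have : k%:R / N.+1%:R <= 1 :> R by rewrite ler_pdivrMr// mul1r ler_nat.
    by set y := k%:R / _ => hy; nra.
  have stepk k : (k <= N.+1)%N -> md (f (p k) - f a) <= B * md x ^+ 2 / N.+1%:R ^+ 2 * k%:R.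
    elim: k => [|k IH] kN; first by rewrite /p !mul0r addr0 subrr md0 mulr0.
    apply: le_trans (@md_tri _ (f (p k)) _ _) _; rewrite -(natr1 k) mulrDr mulr1 addrC.
    apply: lerD; first by apply: IH; exact: ltnW.
    apply: le_trans (quad _ _ (pr k (ltnW kN)) (pr k.+1 kN)) _.
    have N0 : N.+1%:R != 0 :> R by rewrite pnatr_eq0.
    rewrite (_ : p k.+1 - p k = rc (N.+1%:R)^-1 * x); last first.
      by rewrite /p -(natr1 k) mulrDl mul1r rcD; ring.
    by rewrite mdM md_rc ger0_norm ?invr_ge0// exprMn exprVn mulrCA mulrC -!mulrA.
  have := stepk N.+1 (leqnn _); rewrite /p mulfV ?pnatr_eq0// rc1 mul1r.
  have N0 : N.+1%:R != 0 :> R by rewrite pnatr_eq0.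
  by rewrite (_ : _ / _ * _ = B * md x ^+ 2 / N.+1%:R) //; field.
have fe : f (a + x) = f a.
  apply/eqP; rewrite -subr_eq0 -md_eq0 eq_le md_ge0 andbT.
  apply/ler_addgt0Pr => e e0; rewrite add0r.
  set K := B * md x ^+ 2 in chain.
  apply: le_trans (chain (Num.truncn (K / e))) _.
  by rewrite ler_pdivrMr// mulrC -ler_pdivrMr// ltW// truncnS_gt.
have xa : a + x - a = x by ring.
have : a + x = a by apply: finj => //; rewrite xa mx; have [] := rhos (rho / 8); lra.
move/(congr1 (fun y => md (y - a))); rewrite xa mx subrr md0; lra.
Qed.

End Hurwitz.

(** * Entire maps with a simple pole at infinity; bounds for injective maps with a pole *)

Section PoleNormalForm.
Variable R : realType.
Local Notation C := (Cplx R).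
Implicit Types (a z w u : C) (f g A : C -> C).

(** The non-zero derivative at infinity bounds [A w / w] by [2 / md d] for large [w]. This quotient
    is entire, hence constant by Liouville's argument. *)
Lemma linear_of_proper_entire A d : (forall z, holo A z) -> A 0 = 0 ->
  (forall z, z != 0 -> A z != 0) -> hd (fun w => (A w^-1)^-1) 0 d -> d != 0 ->
  forall z, A z = A 1 * z.
Proof.
move=> Ah A0 An0 hd0 d0.
have [g gh Ag] := holo_division ltr01 (fun w (_ : md (w - 0) < 1) => Ah w).
have gE w : A w = w * g w by have := Ag w; rewrite A0 !subr0.
have gh' w : holo g w.
  have [->|w0] := eqVneq w 0; first by apply: gh; rewrite subrr md0.
  have m0 : 0 < md w by rewrite md_gt0.
  apply: (@holo_near _ (fun x => A x / x) _ _ _ m0).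
    move=> x xw; have x0 : x != 0 by apply: contraTneq xw => ->; rewrite sub0r mdN ltxx.
    by rewrite gE; field.
  by apply: holoM => //; apply: holoV => //; exact: holo_id.
have md' : 0 < md d by rewrite md_gt0.
have d20 : 0 < md d / 2 by lra.
have [s s0 hs] := hd0 _ d20.
have big w : s^-1 < md w -> md (g w) <= 2 / md d.
  move=> sw; have w0 : 0 < md w by apply: lt_trans sw; rewrite invr_gt0.
  have wn0 : w != 0 by rewrite -md_gt0.
  have := hs w^-1; rewrite subr0 mdV invrK invr0 A0 invr0 subr0.
  have -> : (md w)^-1 < s by rewrite -[s]invrK ltf_pV2 ?posrE ?invr_gt0.
  move=> /(_ isT) h.
  have gw0 : g w != 0.
    by have := An0 _ wn0; rewrite gE mulf_eq0 negb_or => /andP[].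
  have h1 : md d / 2 * (md w)^-1 <= (md (A w))^-1.
    have := md_dist (d * w^-1) ((A w)^-1); rewrite [md (_ - _^-1)]mdB.
    by rewrite mdM !mdV; lra.
  rewrite -[leLHS]invrK -invf_div lef_pV2 ?posrE ?invr_gt0 ?md_gt0 ?divr_gt0//.
  rewrite -(ler_pM2r (_ : 0 < (md w)^-1)) ?invr_gt0//.
  by apply: le_trans h1 _; rewrite gE mdM invfM mulrC.
have cst z : g z = g 0.
  apply/eqP; rewrite -subr_eq0 -md_eq0 eq_le md_ge0 andbT.
  apply/ler_addgt0Pr => e e0; rewrite add0r.
  pose K := 2 / md d; have K0 : 0 < K by rewrite /K divr_gt0.
  (* The terms put [z] in the half disc for [cauchy_lip], put the circle where [big] applies, and
     make the Lipschitz bound at most [e]. *)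
  pose r := 2 * md z + s^-1 + 16 * K * md z / e + 1.
  have si : 0 < s^-1 by rewrite invr_gt0.
  have q0 : 0 <= 16 * K * md z / e.
    by apply: divr_ge0; [apply: mulr_ge0; [apply: mulr_ge0 => //; exact: ltW|exact: md_ge0]|exact: ltW].
  have z0 := md_ge0 z.
  have r0 : 0 < r by rewrite /r; lra.
  have gb t : md (g (circle 0 r t)) <= K.
    by apply: big; have := md_circle 0 t (ltW r0); rewrite subr0 => ->; rewrite /r; lra.
  have := cauchy_lip r0 (ltW K0) (fun w _ => gh' w) gb (z := 0) (w := z).
  rewrite !subr0 md0 => h; apply: le_trans (h _ _) _; [lra|rewrite /r; lra|].
  rewrite mulrAC ler_pdivrMr//.
  have : 16 * K * md z / e <= r by rewrite /r; lra.
  by rewrite ler_pdivrMr// [r * e]mulrC.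
by move=> z; rewrite !gE mul1r !cst mulrC.
Qed.

Lemma cis_int (z : int) : cis (z%:~R : R) = 1.
Proof.
have nat n : cis (n%:R : R) = 1.
  by elim: n => [|n IH]; rewrite ?cis0// -natr1 cisD IH cis1 mulr1.
by case: z => n; [exact: nat|rewrite NegzE mulrNz cisN nat invr1].
Qed.

Lemma cis_mod1 (t : R) : exists2 s, 0 <= s <= 1 & cis s = cis t.
Proof.
exists (t - (Num.floor t)%:~R).
  have := Num.Theory.floor_le t; have := Num.Theory.floorD1_gt t.
  by rewrite intrD; lra.
by rewrite cisD -mulrNz cis_int mulr1.
Qed.

Lemma circle_min f (r : R) : 0 <= r -> (forall w, md w <= r -> holo f w) ->
  exists t0, forall t, md (f (circle 0 r t0)) <= md (f (circle 0 r t)).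
Proof.
move=> r0 fh.
have mc t : md (circle 0 r t : C) = r by rewrite -[circle _ _ _]subr0 md_circle.
pose h (t : R) : R := md (f (circle 0 r t)).
have ch : continuous h.
  move=> x; apply/(@cvgrPdist_lt _ R) => e e0.
  have [|d hd0] := fh (circle 0 r x); first by rewrite mc.
  have [s s0 hs] := hd_cont hd0 e0.
  have K0 : 0 < 16 * r + 1 by lra.
  apply/nbhs_ballP; exists (s / (16 * r + 1)) => /=; first by rewrite divr_gt0.
  move=> y; rewrite /ball /= ltr_pdivlMr// => xy.
  have : md (f (circle 0 r y) - f (circle 0 r x)) < e.
    apply: hs; rewrite mdB; apply: le_lt_trans (circle_lip _ _ _ r0) _.
    by apply: le_lt_trans xy; rewrite mulrC ler_wpM2l//; lra.
  rewrite /h; have := md_dist (f (circle 0 r y)) (f (circle 0 r x)).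
  have := md_dist (f (circle 0 r x)) (f (circle 0 r y)).
  by rewrite [md (f (circle 0 r x) - _)]mdB ltr_norml; lra.
have [t0 _ ht0] := @EVT_min R h 0 1 ler01 (continuous_subspaceT ch).
exists t0 => t; have [s s01 st] := cis_mod1 t.
have -> : circle 0 r t = circle 0 r s :> C by rewrite /circle st.
by apply: ht0; rewrite in_itv.
Qed.

Section Normalised.
Variables (f : C -> C) (r : R).
Hypotheses (r0 : 0 < r) (fh : forall w, md w < r -> holo f w) (f0 : f 0 = 0)
  (finj : forall z w, md z < r -> md w < r -> f z = f w -> z = w)
  (f1 : forall t, 1 <= md (f (circle 0 (r / 4) t))).

(* The mean value bound at [0] for [1 / (c (1 - c f))], whose value at [0] is [1 / c]. *)
Lemma omitted_value_bound (c : C) : (forall z, md z <= r / 4 -> c * f z != 1) -> md c <= 9.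
Proof.
move=> cn; have [//|c9] := leP (md c) 9.
have r40 : 0 < r / 4 by rewrite divr_gt0.
have c0 : c != 0 by rewrite -md_gt0; lra.
have cm : 0 < md c by rewrite md_gt0.
pose k z := (c * (1 - c * f z))^-1.
have M0 : 0 < (md c * (md c - 1))^-1 by rewrite invr_gt0 mulr_gt0//; lra.
have := @cauchy_bound R k 0 (r / 4) (md c * (md c - 1))^-1 r40 (ltW M0) _ _ 0.
have -> : k 0 = c^-1 by rewrite /k f0 mulr0 subr0 mulr1.
rewrite subrr md0 mdV => h.
suff : (md c)^-1 <= 8 * (md c * (md c - 1))^-1.
  rewrite invfM mulrCA -[leLHS]mulr1 ler_pM2l ?invr_gt0//.
  by rewrite ler_pdivlMr ?mul1r; lra.
apply: h; last by lra.
  move=> w; rewrite subr0 => wr; apply: holoV.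
    by rewrite mulf_neq0// subr_eq0 eq_sym cn.
  apply: holoM; first exact: holo_cst.
  apply: holoB; first exact: holo_cst.
  apply: holoM; first exact: holo_cst.
  by apply: fh; move: r0 => ?; lra.
move=> t; have := f1 t; set y := f _ => y1.
have y2 : md c - 1 <= md (1 - c * y).
  have := md_dist (c * y) 1; rewrite mdB mdM md1; apply: le_trans.
  by rewrite lerB// ler_peMr// ltW.
rewrite mdV mdM lef_pV2 ?posrE.
- by rewrite ler_pM2l.
- by rewrite mulr_gt0//; lra.
- by rewrite mulr_gt0//; lra.
Qed.

(** [P] is [1 / f] with its simple pole at 0 multiplied away. For [z] beyond the circle of radius
    [r / 4], injectivity lets [omitted_value_bound] apply to [c = 1 / f z], so
    [md (P z) <= 9 * md z]; Cauchy's bound extends this inwards, whence [72 = 8 * 9]. The bound is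
    the same for all [f], so families of such [P] have limits. *)
Lemma pole_normal_form d : hd f 0 d -> exists P : C -> C, [/\ P 0 = d^-1,
  forall z, md z < r -> z != 0 -> P z = z / f z,
  forall z, md z < r -> P z != 0 &
  forall z, md z < r -> holo P z /\ md (P z) <= 72 * r].
Proof.
move=> hd0; pose P z := if z == 0 then d^-1 else z / f z.
have dn0 : d != 0.
  apply: (@injective_hd_neq0 R f 0 r d r0) => //.
    by move=> w; rewrite subr0; exact: fh.
  by move=> z w; rewrite !subr0; exact: finj.
have dm : 0 < md d by rewrite md_gt0.
have fn0 z : md z < r -> z != 0 -> f z != 0.
  by move=> zr; apply: contra_neq => fz; apply: finj; rewrite ?md0 // fz f0.
have Ph z : md z < r -> holo P z.
  move=> zr; rewrite -[z]subr0 in zr; move: zr.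
  apply: removable_ext => // [w w0|e e0].
    rewrite subr0 => wr; apply: holoM; first exact: holo_id.
    by apply: holoV; [exact: fn0|exact: fh].
  have d2 : 0 < md d / 2 by lra.
  have k0 : 0 < e * md d ^+ 2 / 4 by rewrite divr_gt0 ?mulr_gt0 ?exprn_gt0.
  have [s s0 hs] := hd0 _ d2; have [s' s'0 hs'] := hd0 _ k0.
  exists (Num.min r (Num.min s s')); first by rewrite !lt_min r0 s0 s'0.
  move=> w w0; rewrite subr0 !lt_min => /and3P[wr ws ws'].
  have := hs w; have := hs' w; rewrite f0 !subr0 => /(_ ws') h' /(_ ws) h.
  have w1 : 0 < md w by rewrite md_gt0.
  have fw := fn0 w wr w0.
  have fb : md d / 2 * md w <= md (f w).
    by have := md_dist (d * w) (f w); rewrite mdB mdM; lra.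
  rewrite (_ : _ - _ = - ((f w - d * w) / (f w * d))); last by field; rewrite fw dn0.
  rewrite mdN mdM mdV mdM ltr_pdivrMr ?mulr_gt0 ?md_gt0//.
  apply: le_lt_trans h' _.
  have : e * md d * (md d / 2 * md w) <= e * md d * md (f w).
    by rewrite ler_wpM2l// mulr_ge0// ltW.
  have : 0 < e * md d * (md d * md w) by rewrite !mulr_gt0.
  by lra.
have P0 z : md z < r -> P z != 0.
  move=> zr; rewrite /P; case: (eqVneq z 0) => [_|z0]; first by rewrite invr_eq0.
  by rewrite mulf_neq0// invr_eq0 fn0.
have far z : md z < r -> (r / 4 < md z \/ exists t, z = circle 0 (r / 4) t) -> md (P z) <= 9 * md z.
  move=> zr zf.
  have z0 : z != 0.
    rewrite -md_gt0; case: zf => [|[t ->]]; first by move: r0 => ?; lra.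
    by rewrite -[circle _ _ _]subr0 md_circle; move: r0 => ?; lra.
  rewrite /P (negbTE z0) mdM mulrC mdV ler_wpM2r ?md_ge0//.
  case: zf => [zf|[t ->]].
    rewrite -mdV; apply: omitted_value_bound => w wr.
    have wr' : md w < r by move: r0 => ?; lra.
    apply/eqP => /(canRL (mulKf _)); rewrite invr_eq0 => /(_ (fn0 z zr z0)).
    by rewrite invrK mulr1 => /finj wz; move: zf; rewrite -wz//; lra.
  have := f1 t; set y := md _ => y1; rewrite -[9]invrK lef_pV2 ?posrE ?invr_gt0//; last by lra.
  by apply: le_trans y1; rewrite invf_le1//; lra.
exists P; split => //; first by rewrite /P eqxx.
  by move=> z zr z0; rewrite /P (negbTE z0).
move=> z zr; split; first exact: Ph.
have rp : 0 < r by [].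
have [z4|z4] := ltP (r / 4) (md z).
  by apply: le_trans (far _ zr (or_introl z4)) _; lra.
(* Cauchy's bound holds on half the radius, and half of [3 * r / 4] still covers [r / 4]. *)
have q0 : 0 < 3 * r / 4 by lra.
have -> : 72 * r = 8 * (9 * r) by ring.
apply: (cauchy_bound q0 _ _ _ (a := 0)); [lra| | |by rewrite subr0; lra].
  by move=> w; rewrite subr0 => wr; apply: Ph; lra.
move=> t; have mc : md (circle 0 (3 * r / 4) t : C) = 3 * r / 4.
  by rewrite -[circle _ _ _]subr0 md_circle// ltW.
apply: le_trans (far _ _ _) _; rewrite mc; [lra|left; lra|lra].
Qed.

End Normalised.
End PoleNormalForm.

(** * Winding numbers *)

Section Winding.
Variable R : realType.
Local Notation C := (Cplx R).
Implicit Types (x y z w : C).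

(** For the root with non-negative real part [md (y + 1) >= 1], and [x - 1 = (y - 1) * (y + 1)]. *)
Lemma sqrt_near1 x : exists2 y, y ^+ 2 = x & md (y - 1) <= md (x - 1).
Proof.
have [y yx yre] : exists2 y : C, y ^+ 2 = x & 0 <= complex.Re y.
  have [h|h] := leP 0 (complex.Re (sqrtC x : C)).
    by exists (sqrtC x) => //; rewrite sqrtCK.
  exists (- sqrtC x); first by rewrite sqrrN sqrtCK.
  by case: (sqrtC x : C) h => a b /= h; lra.
exists y => //; have -> : x - 1 = (y - 1) * (y + 1) by rewrite -yx; ring.
rewrite mdM ler_peMr ?md_ge0//.
apply: le_trans (Re_le_md _); apply: le_trans (ler_norm _).
by case: y yre {yx} => a b /= h; lra.
Qed.

Lemma root4_near1 x : exists2 y, y ^+ 4 = x & md (y - 1) <= md (x - 1).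
Proof.
have [y yx h] := sqrt_near1 x; have [z zy k] := sqrt_near1 y.
by exists z; [rewrite -yx -zy -exprM|exact: le_trans k h].
Qed.

(** Otherwise [y = - k * z] with [k] one of 1, [i], [- i]. Both numbers being near 1 would give
    [md (1 + k) <= 1], but this modulus is 2 or the square root of 2. *)
Lemma root4_near1_uniq y z : md (y - 1) <= 1 / 2 -> md (z - 1) <= 1 / 2 ->
  y ^+ 4 = z ^+ 4 -> y = z.
Proof.
move=> hy hz e.
have := e => /eqP; rewrite -subr_eq0.
pose i : C := Complex 0 1.
have ii : i * i = -1 by apply/eqP; rewrite eq_complex /=; apply/andP; split; apply/eqP; ring.
have -> : y ^+ 4 - z ^+ 4 = (y - z) * (y + z) * ((y - i * z) * (y + i * z)).
  rewrite (_ : (y - i * z) * (y + i * z) = y ^+ 2 - i * i * z ^+ 2); last by ring.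
  by rewrite ii; ring.
have far (k : C) : 1 < md (1 + k) -> md k = 1 -> y + k * z != 0.
  move=> k1 km; apply/eqP => h.
  have : 1 + k = - ((y - 1) + k * (z - 1)) by rewrite -[LHS]addr0 -oppr0 -h; ring.
  move/(congr1 md); rewrite mdN => e'; have := mdD (y - 1) (k * (z - 1)).
  by rewrite -e' mdM km; lra.
have mi : md i = 1 by rewrite md_im normr1.
have two (c : C) : md (1 + c) ^+ 2 = 2 -> 1 < md (1 + c).
  by have := md_ge0 (1 + c); nra.
have d2 (a b : R) : md (Complex a b : C) ^+ 2 = a ^+ 2 + b ^+ 2.
  by rewrite /md /= sqr_sqrtr// addr_ge0 ?sqr_ge0.
have n1 : y + z != 0.
  by rewrite -[z]mul1r far ?md1// (_ : 1 + 1 = rc 2) ?md_rc ?ger0_norm ?rc2//; lra.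
have n2 : y + i * z != 0.
  apply: far => //; apply: two.
  rewrite (_ : 1 + i = Complex 1 1); last by apply/eqP; rewrite eq_complex /= addr0 add0r !eqxx.
  by rewrite d2; ring.
have n3 : y - i * z != 0.
  rewrite -mulNr; apply: far; last by rewrite mdN.
  apply: two; rewrite (_ : 1 - i = Complex 1 (-1)); last first.
    by apply/eqP; rewrite eq_complex /= subr0 add0r !eqxx.
  by rewrite d2; ring.
by rewrite !mulf_eq0 (negbTE n1) (negbTE n2) (negbTE n3) !orbF subr_eq0 => /eqP.
Qed.

(* On a fine grid, the product over a row of the fourth roots near [1] of the quotients of
   consecutive values does not depend on the row; it is [-1] on the first row and [1] on
   the last. *)
Lemma no_winding_homotopy (h : R -> R -> C) :
  (forall s t, 0 <= s <= 1 -> 0 <= t <= 1 -> forall e, 0 < e -> exists2 d : R, 0 < d &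
     forall s' t', 0 <= s' <= 1 -> 0 <= t' <= 1 -> `|s' - s| < d -> `|t' - t| < d ->
       md (h s' t' - h s t) < e) ->
  (forall s t, 0 <= s <= 1 -> 0 <= t <= 1 -> h s t != 0) ->
  (forall s, h s 0 = h s 1) -> (forall t, h 1 t = h 1 0) ->
  ~ (forall t, h 0 t = cis t ^+ 2 * h 0 0).
Proof.
move=> hc hn0 hper h1 h0.
have [d d0 hd0] : exists2 d : R, 0 < d & forall s t s' t', 0 <= s <= 1 -> 0 <= t <= 1 ->
    0 <= s' <= 1 -> 0 <= t' <= 1 -> `|s' - s| < d -> `|t' - t| < d ->
    md (h s' t' / h s t - 1) <= 1 / 8.
  pose P (x y w : R) := exists2 d : R, 0 < d & forall s t s' t', x <= s <= x + w -> y <= t <= y + w ->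
    0 <= s <= 1 -> 0 <= t <= 1 -> 0 <= s' <= 1 -> 0 <= t' <= 1 ->
    `|s' - s| < d -> `|t' - t| < d -> md (h s' t' / h s t - 1) <= 1 / 8.
  suff [d d0 hd0] : P 0 0 1.
    exists d => // s t s' t' hs ht hs' ht'; apply: hd0 => //; by rewrite add0r.
  apply: square_ind.
    move=> x y w w0 [d1 p1 q1] [d2 p2 q2] [d3 p3 q3] [d4 p4 q4].
    exists (Num.min (Num.min d1 d2) (Num.min d3 d4)); first by rewrite !lt_min p1 p2 p3 p4.
    move=> s t s' t' /andP[xs sw] /andP[yt tw] hs ht hs' ht'; rewrite !lt_min.
    move=> /andP[/andP[a1 a2] /andP[a3 a4]] /andP[/andP[b1 b2] /andP[b3 b4]].
    have e1 : x + w / 2 + w / 2 = x + w by field.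
    have e2 : y + w / 2 + w / 2 = y + w by field.
    have [sx|sx] := leP s (x + w / 2); have [ty|ty] := leP t (y + w / 2).
    - by apply: q1 => //; apply/andP.
    - by apply: q3 => //; rewrite ?e2 ?(ltW ty) ?xs.
    - by apply: q2 => //; rewrite ?e1 ?(ltW sx) ?yt.
    - by apply: q4 => //; rewrite ?e1 ?e2 ?(ltW sx) ?(ltW ty).
  move=> x y hx hy; have := hn0 x y hx hy; rewrite -md_gt0 => m0.
  have [e e0 he] := hc x y hx hy (md (h x y) / 32) ltac:(lra).
  exists (e / 2); first by lra.
  move=> x' y' w /andP[w0 we] x'0 x'1 y'0 y'1 xx yy; exists (e / 2); first by lra.
  move=> s t s' t' ss tt hs ht hs' ht' h3 h4.
  have n1 : `|s - x| < e / 2 by rewrite ltr_norml; lra.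
  have n2 : `|t - y| < e / 2 by rewrite ltr_norml; lra.
  have k1 : md (h s t - h x y) < md (h x y) / 32 by apply: he => //; lra.
  have n3 : `|s' - x| < e by move: n1 h3; rewrite !ltr_norml; lra.
  have n4 : `|t' - y| < e by move: n2 h4; rewrite !ltr_norml; lra.
  have k2 : md (h s' t' - h x y) < md (h x y) / 32 by apply: he.
  have hst := hn0 s t hs ht.
  rewrite (_ : _ - 1 = (h s' t' - h s t) / h s t); last by field.
  rewrite mdM mdV ler_pdivrMr ?md_gt0//.
  have := md_dist (h x y) (h s t); rewrite mdB.
  have := md_tri (h x y) (h s' t') (h s t); rewrite [md (h x y - h s t)]mdB; lra.
(* The bound 64 puts [cis (1 / (2 * N))] near enough to 1 to be the root chosen on the first row. *)
have [N N64 Nd] : exists2 N : nat, (64 <= N)%N & (N%:R)^-1 < d.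
  exists (maxn 64 (Num.truncn d^-1).+1); first exact: leq_maxl.
  rewrite -[ltRHS]invrK ltf_pV2 ?posrE ?invr_gt0// ?ltr0n ?leq_max//.
  apply: lt_le_trans (truncnS_gt _) _; by rewrite ler_nat leq_maxr.
have N0 : (0 < N)%N by apply: leq_trans N64.
have NR : 0 < N%:R :> R by rewrite ltr0n.
(* Fourth roots are needed because the first row winds twice: its square roots [cis (1 / N)] would
   multiply to 1, while the fourth roots multiply to [cis (1 / 2) = -1]. *)
have root x : exists y, y ^+ 4 = x /\ md (y - 1) <= md (x - 1).
  by have [y] := root4_near1 x; exists y.
have [p hp] := choice root.
pose g (k : nat) : R := k%:R / N%:R.
have g01 k : (k <= N)%N -> 0 <= g k <= 1.
  by move=> kN; rewrite /g divr_ge0//= ler_pdivrMr// mul1r ler_nat.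
have gS k : g k.+1 - g k = (N%:R)^-1 by rewrite /g -mulrBl -natr1 (addrC _ 1) addrK mul1r.
pose H (a j : nat) := h (g a) (g j).
have Hn0 a j : (a <= N)%N -> (j <= N)%N -> H a j != 0.
  by move=> aN jN; apply: hn0; exact: g01.
have Hh a j : (a <= N)%N -> (j < N)%N -> md (H a j.+1 / H a j - 1) <= 1 / 8.
  move=> aN jN; apply: hd0; rewrite ?g01 ?(ltnW jN)//.
    by rewrite subrr normr0.
  by rewrite gS ger0_norm// invr_ge0 ltW.
have Hv a j : (a < N)%N -> (j <= N)%N -> md (H a.+1 j / H a j - 1) <= 1 / 8.
  move=> aN jN; apply: hd0; rewrite ?g01 ?(ltnW aN)//.
    by rewrite gS ger0_norm// invr_ge0 ltW.
  by rewrite subrr normr0.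
have near2 x y : md (x - 1) <= 1 / 8 -> md (y - 1) <= 1 / 8 -> md (x * y - 1) <= 1 / 2.
  move=> hx hy; rewrite (_ : _ - 1 = (x - 1) * (y - 1) + (x - 1) + (y - 1)); last by ring.
  apply: le_trans (mdD3 _ _ _) _; rewrite mdM.
  by have := md_ge0 (x - 1); have := md_ge0 (y - 1); nra.
pose S a := \prod_(j < N) p (H a j.+1 / H a j).
have Sstep a : (a < N)%N -> S a.+1 = S a.
  move=> aN; pose q j := p (H a.+1 j / H a j).
  have pn0 x : md (x - 1) <= 1 / 8 -> p x != 0.
    move=> hx; apply/eqP => px; have [_] := hp x; rewrite px sub0r mdN md1; lra.
  have tele (n : nat) : (n <= N)%N ->
      (\prod_(j < n) p (H a.+1 j.+1 / H a.+1 j)) * q 0%N = q n * \prod_(j < n) p (H a j.+1 / H a j).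
    elim: n => [|n IH] nN; first by rewrite !big_ord0 mul1r mulr1.
    rewrite !big_ord_recr /= mulrAC IH ?(ltnW nN)//.
    have -> : q n * \prod_(i < n) p (H a i.+1 / H a i) * p (H a.+1 n.+1 / H a.+1 n) =
      (q n * p (H a.+1 n.+1 / H a.+1 n)) * \prod_(i < n) p (H a i.+1 / H a i) by ring.
    (* The two ways around a grid cell: both products are fourth roots near 1 of
       [H a.+1 n.+1 / H a n]. *)
    have -> : q n * p (H a.+1 n.+1 / H a.+1 n) = q n.+1 * p (H a n.+1 / H a n); last by ring.
    have le8 x : md (x - 1) <= 1 / 8 -> md (p x - 1) <= 1 / 8.
      by move=> hx; have [_] := hp x; move=> /le_trans; apply.
    apply: root4_near1_uniq.
    - by apply: near2; apply: le8; [exact: Hv (ltnW nN)|exact: Hh].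
    - by apply: near2; apply: le8; [exact: Hv|exact: Hh (ltnW aN) nN].
    rewrite !exprMn /q !(proj1 (hp _)).
    have := Hn0 a n (ltnW aN) (ltnW nN); have := Hn0 a.+1 n aN (ltnW nN).
    have := Hn0 a n.+1 (ltnW aN) nN => u1 u2 u3.
    by field; rewrite u1 u2 u3.
  have q0N : q 0%N = q N.
    have g0 : g 0%N = 0 by rewrite /g mul0r.
    have gN : g N = 1 by rewrite /g mulfV// gt_eqF.
    by rewrite /q /H g0 gN !hper.
  have := tele N (leqnn N); rewrite -q0N [q 0%N * _]mulrC => /mulIf; apply.
  by apply: pn0; apply: Hv.
have SN : S 0%N = S N.
  have k (n : nat) : (n <= N)%N -> S 0%N = S n.
    by elim: n => // n IH nN; rewrite Sstep// -IH// ltnW.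
  exact: k.
have pu x y : md (x - 1) <= 1 / 8 -> md (y - 1) <= 1 / 2 -> y ^+ 4 = x -> p x = y.
  move=> hx hy yx; apply: root4_near1_uniq => //; last by rewrite (proj1 (hp x)).
  by have [_] := hp x; move=> /le_trans; apply; lra.
have SN1 : S N = 1.
  rewrite /S big1// => j _.
  have gN : g N = 1 by rewrite /g mulfV// gt_eqF.
  rewrite /H gN !(h1 (g _)) mulfV; last by apply: hn0; lra.
  by apply: pu; rewrite ?subrr ?md0 ?expr1n//; lra.
have S0 : S 0%N = -1.
  have g0 : g 0%N = 0 by rewrite /g mul0r.
  pose u : R := (2 * N%:R)^-1.
  have u0 : 0 < u by rewrite invr_gt0 mulr_gt0.
  have cu4 : cis u ^+ 4 = cis (N%:R)^-1 ^+ 2.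
    have -> : (N%:R)^-1 = u + u by rewrite /u; field; rewrite gt_eqF.
    by rewrite cisD -expr2 -exprM.
  have pE j : (j < N)%N -> p (H 0%N j.+1 / H 0%N j) = cis u.
    move=> jN; have hh := Hh 0%N j (leq0n _) jN; apply: pu => //.
      rewrite -cis0; apply: le_trans (cis_lip _ _) _; rewrite subr0 (ger0_norm (ltW u0)).
      have N64' : (64 : R) <= N%:R by rewrite (ler_nat _ 64).
      have : u <= 1 / 128 by rewrite /u -[_^-1]mul1r ler_pdivrMr ?mulr_gt0//; lra.
      by lra.
    rewrite cu4 /H g0 [h 0 (g j.+1)]h0 [h 0 (g j)]h0.
    have -> : g j.+1 = g j + (N%:R)^-1 by rewrite -(gS j) addrC subrK.
    have h00 : h 0 0 != 0 by apply: hn0; lra.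
    by rewrite cisD; have := cis_neq0 (g j) => c0; field; rewrite c0 h00.
  rewrite /S (eq_bigr (fun=> cis u)) => [|j _]; last by apply: pE; case: j.
  rewrite prodr_const card_ord -cis_half.
  have cn (n : nat) : cis u ^+ n = cis (n%:R * u).
    elim: n => [|n IH]; first by rewrite mul0r cis0.
    by rewrite exprS IH -cisD -natr1 mulrDl mul1r addrC.
  by rewrite cn; congr cis; rewrite /u; field; rewrite gt_eqF.
have : md (S 0%N - S N) = 0 by rewrite SN subrr md0.
rewrite S0 SN1 (_ : -1 - 1 = - rc 2); last by rewrite rc2; ring.
rewrite mdN md_rc ger0_norm //; lra.
Qed.

End Winding.

(** * Charts and holomorphic maps *)

Section Bridge.
Variable R : realType.
Local Notation C := (Cplx R).
Implicit Types (z w : C).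

Lemma lt0_rc (e : C) : 0 < e -> exists2 r : R, 0 < r & e = rc r.
Proof.
case: e => a b; rewrite ltcE /= => /andP[/eqP -> a0]; by exists a.
Qed.

(** Balls of [C], as a normed module over itself, have radii in [C]; here they are traded for real
    radii. *)
Lemma nbhs_md z (A : set C) : nbhs z A <->
  exists2 e : R, 0 < e & forall w, md (w - z) < e -> A w.
Proof.
split.
  move=> /nbhs_ballP[e /= e0 h]; have [r r0 er] := lt0_rc e0.
  by exists r => // w hw; apply: h; rewrite -ball_normE /= distrC norm_md er ltcR.
move=> [e e0 h]; apply/nbhs_ballP; exists (rc e) => /=; first by rewrite ltcR.
by move=> w; rewrite -ball_normE /= distrC norm_md ltcR => /h.
Qed.

Lemma near_differentiable (V W : normedModType C) (f g : V -> W) (x : V) :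
  (\forall y \near x, f y = g y) -> differentiable f x -> differentiable g x.
Proof.
move=> fg df; have gx : g x = f x by rewrite (nbhs_singleton fg).
have h : g \o shift x = cst (g x) + 'd f x +o_ 0 id.
  apply/eqaddoP => e e0; have /diff_locally/eqaddoP/(_ e e0) := df.
  have fg0 : \forall h \near (0 : V), f (h + x) = g (h + x).
    have := fg; rewrite -{1}[x]add0r => h.
    have sc : (h + x) @[h --> (0 : V)] --> 0 + x by apply: cvgD; [exact: cvg_id|exact: cvg_cst].
    exact: (sc _ h).
  apply: filter_app; apply: filterS fg0 => y fgy.
  rewrite /shift /= in fgy *.
  by rewrite !fctE /= -fgy gx.
have dg : 'd g x = 'd f x :> (V -> W).
  by apply: diff_unique h; exact: diff_continuous.
apply/diff_locallyP; split; rewrite dg; [exact: (diff_continuous df)|exact: h].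
Qed.

Lemma differentiable_hd (f : C -> C) z : differentiable f z -> hd f z ('d f z 1).
Proof.
move=> /diff_locally/eqaddoP h e e0.
have /h/nbhs_md [d d0 hd] : 0 < rc e by rewrite ltcR.
exists d => // w wz; have := hd (w - z); rewrite subr0 => /(_ wz).
rewrite !fctE /= subrK.
rewrite -[X in 'd f z X]mulr1 linearZ /= !norm_md -rcM lecR.
by rewrite opprD addrA [(w - z) *: _]mulrC.
Qed.

Lemma differentiable_holo (f : C -> C) z : differentiable f z <-> holo f z.
Proof.
split=> [/differentiable_hd|[d hf]]; first by exists ('d f z 1).
have lin : linear (fun h : C => h * d : C).
  by move=> a u v; rewrite mulrDl -mulrA.
pose dM := GRing.isLinear.Build _ _ _ _ _ lin.
pose dL : {linear C -> C} := HB.pack (fun h : C => h * d : C) dM.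
have cd : continuous dL by move=> x; exact: mulrr_continuous.
have h : f \o shift z = cst (f z) + dL +o_ 0 id.
  apply/eqaddoP => e e0; have [r r0 ->] := lt0_rc e0.
  have [s s0 hs] := hf r r0; apply/nbhs_md; exists s => // w; rewrite subr0 => ws.
  have := hs (w + z); rewrite addrK => /(_ ws).
  by rewrite !fctE /= !norm_md -rcM lecR opprD addrA [d * w]mulrC.
have dg := diff_unique cd h.
by apply/diff_locallyP; split; rewrite dg; [exact: cd|exact: h].
Qed.

Lemma differentiable_mx1 (W : normedModType C) (f : W -> 'rV[C]_1) (x : W) :
  differentiable (fun y => f y 0 0) x -> differentiable f x.
Proof.
move=> h; have -> : f = fun y => f y 0 0 *: (const_mx 1 : 'rV[C]_1).
  by apply/funext => y; apply/rowP => i; rewrite !mxE mulr1 ord1.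
exact: differentiableZl.
Qed.

Lemma differentiable_mulmx n (A : 'M[C]_(n, 1)) (u : 'rV[C]_n) :
  differentiable (fun u : 'rV[C]_n => u *m A) u.
Proof.
apply: differentiable_mx1.
have -> : (fun w : 'rV[C]_n => (w *m A) 0 0) =
    \sum_(j < n) (A j 0 *: (fun w : 'rV[C]_n => w 0 j : C)).
  by apply/funext => w; rewrite mxE fct_sumE; apply: eq_bigr => j _; rewrite mulrC.
by apply: differentiable_sum => j; apply: differentiableZ; exact: differentiable_coord.
Qed.

Lemma differentiable_mulmx1 n (A : 'M[C]_(1, n)) (u : 'rV[C]_1) :
  differentiable (fun u : 'rV[C]_1 => u *m A) u.
Proof.
have -> : (fun u : 'rV[C]_1 => u *m A) = fun u => u 0 0 *: row 0 A.
  by apply/funext => w; apply/rowP => j; rewrite !mxE big_ord1.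
by apply: differentiableZl; exact: differentiable_coord.
Qed.

End Bridge.

(** * Maps read in charts *)

Section Charts.
Variables (R : realType).
Local Notation C := (Cplx R).

Lemma differentiable_comp_at (V W Z : normedModType C) (f : V -> W) (g : W -> Z) x y :
  differentiable f x -> f x = y -> differentiable g y -> differentiable (g \o f) x.
Proof. by move=> hf <-; exact: differentiable_comp. Qed.

(** The axioms of [complex_manifold] on charts, which are also established for [CP1 R] and
    [Cspace R n]. *)
Definition good_atlas (n : nat) (M : chartedSpace R n) : Prop :=
  [/\ forall c, atlas M c -> is_chart c,
      forall x : M, exists2 c, atlas M c & chart_dom c x &
      forall c d, atlas M c -> atlas M d -> compatible c d].

Lemma complex_manifold_good n (M : chartedSpace R n) : complex_manifold M -> good_atlas M.
Proof. by case. Qed.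

Section OneChart.
Variables (n : nat) (T : topologicalType) (c : chart R n T).
Hypothesis cc : is_chart c.

Lemma chart_mapK x : chart_dom c x -> chart_inv c (chart_map c x) = x.
Proof. by case: cc => _ _ h _ _; exact: h. Qed.

Lemma chart_codom_map x : chart_dom c x -> chart_codom c (chart_map c x).
Proof. by move=> cx; exists x. Qed.

Lemma near_chart_dom x : chart_dom c x -> \forall y \near x, chart_dom c y.
Proof. by move=> cx; apply: open_nbhs_nbhs; split => //; case: cc. Qed.

Lemma near_chart_codom x : chart_dom c x -> \forall v \near chart_map c x, chart_codom c v.
Proof.
move=> cx; apply: open_nbhs_nbhs; split; first by case: cc.
exact: chart_codom_map.
Qed.

Lemma near_chart_inv x (A : set T) : chart_dom c x -> nbhs x A ->
  \forall v \near chart_map c x, A (chart_inv c v).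
Proof.
move=> cx Ax; case: cc => _ _ _ _ /(_ _ (chart_codom_map cx)); apply.
by rewrite chart_mapK.
Qed.

End OneChart.

Lemma atlas_maximal n (M : chartedSpace R n) c : good_atlas M -> atlas M c ->
  maximal_atlas M c.
Proof. by move=> [h _ k] cM; split; [exact: h|move=> d dM; exact: k]. Qed.

(** Both charts are compatible with a chart [e] of the atlas around the point, and the transition
    factors through [e] near it. *)
Lemma maximal_transition n (M : chartedSpace R n) c d : good_atlas M ->
  maximal_atlas M c -> maximal_atlas M d -> holomorphic_transition c d.
Proof.
move=> [isc cov _] [cc cM] [dc dM] _ [x [cx dx] <-].
have [e eM ex] := cov x.
have ec := isc e eM.
have h1 : differentiable (chart_map e \o chart_inv c) (chart_map c x).
  by have [+ _] := cM e eM; apply; exists x.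
have h2 : differentiable (chart_map d \o chart_inv e) (chart_map e x).
  by have [_] := dM e eM; apply; exists x.
apply: near_differentiable (_ : differentiable ((chart_map d \o chart_inv e) \o (chart_map e \o chart_inv c)) _).
  near=> v; rewrite /= chart_mapK //; near: v.
  by apply: near_chart_inv => //; exact: near_chart_dom.
by apply: (differentiable_comp_at h1 _ h2); rewrite /= chart_mapK.
Unshelve. all: by end_near. Qed.

Definition reads m n (M : chartedSpace R m) (N : chartedSpace R n) (f : M -> N) x
    (c : chart R m M) (d : chart R n N) :=
  differentiable (chart_map d \o f \o chart_inv c) (chart_map c x).

Lemma reads_change m n (M : chartedSpace R m) (N : chartedSpace R n) (f : M -> N) x c c' d d' :
  good_atlas M -> good_atlas N -> {for x, continuous f} ->
  maximal_atlas M c -> maximal_atlas M c' -> maximal_atlas N d -> maximal_atlas N d' ->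
  chart_dom c x -> chart_dom c' x -> chart_dom d (f x) -> chart_dom d' (f x) ->
  reads f x c d -> reads f x c' d'.
Proof.
move=> gM gN fx cM cM' dN dN' cx cx' dx dx' r.
have [cc _] := cM; have [cc' _] := cM'; have [dc _] := dN; have [dc' _] := dN'.
have t1 := maximal_transition gM cM' cM (ex_intro2 _ _ x (conj cx' cx) erefl).
have t2 := maximal_transition gN dN dN' (ex_intro2 _ _ (f x) (conj dx dx') erefl).
apply: near_differentiable (_ : differentiable ((chart_map d' \o chart_inv d) \o
  ((chart_map d \o f \o chart_inv c) \o (chart_map c \o chart_inv c'))) _).
  near=> v.
  have h1 : chart_dom c (chart_inv c' v).
    by near: v; apply: near_chart_inv => //; exact: near_chart_dom.
  have h2 : chart_dom d (f (chart_inv c' v)).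
    near: v; apply: (near_chart_inv cc' (A := f @^-1` chart_dom d)) => //.
    by apply: fx; exact: near_chart_dom.
  by rewrite /= chart_mapK// chart_mapK.
apply: (differentiable_comp_at _ _ t2); last by rewrite /= !chart_mapK.
by apply: (differentiable_comp_at t1 _ r); rewrite /= chart_mapK.
Unshelve. all: by end_near. Qed.

Lemma holomorphic_reads m n (M : chartedSpace R m) (N : chartedSpace R n) (f : M -> N) x c d :
  good_atlas M -> good_atlas N -> holomorphic f ->
  maximal_atlas M c -> maximal_atlas N d -> chart_dom c x -> chart_dom d (f x) ->
  reads f x c d.
Proof.
move=> gM gN [fc fh] cM dN cx dx; have [c' [d' [cM' cx' dN' dx' r]]] := fh x.
apply: reads_change r => //; try exact: atlas_maximal.
exact: fc.
Qed.

Lemma reads_comp l m n (L : chartedSpace R l) (M : chartedSpace R m) (N : chartedSpace R n)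
   (f : L -> M) (g : M -> N) x b c d :
  is_chart b -> is_chart c -> chart_dom b x -> {for x, continuous f} -> chart_dom c (f x) ->
  reads f x b c -> reads g (f x) c d -> reads (g \o f) x b d.
Proof.
move=> bc cc bx fx cx r1 r2.
apply: near_differentiable (_ : differentiable ((chart_map d \o g \o chart_inv c) \o
  (chart_map c \o f \o chart_inv b)) _).
  near=> v; rewrite /= chart_mapK //; near: v.
  apply: (near_chart_inv bc (A := f @^-1` chart_dom c)) => //.
  by apply: fx; exact: near_chart_dom.
by apply: (differentiable_comp_at r1 _ r2); rewrite /= chart_mapK.
Unshelve. all: by end_near. Qed.

Lemma holomorphic_comp l m n (L : chartedSpace R l) (M : chartedSpace R m) (N : chartedSpace R n)
   (f : L -> M) (g : M -> N) :
  (forall c, atlas L c -> is_chart c) -> good_atlas M -> good_atlas N ->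
  holomorphic f -> holomorphic g -> holomorphic (g \o f).
Proof.
move=> gL gM gN [fc fh] hg; split.
  by move=> x; apply: continuous_comp; [exact: fc|case: hg => gc _; exact: gc].
move=> x; have [b [c [bL bx cM cx r]]] := fh x.
have [_ cov _] := gN; have [d dN dx] := cov (g (f x)).
have cmax := atlas_maximal gM cM; have dmax := atlas_maximal gN dN.
exists b, d; split => //; apply: (reads_comp (c := c)) r _ => //; [exact: gL|by case: cmax|exact: fc|].
exact: holomorphic_reads.
Qed.

End Charts.

(** * Subspaces and their induced charts *)

Section Subtypes.
Variable R : realType.

Lemma nbhs_set_type (T : topologicalType) (A : set T) (x : set_type A) (U : set (set_type A)) :
  nbhs x U <-> exists2 V, nbhs (set_val x) V & forall y : set_type A, V (set_val y) -> U y.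
Proof.
split.
  rewrite nbhsE => -[_ [[W oW <-] Wx] WU]; exists W; first by exists W => //; split.
  by move=> y Wy; apply: WU.
move=> [V]; rewrite !nbhsE => -[W [oW Wx] WV] h.
exists (set_val @^-1` W); first by split => //; exists W.
by move=> y Wy; apply: h; exact: WV.
Qed.

Lemma set_val_continuous (T : topologicalType) (A : set T) :
  continuous (set_val : set_type A -> T).
Proof. by move=> x V Vx; apply/nbhs_set_type; exists V. Qed.

Lemma set_val_insubd (T : choiceType) (A : set T) (x0 : set_type A) x :
  A x -> set_val (insubd x0 x) = x.
Proof. by move=> Ax; rewrite set_valE insubdK// inE. Qed.

Lemma insubd_set_val (T : choiceType) (A : set T) (x0 x : set_type A) :
  insubd x0 (set_val x) = x.
Proof. by apply: val_inj; rewrite -!set_valE set_val_insubd //; exact: set_valP. Qed.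

Lemma near_insubd (T : topologicalType) (A : set T) (x0 x : set_type A) (U : set (set_type A)) :
  nbhs x U -> \forall y \near set_val x, A y -> U (insubd x0 y).
Proof.
move=> /nbhs_set_type[V Vx VU]; apply: filterS Vx => y Vy Ay.
by apply: VU; rewrite set_val_insubd.
Qed.

Section Induced.
Variables (k n : nat) (kn : (k <= n)%N) (M : chartedSpace R n) (S : set M).
Local Notation IS := (induced_space k S).

Definition restricts (e : chart R k IS) (c : chart R n M) :=
  [/\ is_chart e, maximal_atlas M c, slice_chart k S c,
   chart_dom e = set_val @^-1` chart_dom c &
   forall x, chart_dom e x -> chart_map e x = chart_map c (set_val x) *m pid_mx k].

Lemma induced_atlasP e : atlas IS e <-> exists c, restricts e c.
Proof.
split=> [[ec [c [? ? ? ?]]]|[c [ec ? ? ? ?]]]; first by exists c.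
by split => //; exists c.
Qed.

Variables (e : chart R k IS) (c : chart R n M).
Hypothesis ec : restricts e c.

Lemma restricts_dom y : chart_dom e y <-> chart_dom c (set_val y).
Proof. by case: ec => _ _ _ -> _. Qed.

Lemma pid_mx_sqr : (pid_mx k : 'M[Cplx R]_(k, n)) *m (pid_mx k : 'M[Cplx R]_(n, k)) = 1%:M.
Proof.
have := @mul_pid_mx (Cplx R) k n k k k; rewrite minnn (minn_idPr kn).
by move=> h; rewrite -pid_mx_1 -h.
Qed.

Lemma restricts_map y : chart_dom e y -> chart_map c (set_val y) = chart_map e y *m pid_mx k.
Proof.
case: ec => ce cM sc dE mE ey; have cy : chart_dom c (set_val y) by rewrite -restricts_dom.
have [w hw] := proj1 (sc _ cy) (set_valP y).
by rewrite mE// hw -[w *m _ *m _]mulmxA pid_mx_sqr mulmx1.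
Qed.

Lemma restricts_inv w : chart_codom e w ->
  set_val (chart_inv e w) = chart_inv c (w *m pid_mx k).
Proof.
move=> [y ey <-]; have ce : is_chart e by case: ec.
have [cc _] : maximal_atlas M c by case: ec.
by rewrite (chart_mapK ce ey) -restricts_map// chart_mapK //; apply/restricts_dom.
Qed.

End Induced.

Lemma mul_pid_self n (v : 'rV[Cplx R]_n) : v *m pid_mx n = v.
Proof. by rewrite pid_mx_1 mulmx1. Qed.

End Subtypes.

(** * The Riemann sphere and local sections *)

Section Sphere.
Variable R : realType.
Local Notation C := (Cplx R).
Local Notation S2 := (one_point_compactification C).
Local Notation aff := (CP1_affine_chart R).
Local Notation inf := (CP1_infty_chart R).

Lemma some_eq (z w : C) : ((Some z : S2) == Some w) = (z == w).
Proof. by apply/eqP/eqP => [[]|->]. Qed.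

Lemma compact_disc (M : R) : compact [set z : C | md z <= M].
Proof.
rewrite compact_ultra => F UF FM.
have PF := @ultra_proper _ _ UF.
have [l hl] := @ulim_ex R C F UF id M FM.
exists l; split; first exact: (ulim_le (UU := UF) FM hl).
move=> A /nbhs_md[e e0 h]; apply: filterS (hl e e0) => z; exact: h.
Qed.

Lemma md_continuous : continuous (md : C -> R).
Proof.
move=> z A /nbhs_ballP[e /= e0 h]; apply/nbhs_md; exists e => // w wz; apply: h.
rewrite /ball /=.
have := md_dist z w; have := md_dist w z; rewrite [md (z - w)]mdB ltr_norml; lra.
Qed.

Lemma compact_md_bounded (K : set C) : compact K -> exists M : R, forall z, K z -> md z <= M.
Proof.
move=> cK; have [K0|/eqP/negP/negP K0] := pselect (K = set0).
  by exists 0 => z; rewrite K0.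
have [||c _ hc] := @compact_EVT_max C R md K _ cK.
- by apply/set0P.
- exact/continuous_subspaceT/md_continuous.
by exists (md c) => z Kz; apply: hc; rewrite inE.
Qed.

Lemma nbhs_none (A : set S2) : nbhs (None : S2) A <->
  A None /\ exists M : R, forall z : C, M < md z -> A (Some z).
Proof.
split=> [[K [cK clK] KA]|[A0 [M hM]]].
  split; first by apply: KA; right.
  have [M hM] := compact_md_bounded cK; exists M => z zM.
  apply: KA; left; exists z => //= Kz; by have := hM z Kz; lra.
exists [set z : C | md z <= M].
  split; first exact: compact_disc.
  have -> : [set z : C | md z <= M] = md @^-1` [set x | x <= M] by [].
  by apply: preimage_closed; [move=> z _; exact: md_continuous|exact: closed_le].
move=> _ [[z /= zM <-]|->//]; apply: hM; rewrite ltNge; exact/negP.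
Qed.

Lemma nbhs_some (z : C) (A : set S2) : nbhs (Some z : S2) A <->
  exists2 e : R, 0 < e & forall w, md (w - z) < e -> A (Some w).
Proof.
rewrite [nbhs _]/(Some @ nbhs z) /=; exact: nbhs_md.
Qed.

(** The inverse of [CP1_infty_chart] with rows of length 1 replaced by complex numbers. *)
Definition sphere_inv (z : C) : S2 := if z == 0 then None else Some z^-1.

Lemma sphere_inv_continuous : continuous sphere_inv.
Proof.
move=> z; have [->|z0] := eqVneq z 0.
  move=> A; rewrite /sphere_inv eqxx => /nbhs_none[A0 [M hM]].
  have M0 : 0 < `|M| + 1 by have := normr_ge0 M; lra.
  apply/nbhs_md; exists (`|M| + 1)^-1; first by rewrite invr_gt0.
  move=> w; rewrite subr0 /preimage /=; case: (eqVneq w 0) => // w0 wM.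
  apply: hM; rewrite mdV.
  apply: (@lt_trans _ _ (`|M| + 1)); first by have := ler_norm M; lra.
  by rewrite -[ltLHS]invrK ltf_pV2 ?posrE ?invr_gt0 ?md_gt0.
move=> A; rewrite {1}/sphere_inv (negbTE z0) => /nbhs_some[e e0 h].
have [r r0 hr] := hd_cont (hdV z0) e0.
have mz : 0 < md z by rewrite md_gt0.
apply/nbhs_md; exists (Num.min r (md z)); first by rewrite lt_min r0.
move=> w; rewrite lt_min => /andP[wr wz]; rewrite /preimage /= /sphere_inv.
case: (eqVneq w 0) => [w0|w0]; first by move: wz; rewrite w0 sub0r mdN ltxx.
by apply: h; exact: hr.
Qed.

Lemma const_mx_differentiable (z : C) : differentiable (fun z : C => const_mx z : 'rV[C]_1) z.
Proof.
apply: differentiable_mx1; apply/differentiable_holo.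
by apply: holo_near ltr01 _ (holo_id z) => w _; rewrite mxE.
Qed.

Lemma const_mx_continuous : continuous (fun z : C => const_mx z : 'rV[C]_1).
Proof. move=> z; exact/differentiable_continuous/const_mx_differentiable. Qed.

Lemma aff_chart : is_chart aff.
Proof.
split=> [||p [z _ <-]|p [z _ <-]|v _] /=.
- by have := @one_point_compactification_open_some C setT openT.
- suff -> : chart_codom aff = setT by exact: openT.
  apply/seteqP; split=> // v _; exists (Some (v 0 0)); first by exists (v 0 0).
  by apply/rowP => i; rewrite mxE ord1.
- by rewrite mxE.
- move=> A; rewrite /= => hA; apply/nbhs_some.
  by have /nbhs_md := @const_mx_continuous z A hA.
- apply: (@continuous_comp _ _ _ (fun v : 'rV[C]_1 => v 0 0) (Some : C -> S2)).
    exact: coord_continuous.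
  exact: one_point_compactification_some_continuous.
Qed.

Lemma sphere_inv_dom w : chart_dom inf (sphere_inv w).
Proof. by rewrite /= /sphere_inv; case: (eqVneq w 0) => // w0; rewrite some_eq invr_eq0. Qed.

Lemma sphere_invK w : chart_map inf (sphere_inv w) = const_mx w.
Proof.
apply/rowP => i; rewrite /= /sphere_inv !mxE.
by case: (eqVneq w 0) => [->//|_]; rewrite invrK.
Qed.

Lemma inf_codom : chart_codom inf = setT.
Proof.
apply/seteqP; split=> // v _; exists (sphere_inv (v 0 0)); first exact: sphere_inv_dom.
by rewrite sphere_invK; apply/rowP => i; rewrite mxE ord1.
Qed.

Lemma inf_dom_open : open (chart_dom inf).
Proof.
rewrite openE => -[z|] /= h; rewrite /interior; last first.
  apply/nbhs_none; split => //; exists 0 => z z0; rewrite /= some_eq.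
  by rewrite -md_gt0.
apply/nbhs_some; rewrite some_eq in h.
exists (md z); first by rewrite md_gt0.
by move=> w; rewrite /= some_eq; apply: contraTneq => ->; rewrite sub0r mdN ltxx.
Qed.

Lemma inf_chart : is_chart inf.
Proof.
split=> [||[z|] /= p0|[z|] /= p0|v _].
- exact: inf_dom_open.
- rewrite inf_codom; exact: openT.
- rewrite some_eq in p0.
  by rewrite mxE invr_eq0 (negbTE p0) invrK.
- by rewrite mxE eqxx.
- rewrite some_eq in p0.
  move=> A; rewrite /= => hA; apply/nbhs_some.
  have /nbhs_md[e e0 he] := @const_mx_continuous z^-1 A hA.
  have [r r0 hr] := hd_cont (hdV p0) e0.
  by exists r => // w /hr /he.
- move=> A; rewrite /= => hA; apply/nbhs_none.
  have /nbhs_md[e e0 he] := @const_mx_continuous 0 A hA.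
  split; first by have := he 0; rewrite subrr md0 => /(_ e0).
  exists e^-1 => z ze; have z0 : 0 < md z by apply: lt_trans ze; rewrite invr_gt0.
  apply: he; rewrite subr0 mdV -[ltRHS]invrK ltf_pV2 ?posrE ?invr_gt0//.
- apply: (@continuous_comp _ _ _ (fun v : 'rV[C]_1 => v 0 0) sphere_inv).
    exact: coord_continuous.
  exact: sphere_inv_continuous.
Qed.

Lemma CP1_good : good_atlas (CP1 R).
Proof.
have coord v : differentiable (fun v : 'rV[C]_1 => v 0 0) v by exact: differentiable_coord.
have inv (v : 'rV[C]_1) : v 0 0 != 0 ->
    differentiable (fun v : 'rV[C]_1 => const_mx (v 0 0)^-1 : 'rV[C]_1) v.
  move=> v0; apply: (@differentiable_comp _ _ _ _ (fun v : 'rV[C]_1 => v 0 0) (fun z => const_mx z^-1 : 'rV[C]_1)).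
    exact: coord.
  apply: differentiable_mx1; apply/differentiable_holo.
  by exists (- ((v 0 0) ^- 2)); apply: hd_near ltr01 _ (hdV v0) => w _; rewrite mxE.
have ident (f : 'rV[C]_1 -> 'rV[C]_1) v : f =1 id -> differentiable f v.
  move=> h; have -> : f = id by apply/funext.
  exact: ex_diff.
split=> [c [->|->]|p|]; [exact: aff_chart|exact: inf_chart| |].
  case: p => [z|]; [exists aff; [by left|by exists z]|exists inf; [by right|by []]].
suff h : forall c d, atlas (CP1 R) c -> atlas (CP1 R) d -> holomorphic_transition c d.
  by move=> c d hc hd; split; exact: h.
move=> c d [->|->] [->|->] _ [p [/= pc pd] <-].
- by apply: ident => v; apply/rowP => i; rewrite /= mxE ord1.
- case: pc pd => z _ <- /=; rewrite some_eq => z0.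
  have -> : chart_map inf \o chart_inv aff = fun v : 'rV[C]_1 => const_mx (v 0 0)^-1 by [].
  by apply: inv; rewrite mxE.
- case: pd pc => z _ <- /=; rewrite some_eq => z0.
  have -> : chart_map aff \o chart_inv inf = fun v : 'rV[C]_1 => const_mx (v 0 0)^-1.
    by apply/funext => v /=; case: (eqVneq (v 0 0) 0) => [->|//]; rewrite invr0.
  by apply: inv; rewrite mxE invr_eq0.
- apply: ident => v; apply/rowP => i; rewrite /= mxE ord1.
  by case: (eqVneq (v 0 0) 0) => [->//|_]; rewrite invrK.
Qed.

Lemma Cspace_good n : good_atlas (Cspace R n).
Proof.
split=> [c ->|x|c d -> ->].
- split; [exact: openT| |by []|by move=> x _; exact: cvg_id|by move=> x _; exact: cvg_id].
  suff -> : chart_codom (Chart setT id id : chart R n (Cspace R n)) = setT by exact: openT.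
  by apply/seteqP; split => // x _; exists x.
- by exists (Chart setT id id).
- by split=> v _ /=; exact: (@ex_diff _ _ _ _ _ id id).
Qed.

End Sphere.

(** [s] is total and only its germ at [F x] is constrained, so sections can be chosen for all [x] at
    once. *)
Definition local_inverse_at (R : realType) (n : nat) (X : chartedSpace R n)
    (F : X -> Cspace R n) (x : X) (s : Cspace R n -> X) :=
  [/\ s (F x) = x,
   \forall w \near F x, F (s w) = w,
   \forall y \near x, s (F y) = y,
   \forall w \near F x, {for w, continuous s} &
   \forall w \near F x, forall c, maximal_atlas X c -> chart_dom c (s w) ->
     reads s w (Chart setT id id : chart R n (Cspace R n)) c].

Section LocalSection.
Variables (R : realType) (n : nat) (X : chartedSpace R n) (gX : good_atlas X).
Variables (F : X -> Cspace R n) (hF : local_biholomorphism F).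
Local Notation idc := (Chart setT id id : chart R n (Cspace R n)).

Lemma idc_maximal : maximal_atlas (Cspace R n) idc.
Proof. exact: (atlas_maximal (Cspace_good R n)). Qed.

(** In full dimension the slice charts are charts of the ambient manifold, so holomorphy between
    subsets can be read there. It is applied both to [F] and to its local inverse. *)
Lemma induced_reads m (M N : chartedSpace R m) (gM : good_atlas M) (A : set M) (B : set N)
    (h : induced_space m A -> induced_space m B) (f : M -> N) :
  open A -> (forall y, set_val (h y) = f (set_val y)) -> holomorphic h ->
  forall x, A x -> [/\ {for x, continuous f} & exists c d,
    [/\ maximal_atlas M c, maximal_atlas N d, chart_dom c x, chart_dom d (f x) & reads f x c d]].
Proof.
move=> oA hf [hc hh] x Ax.
pose x0 : set_type A := exist _ x (mem_set Ax).
have x0E : set_val x0 = x by [].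
have nA : \forall y \near x, A y by apply: open_nbhs_nbhs.
have fc : {for x, continuous f}.
  move=> V; rewrite -[f x]/(f (set_val x0)) -hf => Vx.
  have := hc x0 _ (proj2 (nbhs_set_type _ _) (ex_intro2 _ _ V Vx (fun _ => id))).
  move=> /(near_insubd x0); rewrite x0E => h1.
  apply: filterS (filterI nA h1) => y [Ay /(_ Ay) /=].
  by rewrite hf set_val_insubd.
split; first exact: fc.
have [e [e' [/induced_atlasP[c ec] ex /induced_atlasP[d ed] ex' r]]] := hh x0.
have [ce cM _ _ cE] := ec; have [de dN _ _ dE] := ed.
have cx : chart_dom c x by exact: (proj1 (restricts_dom ec x0) ex).
have fx0 : f x = set_val (h x0) by rewrite hf.
have dx0 := proj1 (restricts_dom ed (h x0)) ex'.
have dx : chart_dom d (f x) := eq_ind_r (chart_dom d) dx0 fx0.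
exists c, d; split; [exact: cM|exact: dN|exact: cx|exact: dx|].
have cex : chart_map e x0 = chart_map c x by rewrite cE// mul_pid_self.
rewrite /reads -cex; apply: near_differentiable r; near=> w.
have wc : chart_codom e w by near: w; exact: near_chart_codom.
have [y ey yw] := wc.
have hy : chart_dom e' (h y).
  have : chart_dom e' (h (chart_inv e w)).
    near: w; apply: (near_chart_inv ce (A := h @^-1` chart_dom e')) => //.
    by apply: hc; exact: (near_chart_dom de ex').
  by rewrite -yw chart_mapK.
rewrite /= -{1}yw chart_mapK// dE// mul_pid_self hf; congr (chart_map d (f _)).
by rewrite -[w]mul_pid_self -(restricts_inv (leqnn m) ec)// -yw chart_mapK.
Unshelve. all: by end_near. Qed.

Lemma local_biholomorphism_reads x c : maximal_atlas X c -> chart_dom c x ->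
  {for x, continuous F} /\ reads F x c idc.
Proof.
move=> cX cx; have [U [oU Ux oFU [h [hh _] hE]]] := hF x.
have [fc [c' [d' [cM dN cx' dx' r]]]] := induced_reads gX oU hE hh Ux.
split; first exact: fc.
exact: (reads_change gX (Cspace_good R n) fc cM cX dN idc_maximal cx' cx dx' I r).
Qed.

Lemma local_section x : exists s, local_inverse_at F x s.
Proof.
have [U [oU Ux oFU [h [hh [g [hg gh ghol]]] hE]]] := hF x.
pose x0 : set_type U := exist _ x (mem_set Ux).
have FUx : (F @` U) (F x) by exists x.
pose b0 : set_type (F @` U) := exist _ (F x) (mem_set FUx).
pose s w := set_val (g (insubd b0 w)).
have sE (y : induced_space n (F @` U)) : set_val (g y) = s (set_val y) by rewrite /s insubd_set_val.
have nFU : \forall w \near F x, (F @` U) w by apply: open_nbhs_nbhs.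
have sF y : U y -> s (F y) = y.
  move=> Uy; pose y0 : set_type U := exist _ y (mem_set Uy).
  by rewrite -[F y]/(F (set_val y0)) -hE -sE hg.
have key := induced_reads (Cspace_good R n) oFU sE ghol.
exists s; split.
- exact: sF.
- apply: filterS nFU => _ [y Uy <-]; by rewrite sF.
- apply: filterS (_ : \forall y \near x, U y); first exact: sF.
  exact: open_nbhs_nbhs.
- by apply: filterS nFU => w /key[].
apply: filterS nFU => w /key[sc [c' [d' [cM dN cx dx r]]]] c cX cs.
exact: (reads_change (Cspace_good R n) gX sc cM idc_maximal dN cX cx I dx cs r).
Qed.

End LocalSection.

(** * Curves over the lines through a point *)

Section Moebius.
Variable R : realType.
Local Notation C := (Cplx R).
Local Notation S2 := (one_point_compactification C).

(* Homogeneous coordinates on the sphere. *)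
Definition hx (P : S2) : C := if P is Some z then z else 1.
Definition hy (P : S2) : C := if P is Some z then 1 else 0.
Definition cross (P Q : S2) : C := hx P * hy Q - hy P * hx Q.

Lemma cross_eq0 P Q : cross P Q = 0 -> P = Q.
Proof.
case: P Q => [z|] [w|] //; rewrite /cross /=.
- by rewrite mulr1 mul1r => /subr0_eq ->.
- by rewrite mulr0 mulr1 sub0r => /eqP; rewrite oppr_eq0 oner_eq0.
- by rewrite mulr1 mul0r subr0 => /eqP; rewrite oner_eq0.
Qed.

Lemma crossxx P : cross P P = 0. Proof. by rewrite /cross; ring. Qed.

(** The quotient is a Moebius map with zero [b] and pole [a]; injectivity is the Pluecker relation
    between the four points. *)
Lemma cross_ratio_inj a b P Q : a <> b -> P <> a -> Q <> a ->
  cross P b / cross P a = cross Q b / cross Q a -> P = Q.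
Proof.
move=> ab Pa Qa e; apply: cross_eq0.
have n1 : cross P a != 0 by apply/eqP => /cross_eq0.
have n2 : cross Q a != 0 by apply/eqP => /cross_eq0.
have n3 : cross a b != 0 by apply/eqP => /cross_eq0.
have : cross P Q * cross a b = 0.
  have : cross Q b * cross P a - cross P b * cross Q a = 0.
    by move/eqP: e; rewrite eqr_div// => /eqP ->; rewrite subrr.
  by rewrite /cross => <-; ring.
by move/eqP; rewrite mulf_eq0 (negbTE n3) orbF => /eqP.
Qed.

(** In either chart, [cross (P w) Q] is affine in the coordinate of [P w] up to a non-zero factor
    that does not depend on [Q] and cancels in the quotient. *)
Lemma cross_ratio_holo (P : C -> S2) z (d : chart R 1 (CP1 R)) a b :
  atlas (CP1 R) d -> chart_dom d (P z) -> {for z, continuous P} ->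
  holo (fun w => chart_map d (P w) 0 0) z -> P z <> a ->
  holo (fun w => cross (P w) b / cross (P w) a) z.
Proof.
move=> dC dz Pc h Pa.
have n1 : cross (P z) a != 0 by apply/eqP => /cross_eq0.
set k := fun w => chart_map d (P w) 0 0 in h.
have near : \forall w \near z, chart_dom d (P w).
  apply: Pc; have [isc _ _] := CP1_good R.
  exact: (near_chart_dom (isc d dC) dz).
have /nbhs_md[r r0 hr] := near.
case: dC => dE; rewrite {}dE /= in dz k h hr.
- apply: (@holo_near _ (fun w => (k w * hy b - hx b) / (k w * hy a - hx a)) _ _ _ r0).
    by move=> w /hr[x _ xw]; rewrite /k -xw /cross /= mxE; congr (_ / _); ring.
  have kz : k z * hy a - hx a = cross (P z) a.
    by rewrite /k; case: dz => x _ <-; rewrite /cross /= mxE; ring.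
  apply: holoM; first by apply: holoB (holo_cst _ _); apply: holoM h (holo_cst _ _).
  apply: holoV; first by rewrite kz.
  by apply: holoB (holo_cst _ _); apply: holoM h (holo_cst _ _).
have hyp w : P w != Some 0 ->
    exists2 l, l != 0 & forall Q, hy Q - k w * hx Q = l * cross (P w) Q.
  rewrite /k /=; case: (P w) => [x|] /=; rewrite mxE.
    rewrite some_eq => x0; exists x^-1; first by rewrite invr_eq0.
    by move=> Q; rewrite /cross /=; field.
  by move=> _; exists 1; [exact: oner_neq0|move=> Q; rewrite /cross /=; ring].
have scale w : P w != Some 0 -> (hy b - k w * hx b) / (hy a - k w * hx a) = cross (P w) b / cross (P w) a.
  by move=> /hyp[l l0 lE]; rewrite !lE invfM mulrACA mulfV ?mul1r.
apply: (@holo_near _ (fun w => (hy b - k w * hx b) / (hy a - k w * hx a)) _ _ _ r0).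
  by move=> w /hr; exact: scale.
have [l l0 lE] := hyp z dz.
apply: holoM; first by apply: holoB (holo_cst _ _) _; apply: holoM h (holo_cst _ _).
apply: holoV; first by rewrite lE mulf_neq0.
by apply: holoB (holo_cst _ _) _; apply: holoM h (holo_cst _ _).
Qed.

End Moebius.

(** * The curve over a line, its coordinate, and its embeddings *)

Section Lines.
Variables (R : realType) (n : nat) (X : chartedSpace R n).
Variable F : X -> Cspace R n.
Local Notation C := (Cplx R).
Local Notation V := 'rV[C]_n.
Local Notation idc := (Chart setT id id : chart R n (Cspace R n)).
Variables (q : V) (sec : X -> Cspace R n -> X).
Hypothesis secP : forall x, local_inverse_at F x (sec x).

Definition pt (v : V) (z : C) : Cspace R n := q + z *: v.
Definition line (v : V) : set (Cspace R n) := [set q + t *: v | t in [set: C]].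
Definition over (v : V) : set X := F @^-1` line v.

(** The interior makes this set open, so the properties hold on whole discs of the line. *)
Definition sec_dom x : set (Cspace R n) := interior [set w | [/\ F (sec x w) = w,
  {for w, continuous (sec x)} & forall c, maximal_atlas X c -> chart_dom c (sec x w) ->
     reads (sec x) w idc c]].

Lemma near_sec_dom x : nbhs (F x) (sec_dom x).
Proof.
apply/nbhs_interior; have [_ h1 _ h2 h3] := secP x.
by apply: filterS (filterI (filterI h1 h2) h3) => w [[]].
Qed.

Lemma sec_dom_near x w : sec_dom x w -> nbhs w (sec_dom x).
Proof. exact: nbhs_interior. Qed.

Lemma sec_domP x w : sec_dom x w -> [/\ F (sec x w) = w,
  {for w, continuous (sec x)} & forall c, maximal_atlas X c -> chart_dom c (sec x w) ->
     reads (sec x) w idc c].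
Proof. exact: nbhs_singleton. Qed.

(** [sec y] undoes [F] near [y], and [sec x w'] stays near [y]. *)
Lemma sec_agree x y w : sec_dom x w -> y = sec x w -> \forall w' \near w, sec y w' = sec x w'.
Proof.
move=> dw ->; have [Fw cw _] := sec_domP dw.
have [_ _ h _ _] := secP (sec x w).
apply: filterS (filterI (sec_dom_near dw) (cw _ h)) => w' [dw' /= <-].
by have [-> _ _] := sec_domP dw'.
Qed.

(** Joint continuity in [v] and [z]: one radius serves all directions near [v0], as the limits over
    varying directions require. *)
Lemma pt_cvg v0 z0 (A : set (Cspace R n)) : nbhs (pt v0 z0) A ->
  exists2 r : R, 0 < r & \forall v \near v0, forall z, md (z - z0) < r -> A (pt v z).
Proof.
move=> hA.
have cvgf : (q + u.1 *: u.2) @[u --> ((z0, v0) : C * V)] --> q + z0 *: v0.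
  apply: cvgD; first exact: cvg_cst.
  exact: (@scale_continuous C V (z0, v0)).
have [[A1 A2] /= [h1 h2] h] := cvgf _ hA.
have /nbhs_md[r r0 hr] := h1; exists r => //; apply: filterS h2 => v Av z /hr Az.
exact: (h (z, v)).
Qed.

Lemma pt_cvg1 v z0 (A : set (Cspace R n)) : nbhs (pt v z0) A ->
  exists2 r : R, 0 < r & forall z, md (z - z0) < r -> A (pt v z).
Proof. by move=> /pt_cvg[r r0 /nbhs_singleton h]; exists r. Qed.

Lemma over_pt v z x : F x = pt v z -> over v x.
Proof. by move=> Fx; exists z. Qed.

Lemma overP v x : over v x -> exists z, F x = pt v z.
Proof. by case=> z _ <-; exists z. Qed.

Lemma pt_inj v z w : v != 0 -> pt v z = pt v w -> z = w.
Proof.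
move=> v0 /addrI /eqP; rewrite -subr_eq0 -scalerBl scaler_eq0 (negbTE v0) orbF subr_eq0.
by move/eqP.
Qed.

Lemma pt_differentiable v z : differentiable (pt v : C -> V) z.
Proof.
apply: differentiableD; first exact: differentiable_cst.
by apply: differentiableZl; exact: ex_diff.
Qed.

Lemma sec_pt_continuous x v z : sec_dom x (pt v z) -> {for z, continuous (fun z => sec x (pt v z))}.
Proof.
move=> dz; apply: (@continuous_comp _ _ _ (pt v : C -> V) (sec x)).
  exact/differentiable_continuous/pt_differentiable.
by have [] := sec_domP dz.
Qed.

(** The parameter [z] of the line is a holomorphic coordinate on the curve: the chart [e] is a
    truncated slice chart [c], and [c] is differentiable along the section. The default value of
    [insubd] is met only away from [z]. *)
Lemma read_along v (N : chartedSpace R 1) (gN : good_atlas N) (G : induced_space 1 (over v) -> N)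
    (x : induced_space 1 (over v)) z e d :
  continuous G -> atlas (induced_space 1 (over v)) e -> maximal_atlas N d ->
  chart_dom e x -> chart_dom d (G x) ->
  differentiable (chart_map d \o G \o chart_inv e) (chart_map e x) ->
  F (set_val x) = pt v z ->
  let P z := G (insubd x (sec (set_val x) (pt v z))) in
  [/\ P z = G x, {for z, continuous P} &
   forall d', maximal_atlas N d' -> chart_dom d' (G x) ->
     holo (fun z => chart_map d' (P z) 0 0) z].
Proof.
move=> Gc /induced_atlasP[c ec] dN ex dx r Fx P.
have [ce cX _ _ cE] := ec; have [cc _] := cX.
set y := set_val x in Fx P *.
have [secy _ _ _ _] := secP y.
have dz : sec_dom y (pt v z) by rewrite -Fx; exact: nbhs_singleton (near_sec_dom y).
have secz : sec y (pt v z) = y by rewrite -Fx.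
have Pz : P z = G x by rewrite /P secz insubd_set_val.
pose I w := insubd x (sec y (pt v w)).
have Iz : I z = x by rewrite /I secz insubd_set_val.
have [r0 r00 hr0] := pt_cvg1 (sec_dom_near dz).
have inover w : md (w - z) < r0 -> over v (sec y (pt v w)).
  by move=> /hr0 /sec_domP[h _ _]; apply: over_pt h.
have Ic : {for z, continuous (I : C -> set_type (over v))}.
  move=> A; rewrite /I secz insubd_set_val => /(near_insubd x) hA.
  have := sec_pt_continuous dz; rewrite /= => /(_ _); rewrite /continuous_at secz => /(_ _ hA) h.
  have nr : \forall w \near z, md (w - z) < r0 by apply/nbhs_md; exists r0.
  by apply: filterS (filterI nr h) => w [/inover h1 h2]; exact: h2.
have Pc : {for z, continuous P}.
  apply: (@continuous_comp _ _ _ (I : C -> set_type (over v)) G); first exact: Ic.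
  exact: Gc.
split => // d' dN' dx'.
have cy : chart_dom c y by exact: (proj1 (restricts_dom ec x) ex).
have [_ _ /(_ c cX)] := sec_domP dz; rewrite secz => /(_ cy) rs.
have [dc _] := dN.
have t : differentiable (chart_map d' \o chart_inv d) (chart_map d (G x)).
  exact: (maximal_transition gN dN dN' (ex_intro2 _ _ (G x) (conj dx dx') erefl)).
apply/differentiable_holo.
pose L (u : V) : 'rV[C]_1 := u *m pid_mx 1.
have Ldiff u : differentiable L u by exact: differentiable_mulmx.
pose k1 : C -> V := chart_map c \o sec y \o id \o pt v.
have dk1 : differentiable k1 z.
  by apply: (differentiable_comp_at (pt_differentiable v z) erefl rs).
have k1z : k1 z = chart_map c y by rewrite /k1 /= secz.
pose k2 := L \o k1.
have dk2 : differentiable k2 z by exact: (differentiable_comp_at dk1 erefl (Ldiff _)).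
have k2z : k2 z = chart_map e x by rewrite /k2 /= k1z cE.
pose k3 := (chart_map d \o G \o chart_inv e) \o k2.
have dk3 : differentiable k3 z by exact: (differentiable_comp_at dk2 k2z r).
have k3z : k3 z = chart_map d (G x) by rewrite /k3 /= k2z chart_mapK.
pose k4 := (chart_map d' \o chart_inv d) \o k3.
have dk4 : differentiable k4 z by exact: (differentiable_comp_at dk3 k3z t).
have dk5 : differentiable ((fun w : 'rV[C]_1 => w 0 0) \o k4) z.
  by apply: (differentiable_comp_at dk4 erefl); exact: differentiable_coord.
apply: near_differentiable dk5; near=> w.
have nw : md (w - z) < r0 by near: w; apply/nbhs_md; exists r0.
have dPw : chart_dom d (P w) by near: w; apply: Pc; rewrite Pz; exact: (near_chart_dom dc dx).
have eIw : chart_dom e (I w) by near: w; apply: Ic; rewrite Iz; exact: (near_chart_dom ce ex).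
have Iw : set_val (I w) = sec y (pt v w) by rewrite set_val_insubd //; exact: inover.
have k2w : k2 w = chart_map e (I w) by rewrite cE// Iw.
by rewrite /k4 /k3 /= k2w (chart_mapK ce eIw) (chart_mapK dc dPw).
Unshelve. all: by end_near. Qed.

Section TwoPoints.
Variables (p1 p2 : X) (Fp1 : F p1 = q) (Fp2 : F p2 = q) (p12 : p1 <> p2).

(* [g] is an embedding of [over v] into the sphere with its pole at [p1]
   (where the value of [g] is set to the junk value 0) and its zero at [p2]. *)
Definition embedding (v : V) (g : X -> C) : Prop :=
  [/\ forall x y, over v x -> over v y -> x <> p1 -> y <> p1 -> g x = g y -> x = y,
      g p1 = 0, g p2 = 0,
      forall x z, F x = pt v z -> x <> p1 -> holo (fun w => g (sec x (pt v w))) z &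
      holo (fun w => (g (sec p1 (pt v w)))^-1) 0].

Lemma pt0 v : pt v 0 = q. Proof. by rewrite /pt scale0r addr0. Qed.

(** Follow the biholomorphism with [D] by the Moebius map that sends the image [a] of [p1] to
    infinity and the image [b] of [p2] to 0. Division by 0 supplies the junk value at [p1]. *)
Lemma embedding_exists v (D : set (CP1 R)) :
  biholomorphic (induced_space 1 (over v)) (induced_space 1 D) ->
  exists g, embedding v g.
Proof.
move=> [phi [[phic phih] [psi [phiK psiK _]]]].
have Ov1 : over v p1 by apply: (@over_pt v 0); rewrite pt0.
have Ov2 : over v p2 by apply: (@over_pt v 0); rewrite pt0.
pose x1 : induced_space 1 (over v) := exist _ p1 (mem_set Ov1).
pose x2 : induced_space 1 (over v) := exist _ p2 (mem_set Ov2).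
pose G (y : induced_space 1 (over v)) : CP1 R := set_val (phi y).
have Gc : continuous G.
  move=> y; apply: (@continuous_comp _ _ _ phi (set_val : set_type D -> CP1 R)); first exact: phic.
  exact: set_val_continuous.
have Ginj y y' : G y = G y' -> y = y'.
  by rewrite /G => /val_inj h; rewrite -(phiK y) h phiK.
pose a := G x1; pose b := G x2.
have ab : a <> b by move=> /Ginj /(congr1 set_val) h; exact: p12.
pose ins x := insubd x1 x : induced_space 1 (over v).
pose g x := cross (G (ins x)) b / cross (G (ins x)) a.
have insE x : over v x -> set_val (ins x) = x by exact: set_val_insubd.
have ins1 : ins p1 = x1 by apply: val_inj; rewrite -!set_valE insE.
have ins2 : ins p2 = x2 by apply: val_inj; rewrite -!set_valE insE.
have Ga x : over v x -> x <> p1 -> G (ins x) <> a.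
  by move=> ox xp; rewrite /a => /Ginj e; apply: xp; rewrite -(insE x ox) e.
have read (y : induced_space 1 (over v)) z : F (set_val y) = pt v z ->
    let P z := G (insubd y (sec (set_val y) (pt v z))) in
    [/\ P z = G y, {for z, continuous P} & exists d, [/\ atlas (CP1 R) d, chart_dom d (G y) &
       holo (fun z => chart_map d (P z) 0 0) z]].
  move=> Fy P; have [e [d [eA ey /induced_atlasP[c dc] dy r]]] := phih y.
  have [cd cM _ _ cE] := dc.
  have cy : chart_dom c (G y) := proj1 (restricts_dom dc _) dy.
  have ce : is_chart e by move/induced_atlasP: eA => [? []].
  have r' : differentiable (chart_map c \o G \o chart_inv e) (chart_map e y).
    apply: near_differentiable r; near=> w.
    have : chart_dom d (phi (chart_inv e w)).
      near: w; apply: (near_chart_inv ce (A := phi @^-1` chart_dom d)) => //.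
      by apply: phic; exact: (near_chart_dom cd dy).
    by move=> dw; rewrite /= cE// mul_pid_self.
  have [h1 h2 h3] := read_along (CP1_good R) Gc eA cM ey cy r' Fy.
  split => //; have [_ cov _] := CP1_good R; have [d' dA dG] := cov (G y).
  by exists d'; split => //; apply: h3 => //; exact: (atlas_maximal (CP1_good R)).
have insub_ins y x : over v x -> insubd y x = ins x.
  by move=> ox; apply: val_inj; rewrite -!set_valE insE // set_val_insubd.
have near_over x z : F x = pt v z -> exists2 r : R, 0 < r & forall w, md (w - z) < r -> over v (sec x (pt v w)).
  move=> Fx; have := near_sec_dom x; rewrite Fx => /pt_cvg1[r r0 hr].
  exists r => // w /hr /sec_domP[h _ _]; exact: over_pt h.
exists g; split.
- move=> x y ox oy xp yp /(cross_ratio_inj ab (Ga x ox xp) (Ga y oy yp)) /Ginj h.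
  by rewrite -(insE x ox) h insE.
- by rewrite /g ins1 crossxx invr0 mulr0.
- by rewrite /g ins2 crossxx mul0r.
- move=> x z Fx xp; have ox := over_pt Fx.
  have [r r0 hr] := near_over x z Fx.
  have := read (ins x) z; rewrite insE// => /(_ Fx)[Pz Pc [d [dA dG h]]].
  apply: (@holo_near _ (fun w => cross (G (insubd (ins x) (sec x (pt v w)))) b /
     cross (G (insubd (ins x) (sec x (pt v w)))) a) _ _ _ r0).
    by move=> w /hr ow; rewrite /g insub_ins.
  apply: (cross_ratio_holo (P := fun w => G (insubd (ins x) (sec x (pt v w)))) b dA) => //.
    by rewrite Pz.
  by rewrite Pz; exact: Ga.
- have Fx : F p1 = pt v 0 by rewrite pt0.
  have [r r0 hr] := near_over p1 0 Fx.
  have := read x1 0 Fx => -[Pz Pc [d [dA dG h]]].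
  apply: (@holo_near _ (fun w => cross (G (insubd x1 (sec p1 (pt v w)))) a /
     cross (G (insubd x1 (sec p1 (pt v w)))) b) _ _ _ r0).
    by move=> w /hr ow; rewrite /g invf_div.
  apply: (cross_ratio_holo (P := fun w => G (insubd x1 (sec p1 (pt v w)))) a dA) => //.
    by rewrite Pz.
  by rewrite Pz.
Unshelve. all: by end_near. Qed.

End TwoPoints.
End Lines.

(** * Automorphisms of the sphere that fix 0 and infinity *)

Section SphereAutomorphisms.
Variable R : realType.
Local Notation C := (Cplx R).
Local Notation aff := (CP1_affine_chart R).
Local Notation inf := (CP1_infty_chart R).

Lemma aff_atlas : atlas (CP1 R) aff. Proof. by left. Qed.
Lemma inf_atlas : atlas (CP1 R) inf. Proof. by right. Qed.

Lemma sphere_reads_holo (M : CP1 R -> CP1 R) (c d : chart R 1 (CP1 R)) z :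
  holomorphic M -> atlas (CP1 R) c -> atlas (CP1 R) d ->
  chart_dom c (chart_inv c (const_mx z)) -> chart_map c (chart_inv c (const_mx z)) = const_mx z ->
  chart_dom d (M (chart_inv c (const_mx z))) ->
  holo (fun w => chart_map d (M (chart_inv c (const_mx w))) 0 0) z.
Proof.
move=> hM cA dA cz cE dz; have gS := CP1_good R.
have := holomorphic_reads gS gS hM (atlas_maximal gS cA) (atlas_maximal gS dA) cz dz.
rewrite /reads cE => r; apply/differentiable_holo.
have h : differentiable ((chart_map d \o M \o chart_inv c) \o (fun w : C => const_mx w)) z.
  exact: (differentiable_comp_at (const_mx_differentiable z) erefl r).
exact: (differentiable_comp_at (g := fun v : 'rV[C]_1 => v 0 0 : C) h erefl (differentiable_coord _ 0 0)).
Qed.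

(** In the chart at infinity [M] reads [(a w^-1)^-1], whose derivative at 0 is non-zero by
    injectivity; so [linear_of_proper_entire] applies to [a]. *)
Lemma sphere_aut_linear (M : CP1 R -> CP1 R) : holomorphic M -> injective M ->
  M None = None -> M (Some 0) = Some 0 ->
  exists2 c : C, c != 0 & forall z, M (Some z) = Some (c * z).
Proof.
move=> hM Minj MN M0.
pose a z : C := odflt 0 (M (Some z)).
have Ma z : M (Some z) = Some (a z).
  by rewrite /a; case E : (M (Some z)) => [w|] //; have := Minj _ _ (etrans E (esym MN)).
have ainj z w : a z = a w -> z = w.
  move=> e; have : M (Some z) = M (Some w) by rewrite !Ma e.
  by move=> /Minj [].
have a0 : a 0 = 0 by move: (Ma 0); rewrite M0 => -[].
have an0 z : z != 0 -> a z != 0.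
  by move=> z0; apply/eqP => az; move: z0; rewrite (ainj z 0) ?eqxx// az a0.
have ah z : holo a z.
  have := @sphere_reads_holo M aff aff z hM aff_atlas aff_atlas.
  move=> h; apply: holo_near ltr01 _ (h _ _ _).
  - by move=> w _ /=; rewrite !mxE.
  - by exists z => //=; rewrite mxE.
  - by apply/rowP => i; rewrite /= !mxE.
  - by rewrite /= mxE Ma; exists (a z).
have infE (w : C) : chart_inv inf (const_mx w) = sphere_inv w by rewrite /= mxE.
have Msi w : M (sphere_inv w) = sphere_inv ((a w^-1)^-1).
  rewrite /sphere_inv invr_eq0 invrK; case: (eqVneq w 0) => [->|w0].
    by rewrite invr0 a0 eqxx.
  by rewrite Ma (negbTE (an0 _ _)) // invr_eq0.
have bh w : holo (fun w => (a w^-1)^-1) w.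
  have := @sphere_reads_holo M inf inf w hM inf_atlas inf_atlas.
  move=> h; apply: holo_near ltr01 _ (h _ _ _).
  - by move=> x _; rewrite infE Msi sphere_invK mxE.
  - by rewrite infE; exact: sphere_inv_dom.
  - by rewrite infE sphere_invK.
  - by rewrite infE Msi; exact: sphere_inv_dom.
have [d hd0] := bh 0.
have d0 : d != 0.
  apply: (injective_hd_neq0 ltr01 _ _ hd0) => [w _|z w _ _]; first exact: bh.
  by move=> /invr_inj /ainj /invr_inj.
have lin := linear_of_proper_entire ah a0 an0 hd0 d0.
by exists (a 1); [apply: an0; exact: oner_neq0|move=> z; rewrite Ma lin].
Qed.

End SphereAutomorphisms.

(** * Rigidity and connectedness of the curves *)

Section Embeddings.
Variables (R : realType) (n : nat) (X : chartedSpace R n) (gX : good_atlas X)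
  (hX : hausdorff_space X).
Variables (F : X -> Cspace R n) (hF : local_biholomorphism F) (n0 : (0 < n)%N).
Local Notation C := (Cplx R).
Local Notation V := 'rV[C]_n.
Variables (q : V) (sec : X -> Cspace R n -> X).
Hypothesis secP : forall x, local_inverse_at F x (sec x).
Variables (p1 p2 : X) (Fp1 : F p1 = q) (Fp2 : F p2 = q) (p12 : p1 <> p2).
Local Notation pt := (pt q).
Local Notation over := (over F q).
Local Notation embedding := (embedding F q sec p1 p2).

Lemma separating_opens (x y : X) : x <> y ->
  exists A B : set X, [/\ open A, open B, A x, B y & forall u, A u -> ~ B u].
Proof.
move=> xy; have := hX; rewrite open_hausdorff.
move=> /(_ x y (introN eqP xy))[[A B] /= [Ax By] [oA oB /eqP AB]].
rewrite !inE in Ax By; exists A, B; split => // u Au Bu.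
by have : (A `&` B) u by []; rewrite AB.
Qed.

Lemma near_neq (x y : X) : x <> y -> \forall z \near x, z <> y.
Proof.
move=> /separating_opens[A [B [oA _ Ax By AB]]]; apply: filterS (open_nbhs_nbhs (conj oA Ax)).
by move=> z Az zy; apply: (AB z Az); rewrite zy.
Qed.

Lemma near_sec p u v0 (D : set X) : F p = pt v0 u -> open D -> D p ->
  exists2 s : R, 0 < s & \forall v \near v0, forall w, md (w - u) < s -> D (sec p (pt v w)).
Proof.
move=> Fp oD Dp; apply: (@pt_cvg _ _ _ v0 u [set w | D (sec p w)]).
have [sp _ _ cs _] := secP p; have cp := nbhs_singleton cs.
by rewrite -Fp; apply: cp; rewrite sp; exact: open_nbhs_nbhs.
Qed.

Lemma F_continuous : continuous F.
Proof.
move=> x; have [_ cov _] := gX; have [c cX cx] := cov x.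
by have [] := local_biholomorphism_reads gX hF (atlas_maximal gX cX) cx.
Qed.

Lemma line_coordinate v : v != 0 -> exists l : V -> C,
  (forall z, l (pt v z) = z) /\ forall u, differentiable l u.
Proof.
move=> v0; have [j vj] : exists j, v 0 j != 0 by apply/rV0Pn.
exists (fun u => (v 0 j)^-1 *: ((u 0 j : C) - q 0 j)); split=> [z|u].
  by rewrite !mxE [q 0 j + _]addrC addrK -[_ *: _]/(_ * _) mulrCA mulVf ?mulr1.
apply: differentiableZ; apply: differentiableB; first exact: differentiable_coord.
exact: differentiable_cst.
Qed.

(** The map to the sphere that an embedding [g] stands for, with infinity in place of the junk
    value. *)
Definition sphere_map v (g : X -> C) (y : induced_space 1 (over v)) : CP1 R :=
  if set_val y == p1 then None else Some (g (set_val y)).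

Lemma embedding_neq0 v g x : embedding v g -> over v x -> x <> p1 -> x <> p2 -> g x != 0.
Proof.
move=> [ginj _ g2 _ _] ox x1 x2; apply/eqP => gx; apply: x2.
apply: ginj => //; last by rewrite gx g2.
  by apply: (@over_pt _ _ _ _ _ v 0); rewrite pt0.
by move=> e; apply: p12.
Qed.

Lemma sphere_map_inj v g : embedding v g -> injective (sphere_map (v := v) g).
Proof.
move=> [ginj _ _ _ _] x y; rewrite /sphere_map.
have ox := set_valP x; have oy := set_valP y.
case: eqP => [x1|x1]; case: eqP => [y1|y1] // e; apply: val_inj.
  by rewrite -!set_valE x1 y1.
by case: e => e; exact: ginj.
Qed.

Lemma sphere_map_holomorphic m (N : chartedSpace R m) v g (psi : N -> induced_space 1 (over v)) :
  v != 0 -> (forall c, atlas N c -> is_chart c) -> embedding v g -> holomorphic psi ->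
  holomorphic (sphere_map (v := v) g \o psi).
Proof.
move=> v0 gN eg [psic psih].
have [l [lpt ldiff]] := line_coordinate v0.
pose Z (x : N) : C := l (F (set_val (psi x))).
have valc : continuous (fun x => set_val (psi x) : X).
  move=> x; apply: (@continuous_comp _ _ _ psi (set_val : set_type (over v) -> X)); first exact: psic.
  exact: set_val_continuous.
have Zc : continuous Z.
  move=> x; apply: (@continuous_comp _ _ _ (fun x => F (set_val (psi x))) l).
    by apply: (@continuous_comp _ _ _ (fun x => set_val (psi x)) F); [exact: valc|exact: F_continuous].
  exact/differentiable_continuous/ldiff.
have FZ x : F (set_val (psi x)) = pt v (Z x).
  by have [z Fz] := overP (set_valP (psi x)); rewrite /Z Fz lpt.
have Zread x : exists2 b, atlas N b & chart_dom b x /\ differentiable (Z \o chart_inv b) (chart_map b x).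
  have [b [e [bN bx /induced_atlasP[c ec] ex r]]] := psih x.
  exists b; first exact: bN.
  split; first exact: bx.
  have bb := gN b bN.
  have [ce cX _ _ cE] := ec; have [cc _] := cX.
  have cy : chart_dom c (set_val (psi x)) := proj1 (restricts_dom ec _) ex.
  have [_ rF] := local_biholomorphism_reads gX hF cX cy.
  pose k1 := (fun w : 'rV[C]_1 => w *m pid_mx 1 : V) \o (chart_map e \o psi \o chart_inv b).
  have d1 : differentiable k1 (chart_map b x).
    exact: (differentiable_comp_at r erefl (differentiable_mulmx1 _ _)).
  have k1x : k1 (chart_map b x) = chart_map c (set_val (psi x)).
    by rewrite /k1 /= chart_mapK// -(restricts_map n0 ec).
  have d2 := differentiable_comp_at d1 k1x rF.
  have d3 := differentiable_comp_at d2 erefl (ldiff _).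
  apply: near_differentiable d3; near=> w.
  have ew : chart_dom e (psi (chart_inv b w)).
    near: w; apply: (near_chart_inv bb (A := psi @^-1` chart_dom e)) => //.
    by apply: psic; exact: (near_chart_dom ce ex).
  rewrite /= /k1 /= -(restricts_map n0 ec ew) chart_mapK//.
  exact: (proj1 (restricts_dom ec _) ew).
(* Locally the map is [K (h (Z x'))]: [Z] is the coordinate of the line, [h] is [g] or [1 / g] along
   a section, and [K] inverts the affine chart or the chart at infinity. *)
suff key x : exists (h : C -> C) (K : C -> CP1 R) (d : chart R 1 (CP1 R)), [/\ holo h (Z x),
    continuous K, atlas (CP1 R) d, (forall w, chart_dom d (K w) /\ chart_map d (K w) 0 0 = w) &
    \forall x' \near x, sphere_map g (psi x') = K (h (Z x'))].
  split=> [x|x].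
    have [h [K [d [[dh hh] Kc dA _ near]]]] := key x.
    have hc : {for Z x, continuous h}.
      by apply/differentiable_continuous/differentiable_holo; exists dh.
    have c2 : {for x, continuous (K \o (h \o Z))}.
      apply: (@continuous_comp _ _ _ (h \o Z) K); last exact: Kc.
      by apply: continuous_comp; [exact: Zc|exact: hc].
    move=> A; rewrite /= (nbhs_singleton near) => /c2 hA.
    by apply: filterS (filterI near hA) => x' [/= e1]; rewrite /preimage /= e1.
  have [h [K [d [hh Kc dA Kd near]]]] := key x.
  have [b bN [bx br]] := Zread x; have bb := gN b bN.
  exists b, d; split; [exact: bN|exact: bx|exact: dA| |].
    by rewrite /= (nbhs_singleton near); case: (Kd (h (Z x))).
  apply: differentiable_mx1.
  have Zb : (Z \o chart_inv b) (chart_map b x) = Z x by rewrite /= chart_mapK.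
  have := differentiable_comp_at br Zb (proj2 (differentiable_holo _ _) hh).
  apply: near_differentiable; near=> w.
  have e : sphere_map g (psi (chart_inv b w)) = K (h (Z (chart_inv b w))).
    by near: w; exact: (near_chart_inv bb bx near).
  by rewrite /= e; case: (Kd (h (Z (chart_inv b w)))).
have [ginj g1 g2 gh gp] := eg.
set y := set_val (psi x).
have [_ _ nsec _ _] := secP y.
have nsec' : \forall x' \near x, sec y (pt v (Z x')) = set_val (psi x').
  near=> x'; rewrite -FZ; near: x'; exact: (valc x _ nsec).
(* Near [p1] the map is read through [1 / g]. Staying away from [p2] keeps [g] non-zero off [p1],
   and at [p1] itself [0^-1 = 0] yields infinity. *)
have [y1|y1] := eqVneq y p1.
  have nz : \forall x' \near x, set_val (psi x') <> p2.
    have yp2 : y <> p2 by rewrite y1.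
    exact: (valc x _ (near_neq yp2)).
  exists (fun w => (g (sec p1 (pt v w)))^-1), (@sphere_inv R), (CP1_infty_chart R); split.
  - have -> : Z x = 0; last exact: gp.
    by apply: (pt_inj v0 (q := q)); rewrite -FZ -/y y1 Fp1 pt0.
  - exact: sphere_inv_continuous.
  - exact: inf_atlas.
  - by move=> w; split; [exact: sphere_inv_dom|rewrite sphere_invK mxE].
  - apply: filterS (filterI nz nsec') => x' [n2]; rewrite y1 => ->.
    rewrite /sphere_map /sphere_inv invr_eq0 invrK; case: eqP => [->|n1].
      by rewrite g1 eqxx.
    by rewrite (negbTE (embedding_neq0 eg (set_valP (psi x')) n1 n2)).
have nz : \forall x' \near x, set_val (psi x') <> p1.
  exact: (valc x _ (near_neq (elimN eqP y1))).
exists (fun w => g (sec y (pt v w))), (Some : C -> CP1 R), (CP1_affine_chart R); split.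
- by apply: gh; [exact: FZ|apply/eqP].
- exact: one_point_compactification_some_continuous.
- exact: aff_atlas.
- by move=> w; split; [exists w|rewrite /= mxE].
- apply: filterS (filterI nz nsec') => x' [n1 ->].
  by rewrite /sphere_map; case: eqP.
Unshelve. all: by end_near. Qed.

Lemma embedding_unique v (D : set (CP1 R)) g g' : v != 0 -> rigid_domain D ->
  biholomorphic (induced_space 1 (over v)) (induced_space 1 D) ->
  embedding v g -> embedding v g' ->
  exists2 c, c != 0 & forall x, over v x -> x <> p1 -> g' x = c * g x.
Proof.
move=> v0 [_ _ rig] [phi [_ [psi [phiK psiK psih]]]] eg eg'.
have gD c : atlas (induced_space 1 D) c -> is_chart c by move=> /induced_atlasP[? []].
have psi_inj : injective psi := can_inj psiK.
have [A1 [hA1 [B1 [A1K B1K hB1]]] A1E] := rig _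
  (inj_comp (sphere_map_inj eg) psi_inj) (sphere_map_holomorphic v0 gD eg psih).
have [A2 [hA2 [B2 [A2K B2K hB2]]] A2E] := rig _
  (inj_comp (sphere_map_inj eg') psi_inj) (sphere_map_holomorphic v0 gD eg' psih).
have gS := CP1_good R.
have hM : holomorphic (A2 \o B1).
  by apply: holomorphic_comp hB1 hA2 => //; case: gS.
have Minj : injective (A2 \o B1) by exact: inj_comp (can_inj A2K) (can_inj B1K).
have ME (y : induced_space 1 (over v)) : (A2 \o B1) (sphere_map g y) = sphere_map g' y.
  have := A1E (phi y); have := A2E (phi y); rewrite /= !phiK => -> ->.
  by rewrite A1K.
have Ov1 : over v p1 by apply: (@over_pt _ _ _ _ _ v 0); rewrite pt0.
have Ov2 : over v p2 by apply: (@over_pt _ _ _ _ _ v 0); rewrite pt0.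
have lift x : over v x -> exists y : induced_space 1 (over v), set_val y = x.
  by move=> ox; exists (exist _ x (mem_set ox)).
have [y1 y1E] := lift p1 Ov1; have [y2 y2E] := lift p2 Ov2.
have MN : (A2 \o B1) None = None.
  by have := ME y1; rewrite /sphere_map y1E eqxx.
have [_ _ g2 _ _] := eg; have [_ _ g2' _ _] := eg'.
have M0 : (A2 \o B1) (Some 0) = Some 0.
  have := ME y2; rewrite /sphere_map y2E g2 g2'; case: eqP => // e.
  by case: p12.
have [c c0 cM] := sphere_aut_linear hM Minj MN M0.
exists c => // x ox x1; have [y yE] := lift x ox.
have := ME y; rewrite /sphere_map yE; case: eqP => // _.
by rewrite cM => -[].
Qed.

(** The curve inherits connectedness from [D]. A relatively clopen part is described by
    neighbourhoods in [X], which is how the sections provide it. *)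
Lemma over_connected v (D : set (CP1 R)) (Z : set X) : connected D ->
  biholomorphic (induced_space 1 (over v)) (induced_space 1 D) ->
  (exists2 x, over v x & Z x) ->
  (forall x, over v x -> Z x -> \forall y \near x, over v y -> Z y) ->
  (forall x, over v x -> ~ Z x -> \forall y \near x, over v y -> ~ Z y) ->
  forall x, over v x -> Z x.
Proof.
move=> cD [phi [_ [psi [phiK psiK [psic _]]]]] [x0 ox0 Zx0] Zo Zc x ox.
have opn (Y : set X) : (forall x, over v x -> Y x -> \forall y \near x, over v y -> Y y) ->
    open ([set d : induced_space 1 D | Y (set_val (psi d))] : set (set_type D)).
  move=> hY; rewrite openE => d /= Yd; rewrite /interior.
  have h := hY _ (set_valP (psi d)) Yd.
  have : nbhs (psi d) [set y : set_type (over v) | Y (set_val y)].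
    apply/nbhs_set_type; exists [set y | over v y -> Y y] => // y; apply; exact: set_valP.
  exact: psic.
have [W1 oW1 E1] := opn _ Zo; have [W2 oW2 E2] := opn _ Zc.
pose lift z (oz : over v z) : induced_space 1 (over v) := exist _ z (mem_set oz).
pose d0 := phi (lift x0 ox0); pose d := phi (lift x ox).
have Z0 : Z (set_val (psi d0)) by rewrite /d0 phiK.
have : D `&` W1 = D.
  apply: cD.
  - exists (set_val d0); split; first exact: set_valP.
    by have : (set_val @^-1` W1) d0 by rewrite E1.
  - by exists W1.
  - exists (~` W2); first exact: open_closedC.
    apply/seteqP; split=> w [Dw Ow]; split => //.
      pose wd : set_type D := exist _ w (mem_set Dw).
      have : (set_val @^-1` W1) wd by [].
      rewrite E1 /= => Zw W2w.
      have : (set_val @^-1` W2) wd by [].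
      by rewrite E2 /= => /(_ Zw).
    pose wd : set_type D := exist _ w (mem_set Dw).
    have : ~ (set_val @^-1` W2) wd by [].
    rewrite E2 /= => /contrapT Zw.
    by have : (set_val @^-1` W1) wd by rewrite E1.
move=> DW; have : (D `&` W1) (set_val d) by rewrite DW; exact: set_valP.
move=> [_ W1d]; have : (set_val @^-1` W1) d by [].
by rewrite E1 /= /d phiK.
Qed.

End Embeddings.

(** * The invariant of two points in a fibre *)

Section Invariant.
Variables (R : realType) (n : nat) (X : chartedSpace R n) (gX : good_atlas X)
  (hX : hausdorff_space X).
Variables (F : X -> Cspace R n) (hF : local_biholomorphism F) (n0 : (0 < n)%N).
Local Notation C := (Cplx R).
Local Notation V := 'rV[C]_n.
Variables (q : V) (sec : X -> Cspace R n -> X).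
Hypothesis secP : forall x, local_inverse_at F x (sec x).
Variables (p1 p2 : X) (Fp1 : F p1 = q) (Fp2 : F p2 = q) (p12 : p1 <> p2).
Local Notation pt := (pt q).
Local Notation over := (over F q).
Local Notation embedding := (embedding F q sec p1 p2).
Local Notation sec_dom := (sec_dom F sec).

Lemma over_pole v : over v p1.
Proof. by apply: (@over_pt _ _ _ _ _ v 0); rewrite pt0. Qed.

Lemma F_sec x w : sec_dom x w -> F (sec x w) = w.
Proof. by move=> /sec_domP[]. Qed.

Lemma embedding_holo v g x w : embedding v g -> sec_dom x (pt v w) ->
  sec x (pt v w) <> p1 -> holo (fun w => g (sec x (pt v w))) w.
Proof.
move=> [_ _ _ gh _] dw y1; have Fy := F_sec dw.
have := gh _ _ Fy y1.
have /(sec_agree secP dw)/pt_cvg1[r r0 hr] : sec x (pt v w) = sec x (pt v w) by [].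
by apply: holo_near r0 _ => w' /hr ->.
Qed.

Lemma sec_neq v x w p : v != 0 -> F p = q -> sec_dom x (pt v w) -> w != 0 -> sec x (pt v w) <> p.
Proof.
move=> v0 Fp dw /eqP w0 e; apply: w0; apply: (pt_inj v0 (q := q)).
by rewrite -(F_sec dw) e Fp pt0.
Qed.

Lemma sec_base x : F x = q -> forall v, sec x (pt v 0) = x.
Proof. by move=> Fx v; rewrite pt0 -Fx; case: (secP x). Qed.

Section Pole.
Variables (v : V) (g : X -> C).
Hypotheses (v0 : v != 0) (eg : embedding v g).

Section PoleDisc.
Variable r : R.
Hypothesis rd : forall w, md w < r -> sec_dom p1 (pt v w).
Let f w := (g (sec p1 (pt v w)))^-1.

(** The junk value [g p1 = 0] and [0^-1 = 0] give [1 / g] its correct value at the pole. *)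
Lemma pole_zero : f 0 = 0.
Proof. by have [_ g1 _ _ _] := eg; rewrite /f sec_base// g1 invr0. Qed.

Lemma pole_neq0 w : md w < r -> w != 0 -> g (sec p1 (pt v w)) != 0.
Proof.
move=> wr w0; have dw := rd wr.
apply: (embedding_neq0 Fp2 p12 eg).
- exact: over_pt (F_sec dw).
- exact: sec_neq dw w0.
- exact: sec_neq dw w0.
Qed.

Lemma pole_holo w : md w < r -> holo f w.
Proof.
have [->|w0] := eqVneq w 0; first by have [_ _ _ _ h] := eg.
move=> wr; apply: holoV; first exact: pole_neq0.
by apply: embedding_holo => //; [exact: rd|apply: sec_neq => //; exact: rd].
Qed.

Lemma pole_inj z w : md z < r -> md w < r -> f z = f w -> z = w.
Proof.
move=> zr wr; have fn0 u : md u < r -> u != 0 -> f u != 0.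
  by move=> ur u0; rewrite invr_eq0; exact: pole_neq0.
have [->|z0] := eqVneq z 0; have [->|w0] := eqVneq w 0 => //.
- by rewrite pole_zero => /esym/eqP; rewrite (negbTE (fn0 _ wr w0)).
- by rewrite pole_zero => /eqP; rewrite (negbTE (fn0 _ zr z0)).
have [ginj _ _ _ _] := eg; have dz := rd zr; have dw := rd wr.
move=> /invr_inj /ginj e; apply: (pt_inj v0 (q := q)).
rewrite -(F_sec dz) -(F_sec dw) e //.
- exact: over_pt (F_sec dz).
- exact: over_pt (F_sec dw).
- exact: sec_neq dz z0.
- exact: sec_neq dw w0.
Qed.

End PoleDisc.

Lemma pole_hd_neq0 d : hd (fun w => (g (sec p1 (pt v w)))^-1) 0 d -> d != 0.
Proof.
have := near_sec_dom secP p1; rewrite Fp1 -{1}(pt0 q v) => /pt_cvg1[s s0 hs].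
have hs' w : md w < s -> sec_dom p1 (pt v w) by have := hs w; rewrite subr0.
move=> h; apply: (injective_hd_neq0 s0 _ _ h) => [w|z w]; rewrite !subr0.
  exact: pole_holo.
exact: pole_inj.
Qed.

Lemma zero_hd_neq0 d : hd (fun w => g (sec p2 (pt v w))) 0 d -> d != 0.
Proof.
have := near_sec_dom secP p2; rewrite Fp2 -{1}(pt0 q v) => /pt_cvg1[s s0 hs].
have hs' w : md w < s -> sec_dom p2 (pt v w) by have := hs w; rewrite subr0.
have n1 w : md w < s -> sec p2 (pt v w) <> p1.
  have [->|w0] := eqVneq w 0; first by rewrite sec_base// => _ e; exact: p12.
  by move=> /hs' dw; exact: sec_neq dw w0.
move=> h; apply: (injective_hd_neq0 s0 _ _ h) => [w|z w]; rewrite !subr0.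
  by move=> ws; apply: embedding_holo => //; [exact: hs'|exact: n1].
move=> zs ws; have [ginj _ _ _ _] := eg; have dz := hs' _ zs; have dw := hs' _ ws.
move=> /ginj e; apply: (pt_inj v0 (q := q)).
rewrite -(F_sec dz) -(F_sec dw) e //; try exact: n1.
- exact: over_pt (F_sec dz).
- exact: over_pt (F_sec dw).
Qed.

End Pole.

Lemma embedding_scale v g c : c != 0 -> embedding v g -> embedding v (fun x => c * g x).
Proof.
move=> c0 [ginj g1 g2 gh gp]; split.
- by move=> x y ox oy x1 y1 /(mulfI c0); exact: ginj.
- by rewrite g1 mulr0.
- by rewrite g2 mulr0.
- by move=> x z Fx x1; apply: holoM (holo_cst _ _) (gh _ _ Fx x1).
apply: holo_near ltr01 _ (holoM (holo_cst c^-1 _) gp) => w _.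
by rewrite invfM.
Qed.

(* [(1/g)'(p1) * g'(p2)], which does not change when [g] is rescaled. *)
Definition residue v (b : C) := exists g al be, [/\ embedding v g,
  hd (fun w => (g (sec p1 (pt v w)))^-1) 0 al, hd (fun w => g (sec p2 (pt v w))) 0 be &
  b = al * be].

Lemma residue_exists v (D : set (CP1 R)) :
  biholomorphic (induced_space 1 (over v)) (induced_space 1 D) ->
  exists b, residue v b.
Proof.
move=> /(embedding_exists secP Fp1 Fp2 p12)[g eg].
have [_ _ _ gh [al hal]] := eg.
have [||be hbe] := gh p2 0; [by rewrite pt0|by move=> e; exact: p12|].
by exists (al * be), g, al, be.
Qed.

Lemma residue_neq0 v b : v != 0 -> residue v b -> b != 0.
Proof.
move=> v0 [g [al [be [eg h1 h2 ->]]]].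
by rewrite mulf_neq0//; [exact: pole_hd_neq0 h1|exact: zero_hd_neq0 h2].
Qed.

Lemma residue_unique v (D : set (CP1 R)) b b' : v != 0 -> rigid_domain D ->
  biholomorphic (induced_space 1 (over v)) (induced_space 1 D) ->
  residue v b -> residue v b' -> b = b'.
Proof.
move=> v0 rD vD [g [al [be [eg h1 h2 ->]]]] [g' [al' [be' [eg' h1' h2' ->]]]].
have [c c0 gg'] := embedding_unique gX hX hF n0 secP Fp1 Fp2 p12 v0 rD vD eg eg'.
have [_ g1 _ _ _] := eg; have [_ g1' _ _ _] := eg'.
have gE x : over v x -> g' x = c * g x.
  by move=> ox; have [->|/eqP x1] := eqVneq x p1; [rewrite g1 g1' mulr0|exact: gg'].
have near p : F p = q -> exists2 r : R, 0 < r & forall w, md (w - 0) < r ->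
    g' (sec p (pt v w)) = c * g (sec p (pt v w)).
  move=> Fp; have := near_sec_dom secP p; rewrite Fp -{1}(pt0 q v) => /pt_cvg1[s s0 hs].
  by exists s => // w /hs dw; apply: gE; exact: over_pt (F_sec dw).
have [r1 r10 hr1] := near p1 Fp1; have [r2 r20 hr2] := near p2 Fp2.
have e1 : al' = c^-1 * al.
  apply: hd_uniq h1' _; apply: hd_near r10 _ (hdZ c^-1 h1) => w /hr1 ->.
  by rewrite invfM.
have e2 : be' = c * be.
  by apply: hd_uniq h2' _; apply: hd_near r20 _ (hdZ c h2) => w /hr2 ->.
by rewrite e1 e2; field.
Qed.

(** The curve and [g] stay the same; only the coordinate is rescaled by [c], and each of the two
    derivatives gains a factor [c]. *)
Lemma residue_scale v c b : c != 0 -> residue v b -> residue (c *: v) (c ^+ 2 * b).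
Proof.
move=> c0 [g [al [be [[ginj g1 g2 gh gp] h1 h2 ->]]]].
have ptE w : pt (c *: v) w = pt v (w * c) by rewrite /pt scalerA.
have ovE x : over (c *: v) x <-> over v x.
  split=> [/overP[w Fx]|/overP[w Fx]]; first by apply: (@over_pt _ _ _ _ _ _ (w * c)); rewrite -ptE.
  by apply: (@over_pt _ _ _ _ _ _ (w / c)); rewrite ptE divfK.
have hmul z : hd (fun w : C => w * c) z c.
  pose proof (hdZ c (hd_id z)) as h; rewrite mulr1 in h.
  by apply: hd_near ltr01 _ h => w _; rewrite mulrC.
have chain f d : hd f 0 d -> hd (fun w => f (w * c)) 0 (d * c).
  by move=> hf; apply: (@hd_comp _ (fun w => w * c) f) => //; rewrite mul0r.
exists g, (al * c), (be * c); split.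
- split => //.
  + by move=> x y /ovE ox /ovE oy; exact: ginj.
  + move=> x z Fx x1; have := gh x (z * c); rewrite -ptE => /(_ Fx x1)[d hd0].
    exists (d * c); have := hd_comp (hmul z) hd0; apply: hd_near ltr01 _ => w _.
    by rewrite /= ptE.
  + have [d hd0] := gp; exists (d * c); have := chain _ _ hd0; apply: hd_near ltr01 _ => w _.
    by rewrite ptE.
- by have := chain _ _ h1; apply: hd_near ltr01 _ => w _; rewrite ptE.
- by have := chain _ _ h2; apply: hd_near ltr01 _ => w _; rewrite ptE.
- by ring.
Qed.

(** The data that pass to the limit: [g] is bounded by 9 outside the disc of radius [r / 4] about
    the pole, [P] is [w * g] inside, and [z0] is a point where [md P] has a known positive value, so
    that a limit of the [P] is not 0. *)
Definition normalised v (r : R) (g : X -> C) (al : C) (P : C -> C) (z0 : C) := [/\ embedding v g,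
  hd (fun w => (g (sec p1 (pt v w)))^-1) 0 al,
  forall y, over v y -> y <> p1 -> (forall w, md w <= r / 4 -> y <> sec p1 (pt v w)) -> md (g y) <= 9,
  [/\ P 0 = al^-1, forall w, md w < r -> w != 0 -> P w = w * g (sec p1 (pt v w)),
   forall w, md w < r -> P w != 0 &
   forall w, md w < r -> holo P w /\ md (P w) <= 72 * r] &
  md z0 = r / 4 /\ md (P z0) = r / 4].

Lemma normalised_exists v (D : set (CP1 R)) r : v != 0 -> 0 < r ->
  biholomorphic (induced_space 1 (over v)) (induced_space 1 D) ->
  (forall w, md w < r -> sec_dom p1 (pt v w)) ->
  exists g al P z0, normalised v r g al P z0.
Proof.
move=> v0 r0 vD rd; have [g eg] := embedding_exists secP Fp1 Fp2 p12 vD.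
have [f fE] : exists f, f = fun w => (g (sec p1 (pt v w)))^-1 by eexists.
have fh w : md w < r -> holo f w by rewrite fE; exact: (pole_holo v0 eg rd).
have r4 : 0 < r / 4 by lra.
have cmd t : md (circle 0 (r / 4) t : C) = r / 4.
  by rewrite -[circle _ _ _]subr0 md_circle// ltW.
have cr t : md (circle 0 (r / 4) t : C) < r by rewrite cmd; lra.
have [t0 ht0] : exists t0, forall t, md (f (circle 0 (r / 4) t0)) <= md (f (circle 0 (r / 4) t)).
  apply: circle_min; first exact: ltW.
  by move=> w wr; apply: fh; lra.
have cn0 t : circle 0 (r / 4) t != 0 :> C by rewrite -md_gt0 cmd.
(* Multiplying [g] by [m] makes 1 the minimum of [md (1 / g)] on the circle, attained at the point
   that becomes [z0]. *)
have [m mE] : exists m, m = md (f (circle 0 (r / 4) t0)) by eexists.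
have m0 : 0 < m.
  by rewrite mE md_gt0 fE invr_eq0; apply: (pole_neq0 v0 eg rd).
have mn : rc m != 0 :> C by rewrite rc_eq0 gt_eqF.
have [g' g'E] : exists g', g' = fun x => rc m * g x by eexists.
have eg' : embedding v g' by rewrite g'E; exact: embedding_scale.
have [f' f'E'] : exists f', f' = fun w => (g' (sec p1 (pt v w)))^-1 by eexists.
have f'E w : f' w = (rc m)^-1 * f w by rewrite f'E' g'E fE invfM.
have f'1 t : 1 <= md (f' (circle 0 (r / 4) t)).
  by rewrite f'E mdM mdV md_rc (ger0_norm (ltW m0)) mulrC ler_pdivlMr// mul1r mE.
have [_ _ _ _] := eg'; rewrite -f'E' => -[al hal].
have f'0 : f' 0 = 0 by rewrite f'E'; exact: (pole_zero eg').
have f'h w : md w < r -> holo f' w by rewrite f'E'; exact: (pole_holo v0 eg' rd).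
have f'i z w : md z < r -> md w < r -> f' z = f' w -> z = w.
  by rewrite f'E'; exact: (pole_inj v0 eg' rd).
have gE' w : g' (sec p1 (pt v w)) = (f' w)^-1 by rewrite f'E' invrK.
have [P [P0 Pw Pn Ph]] := pole_normal_form r0 f'h f'0 f'i f'1 hal.
exists g', al, P, (circle 0 (r / 4) t0); split; [exact: eg'|by rewrite -f'E'| | |].
- move=> y oy y1 yn; apply: (omitted_value_bound r0 f'h f'0 f'1) => z zr.
  have zr' : md z < r by lra.
  have [->|z0] := eqVneq z 0; first by rewrite f'0 mulr0 eq_sym oner_eq0.
  apply/eqP => h; have gz := pole_neq0 v0 eg' rd zr' z0.
  have gy : g' y = g' (sec p1 (pt v z)).
    have fz : f' z != 0 by rewrite -invr_eq0 -gE'.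
    by apply: (mulIf fz); rewrite h gE' mulVf.
  have [ginj _ _ _ _] := eg'; apply: (yn z zr).
  apply: (ginj _ _ oy (over_pt (F_sec (rd _ zr'))) y1 _ gy).
  exact: sec_neq (rd _ zr') z0.
- split; [exact: P0| |exact: Pn|exact: Ph].
  by move=> w wr w0; rewrite Pw// gE'.
split; first exact: cmd.
rewrite Pw// mdM cmd mdV f'E mdM mdV md_rc (ger0_norm (ltW m0)) -mE.
by rewrite mulVf ?gt_eqF// invr1 mulr1.
Qed.

End Invariant.

(** * Limits of normalised embeddings as the direction varies *)

Section Limit.
Variables (R : realType) (n : nat) (X : chartedSpace R n) (gX : good_atlas X)
  (hX : hausdorff_space X).
Variables (F : X -> Cspace R n) (hF : local_biholomorphism F).
Local Notation C := (Cplx R).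
Local Notation V := 'rV[C]_n.
Variables (q : V) (sec : X -> Cspace R n -> X).
Hypothesis secP : forall x, local_inverse_at F x (sec x).
Variables (p1 p2 : X) (Fp1 : F p1 = q) (Fp2 : F p2 = q) (p12 : p1 <> p2).
Local Notation pt := (pt q).
Local Notation over := (over F q).
Local Notation embedding := (embedding F q sec p1 p2).
Local Notation sec_dom := (sec_dom F sec).
Local Notation normalised := (normalised F q sec p1 p2).

Variables (I : Type) (U : set_system I).
Context {UU : UltraFilter U}.
Let PU : ProperFilter U := ultra_proper.
Local Existing Instance PU.

Variables (vv : I -> V) (v0 : V) (v0n : v0 != 0).
Hypothesis vv_lim : forall A, nbhs v0 A -> U [set i | A (vv i)].
Variables (r : R) (r0 : 0 < r).
Hypothesis rd : \forall v \near v0, forall w, md w < r -> sec_dom p1 (pt v w).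
Variables (g : I -> X -> C) (al : I -> C) (P : I -> C -> C) (z0 : I -> C).
Hypothesis gP : U [set i | vv i != 0 /\ normalised (vv i) r (g i) (al i) (P i) (z0 i)].

Let rdi : U [set i | forall w, md w < r -> sec_dom p1 (pt (vv i) w)].
Proof. exact: (vv_lim rd). Qed.

Let rd0 w : md w < r -> sec_dom p1 (pt v0 w).
Proof. exact: (nbhs_singleton rd). Qed.

(** A zero of [Q] would make it vanish identically by Hurwitz's theorem, whereas [md Q] is at least
    [r / 4] at the limit of the points [z0 i]. *)
Lemma pole_limit_ex : exists Q : C -> C, [/\ forall w, md w < r -> holo Q w,
  forall w, md w < r -> Q w != 0 & forall w, md w < r -> ulim U (P ^~ w) (Q w)].
Proof.
have M0 : 0 <= 72 * r by rewrite mulr_ge0// ltW.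
have Ph : U [set i | forall w, md (w - 0) < r -> holo (P i) w /\ md (P i w) <= 72 * r].
  by apply: filterS gP => i [_ [_ _ _ [_ _ _ h] _]] w; rewrite subr0; exact: h.
have [Q hQ] := holo_ulim_ex Ph.
have Qh w : md w < r -> holo Q w.
  by move=> wr; apply: (holo_ulim M0 Ph hQ); rewrite subr0.
have hQ' w : md w < r -> ulim U (P ^~ w) (Q w) by move=> wr; apply: hQ; rewrite subr0.
exists Q; split => // w wr; apply/eqP => Qw.
have [z hz] : exists z, ulim U z0 z.
  apply: (@ulim_ex R I U UU z0 (r / 4)).
  by apply: filterS gP => i [_ [_ _ _ _ [h _]]]; rewrite /= h.
have zr : md z < r.
  have : md z <= r / 4.
    by apply: ulim_le hz; apply: filterS gP => i [_ [_ _ _ _ [h _]]]; rewrite /= h.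
  by move: r0 => ?; lra.
have Qz : Q z = 0.
  apply: (hurwitz (UU := UU) M0 Ph hQ _ (z0 := w)) => //; rewrite ?subr0//.
  by apply: filterS gP => i [_ [_ _ _ [_ _ h _] _]] u; rewrite subr0; exact: h.
have hd : ulim U (fun i => P i (z0 i)) (Q z).
  by apply: (ulim_diag M0 Ph hQ) => //; rewrite subr0.
have : r / 4 <= md (Q z).
  by apply: ulim_ge hd; apply: filterS gP => i [_ [_ _ _ _ [_ h]]]; rewrite /= h.
by rewrite Qz md0; move: r0 => ?; lra.
Qed.

(** Either [x] is outside the small disc about the pole, or it is inside, where [g] is [P / w]. *)
Lemma normalised_bound i x w : vv i != 0 -> normalised (vv i) r (g i) (al i) (P i) (z0 i) ->
  (forall w, md w < r -> sec_dom p1 (pt (vv i) w)) ->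
  F x = pt (vv i) w -> x <> p1 ->
  md (g i x) <= 9 \/ [/\ md w <= r / 4, w != 0, x = sec p1 (pt (vv i) w) & md (g i x) <= 72 * r / md w].
Proof.
move=> vi [eg hal far [P0 Pw _ Pb] _] rdx Fx x1.
have [[u [ur xu]]|nu] := pselect (exists u, md u <= r / 4 /\ x = sec p1 (pt (vv i) u)); last first.
  left; apply: far => //; first exact: over_pt Fx.
  by move=> u ur xu; apply: nu; exists u.
have ur' : md u < r by move: r0 => ?; lra.
have uw : u = w.
  by apply: (pt_inj vi (q := q)); rewrite -Fx xu (F_sec (rdx _ ur')).
right; rewrite -uw; have u0 : u != 0.
  by apply/eqP => e; apply: x1; rewrite xu e (sec_base secP Fp1).
split => //; rewrite ler_pdivlMr ?md_gt0//.
by have [_] := Pb _ ur'; rewrite Pw// mdM mulrC -xu.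
Qed.

(** If [z] is not 0, then [md w > md z / 2] near [z], which turns [72 * r / md w] into
    [144 * r / md z]. *)
Lemma locally_bounded_away x z : F x = pt v0 z -> x <> p1 -> exists s : R, exists M : R, [/\ 0 < s, 0 <= M,
  \forall v \near v0, forall w, md (w - z) < s -> sec_dom x (pt v w),
  forall w, md (w - z) < s -> sec x (pt v0 w) <> p1 &
  U [set i | forall w, md (w - z) < s ->
    sec x (pt (vv i) w) <> p1 /\ md (g i (sec x (pt (vv i) w))) <= M]].
Proof.
move=> Fx x1.
have nd := near_sec_dom secP x; rewrite Fx in nd.
have [s1 s10 hs1] := pt_cvg nd.
have n1 := vv_lim hs1.
have [z00|zn0] := eqVneq z 0; last first.
  have mz : 0 < md z by rewrite md_gt0.
  exists (Num.min s1 (md z / 2)), (9 + 144 * r / md z).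
  have far w : md (w - z) < md z / 2 -> md z / 2 < md w.
    by move=> h; have := md_dist z w; rewrite mdB; lra.
  have farn w : md (w - z) < md z / 2 -> w != 0.
    by move=> /far h; rewrite -md_gt0; apply: lt_trans h; rewrite divr_gt0.
  have M1 : 0 <= 144 * r / md z.
    by apply: divr_ge0; [apply: mulr_ge0; [lra|exact: ltW]|exact: md_ge0].
  split.
  - by rewrite lt_min s10 divr_gt0.
  - by rewrite addr_ge0.
  - by apply: filterS hs1 => v hv w; rewrite lt_min => /andP[/hv].
  - move=> w; rewrite lt_min => /andP[ws /farn w0].
    exact: (sec_neq v0n Fp1 (nbhs_singleton hs1 _ ws) w0).
  apply: filterS (filterI (filterI n1 rdi) gP) => i [[/= dx dp] [vi ni]] w.
  rewrite lt_min => /andP[ws wz]; have dw := dx _ ws; have w0 := farn _ wz.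
  have y1 := sec_neq vi Fp1 dw w0; split => //.
  have [h|[_ _ _ h]] := normalised_bound vi ni dp (F_sec dw) y1.
    by apply: le_trans h _; rewrite lerDl.
  apply: le_trans h _.
  have : 72 * r / md w <= 144 * r / md z.
    rewrite ler_pdivrMr ?md_gt0// mulrAC ler_pdivlMr//.
    have := far _ wz => h.
    rewrite -!mulrA [144 * _](_ : _ = 72 * (r * (2 * md w))); last by ring.
    rewrite ler_pM2l// ler_pM2l//; lra.
  by lra.
(* Now [x] is another point over [q], such as [p2]. The Hausdorff property separates its section
   from that of [p1], so the alternative with the bound 9 holds. *)
have Fx' : F x = q by rewrite Fx z00 pt0.
have [A [B [Ao Bo Ax Bp disj]]] := separating_opens hX x1.
have [s2 s20 hs2] := near_sec secP (etrans Fx' (esym (pt0 q v0))) Ao Ax.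
have [s3 s30 hs3] := near_sec secP (etrans Fp1 (esym (pt0 q v0))) Bo Bp.
exists (Num.min s1 (Num.min s2 s3)), 9.
have notp v w : (forall w, md (w - 0) < s2 -> A (sec x (pt v w))) -> md (w - z) < s2 -> sec x (pt v w) <> p1.
  by rewrite z00 => h ws e; have := disj _ (h _ ws); rewrite e; apply.
split.
- by rewrite !lt_min s10 s20.
- by [].
- by apply: filterS hs1 => v hv w; rewrite lt_min => /andP[/hv].
- move=> w; rewrite !lt_min => /and3P[_ ws _].
  exact: notp (nbhs_singleton hs2) ws.
apply: filterS (filterI (filterI (filterI n1 (vv_lim hs2)) (vv_lim hs3)) (filterI rdi gP)).
move=> i [[[/= dx hA] hB] [dp [vi ni]]] w; rewrite !lt_min => /and3P[ws w2 w3].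
have y1 := notp _ _ hA w2; split => //.
have [//|[_ _ e _]] := normalised_bound vi ni dp (F_sec (dx _ ws)) y1.
have := disj _ (hA w _); rewrite -z00 => /(_ w2); rewrite e => nB.
by case: nB; apply: hB; rewrite -z00.
Qed.

(** A point [x] of the limit curve is followed to the curve of [vv i] by its own section; at [p1]
    and off the curve [gl] is 0. *)
Lemma limit_ex : exists gl : X -> C, gl p1 = 0 /\ forall x z, F x = pt v0 z -> x <> p1 ->
  ulim U (fun i => g i (sec x (pt (vv i) z))) (gl x).
Proof.
have h x : exists l, (x = p1 -> l = 0) /\ forall z, F x = pt v0 z -> x <> p1 ->
    ulim U (fun i => g i (sec x (pt (vv i) z))) l.
  have [x1|x1] := pselect (x = p1); first by exists 0; split.
  have [[z Fx]|nz] := pselect (exists z, F x = pt v0 z); last first.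
    by exists 0; split=> // z Fx; case: nz; exists z.
  have [s [M [s0 M0 _ _ hU]]] := locally_bounded_away Fx x1.
  have [|l hl] := @ulim_ex R I U UU (fun i => g i (sec x (pt (vv i) z))) M.
    by apply: filterS hU => i /(_ z); rewrite subrr md0 => /(_ s0)[].
  exists l; split=> // w Fw _; rewrite (_ : w = z) //.
  by apply: (pt_inj v0n (q := q)); rewrite -Fx -Fw.
have [gl hgl] := choice h; exists gl; split; first by have [+ _] := hgl p1; apply.
by move=> x z Fx x1; have [_] := hgl x; apply.
Qed.

Section LimitMap.
Variable gl : X -> C.
Hypotheses (gl1 : gl p1 = 0) (glP : forall x z, F x = pt v0 z -> x <> p1 ->
  ulim U (fun i => g i (sec x (pt (vv i) z))) (gl x)).

Lemma limit_along x w : sec_dom x (pt v0 w) -> sec x (pt v0 w) <> p1 ->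
  ulim U (fun i => g i (sec x (pt (vv i) w))) (gl (sec x (pt v0 w))).
Proof.
move=> dw y1; have Fy := F_sec dw.
have := glP Fy y1; apply: ulim_eq.
have /(sec_agree secP dw)/pt_cvg[s s0 hs] : sec x (pt v0 w) = sec x (pt v0 w) by [].
apply: filterS (vv_lim hs) => i /= /(_ w); rewrite subrr md0 => /(_ s0) ->.
by [].
Qed.

Lemma limit_chart x z : F x = pt v0 z -> x <> p1 -> exists s : R, exists M : R, [/\ 0 < s, 0 <= M,
  forall w, md (w - z) < s -> sec_dom x (pt v0 w) /\ sec x (pt v0 w) <> p1,
  U [set i | forall w, md (w - z) < s -> [/\ sec_dom x (pt (vv i) w), sec x (pt (vv i) w) <> p1,
    holo (fun w => g i (sec x (pt (vv i) w))) w & md (g i (sec x (pt (vv i) w))) <= M]] &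
  forall w, md (w - z) < s -> ulim U (fun i => g i (sec x (pt (vv i) w))) (gl (sec x (pt v0 w)))].
Proof.
move=> Fx x1; have [s [M [s0 M0 hd hn hU]]] := locally_bounded_away Fx x1.
have d0 := nbhs_singleton hd.
exists s, M; split => //.
- by move=> w ws; split; [exact: d0|exact: hn].
- apply: filterS (filterI (filterI hU (vv_lim hd)) gP) => i [[/= h1 h2] [vi [eg _ _ _ _]]] w ws.
  have [y1 yM] := h1 _ ws; split => //; first exact: h2.
  by apply: (embedding_holo secP eg) => //; exact: h2.
- by move=> w ws; apply: limit_along; [exact: d0|exact: hn].
Qed.

Lemma limit_holo x z : F x = pt v0 z -> x <> p1 -> exists2 s : R, 0 < s &
  forall w, md (w - z) < s -> holo (fun w => gl (sec x (pt v0 w))) w.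
Proof.
move=> Fx x1; have [s [M [s0 M0 _ hU hl]]] := limit_chart Fx x1.
exists s => // w ws.
apply: (holo_ulim M0 (f := fun i w => g i (sec x (pt (vv i) w))) (a := z) (r := s) _ hl) => //.
by apply: filterS hU => i h u /h[].
Qed.

Variable Q : C -> C.
Hypotheses (Qh : forall w, md w < r -> holo Q w) (Qn : forall w, md w < r -> Q w != 0)
  (QP : forall w, md w < r -> ulim U (P ^~ w) (Q w)).

Lemma limit_pole w : md w < r -> (gl (sec p1 (pt v0 w)))^-1 = w / Q w.
Proof.
move=> wr; have [->|w0] := eqVneq w 0.
  by rewrite (sec_base secP Fp1) gl1 invr0 mul0r.
have y1 := sec_neq v0n Fp1 (rd0 wr) w0.
have h1 := limit_along (rd0 wr) y1.
have h2 : ulim U (fun i => w^-1 * P i w) (w^-1 * Q w).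
  by apply: ulimM (QP wr); exact: ulim_cst.
have h3 : ulim U (fun i => g i (sec p1 (pt (vv i) w))) (w^-1 * Q w).
  refine (ulim_eq _ h2); apply: filterS gP => i [_ [_ _ _ [_ Pw _ _] _]] /=.
  by rewrite Pw// mulKf.
by rewrite (ulim_uniq h1 h3) invfM invrK mulrC.
Qed.

Lemma limit_pole_hd : hd (fun w => (gl (sec p1 (pt v0 w)))^-1) 0 (Q 0)^-1.
Proof.
have rr : md (0 : C) < r by rewrite md0.
have [d hq] := Qh rr; have Q0 := Qn rr.
have hi := hd_comp hq (hdV Q0).
have := hdM (hd_id (0 : C)) hi; rewrite mul1r mul0r addr0 /=.
apply: hd_near r0 _ => w; rewrite subr0 => wr.
by rewrite limit_pole.
Qed.

Lemma al_limit : ulim U al (Q 0)^-1.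
Proof.
have rr : md (0 : C) < r by rewrite md0.
pose proof (ulimV (Qn rr) (QP rr)) as h; refine (ulim_eq _ h).
by apply: filterS gP => i [_ [_ _ _ [P0 _ _ _] _]]; rewrite /= P0 invrK.
Qed.

Lemma over_near x z s : F x = pt v0 z -> 0 < s -> \forall y \near x, over v0 y ->
  exists w, [/\ md (w - z) < s, F y = pt v0 w & y = sec x (pt v0 w)].
Proof.
move=> Fx s0; have [k [kpt kd]] := line_coordinate q v0n.
pose l (y : X) : C := k (F y).
have lpt y w : F y = pt v0 w -> l y = w by rewrite /l => ->.
have lc : {for x, continuous l}.
  apply: (@continuous_comp _ _ _ F k); first exact: (F_continuous gX hF).
  exact/differentiable_continuous/kd.
have nl : \forall y \near x, md (l y - z) < s.
  apply: (lc [set u | md (u - z) < s]); apply/nbhs_md; exists s => // w.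
  by rewrite (lpt _ _ Fx).
have [_ _ ns _ _] := secP x.
apply: filterS (filterI nl ns) => y [/= ly sy] oy.
have [w Fy] := overP oy; exists w; split => //; first by rewrite -(lpt _ _ Fy).
by rewrite -Fy sy.
Qed.

(** Hurwitz's theorem for [g i (sec x w) - g i (sec y zy)]. This has no zeros because [g i] is
    injective and the two sections lie in disjoint open sets; so its limit, being 0 at [x], is 0
    around [x]. *)
Lemma limit_locally_inj x y z : F x = pt v0 z -> over v0 y -> x <> p1 -> y <> p1 -> x <> y ->
  gl x = gl y -> \forall x' \near x, over v0 x' -> gl x' = gl y.
Proof.
move=> Fx oy x1 y1 xy e; have [zy Fy] := overP oy.
have [s [M [s0 M0 hd0 hU hl]]] := limit_chart Fx x1.
have [sy [My [sy0 My0 _ hUy hly]]] := limit_chart Fy y1.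
have [A [B [Ao Bo Ax By disj]]] := separating_opens hX xy.
have [sA sA0 hA] := near_sec secP Fx Ao Ax.
have [sB sB0 hB] := near_sec secP Fy Bo By.
pose s' := Num.min s sA; have s'0 : 0 < s' by rewrite lt_min s0.
pose c i := g i (sec y (pt (vv i) zy)).
have yy : md (zy - zy) < sy by rewrite subrr md0.
have yE : sec y (pt v0 zy) = y by rewrite -Fy; case: (secP y).
have hc : ulim U c (gl y) by have := hly zy yy; rewrite yE.
have key : forall w, md (w - z) < s' -> gl (sec x (pt v0 w)) - gl y = 0.
  apply: (hurwitz (UU := UU) (f := fun i w => g i (sec x (pt (vv i) w)) - c i)
     (M := M + My) (a := z) (r := s') _ _ _ _ (z0 := z)).
  - by rewrite addr_ge0.
  - apply: filterS (filterI hU hUy) => i [/= h1 h2] w; rewrite lt_min => /andP[ws _].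
    have [_ _ hh hb] := h1 _ ws; have [_ _ _ hby] := h2 _ yy; split.
      by apply: holoB hh (holo_cst _ _).
    by apply: le_trans (mdD _ _) _; rewrite mdN lerD.
  - move=> w; rewrite lt_min => /andP[ws _].
    by apply: ulimB; [exact: hl|exact: hc].
  - apply: filterS (filterI (filterI hU hUy) (filterI (filterI (vv_lim hA) (vv_lim hB)) gP)).
    move=> i [[/= h1 h2] [[hAi hBi] [vi [[ginj _ _ _ _] _ _ _ _]]]] w; rewrite lt_min => /andP[ws wA].
    have [dx nx _ _] := h1 _ ws; have [dy ny _ _] := h2 _ yy.
    rewrite subr_eq0; apply/eqP => /ginj E.
    have := disj _ (hAi _ wA); rewrite E//.
    + by apply; apply: hBi; rewrite subrr md0.
    + exact: over_pt (F_sec dx).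
    + exact: over_pt (F_sec dy).
  - by rewrite subrr md0.
  - have -> : sec x (pt v0 z) = x by rewrite -Fx; case: (secP x).
    by rewrite e subrr.
apply: filterS (over_near Fx s'0) => x' h /h[w [ws _ ->]].
by apply/eqP; rewrite -subr_eq0; apply/eqP; exact: key.
Qed.

(** [Z] consists of the points other than [p1] near which [gl] is constantly [gl y] on the curve. It
    is non-empty by [limit_locally_inj] and relatively clopen, so it would contain [p1]. *)
Lemma limit_injective (D : set (CP1 R)) : connected D ->
  biholomorphic (induced_space 1 (over v0)) (induced_space 1 D) ->
  forall x y, over v0 x -> over v0 y -> x <> p1 -> y <> p1 -> gl x = gl y -> x = y.
Proof.
move=> cD vD x y ox oy x1 y1 e; apply: contrapT => xy.
have [z Fx] := overP ox.
pose Z : set X := [set x' | x' <> p1 /\ \forall u \near x', over v0 u -> gl u = gl y].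
have Zgl u : over v0 u -> Z u -> gl u = gl y.
  by move=> ou [_ h]; exact: (nbhs_singleton h).
suff h : Z p1 by case: h.
apply: (over_connected cD vD) (over_pole Fp1 v0).
- by exists x => //; split => //; exact: limit_locally_inj Fx oy x1 y1 xy e.
- move=> u _ [u1 hu]; have nu := near_neq hX u1.
  near=> u'; move=> _; split; first by near: u'; exact: nu.
  by near: u'; exact/nbhs_interior.
move=> u ou nZ; have [w Fu] := overP ou.
(* Close to [p1] the value [gl y] is not taken, since there [gl] is [Q w / w] with [Q 0] non-zero:
   [s'] makes [md w * md (gl y)] less than [md (Q 0) / 2]. *)
have [u1|u1] := pselect (u = p1).
  have rr : md (0 : C) < r by rewrite md0.
  have Fu0 : F u = pt v0 0 by rewrite u1 Fp1 pt0.
  have [d hq] := Qh rr.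
  have m0 : 0 < md (Q 0) / 2 by rewrite divr_gt0 ?md_gt0 ?Qn.
  have [s s0 hs] := hd_cont hq m0.
  pose K := md (gl y) + 1; have K0 : 0 < K by rewrite /K; have := md_ge0 (gl y); lra.
  pose s' := Num.min r (Num.min s (md (Q 0) / 2 / K)).
  have s'0 : 0 < s' by rewrite !lt_min r0 s0 divr_gt0.
  apply: filterS (over_near Fu0 s'0) => u' h ou'; have [w' [ws' Fu' uE]] := h ou'.
  move=> Zu'; have := Zgl _ ou' Zu'; have [n1 _] := Zu'.
  move: ws'; rewrite !lt_min => /and3P[wr]; move: (wr); rewrite subr0 => wr' ws.
  rewrite ltr_pdivlMr// => wK.
  have w'0 : w' != 0.
    by apply/eqP => w0; apply: n1; rewrite uE w0 u1 (sec_base secP Fp1).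
  rewrite uE u1 => E.
  have := limit_pole wr'; rewrite E => E'.
  have : md (Q w') = md w' * md (gl y).
    have gy0 : gl y != 0.
      by apply/eqP => g0; move/eqP: E'; rewrite g0 invr0 eq_sym mulf_eq0 (negbTE w'0) invr_eq0 (negbTE (Qn wr')).
    rewrite -mdM -[gl y]invrK E' invfM invrK mulrA mulfV// mul1r //.
  have := hs w'; rewrite subr0 => /(_ ws); have := md_dist (Q 0) (Q w'); rewrite mdB.
  have := md_ge0 w'; rewrite /K in wK; nra.
have [s s0 hs] := limit_holo Fu u1.
pose ph w := gl (sec u (pt v0 w)) - gl y.
have phh w' : md (w' - w) < s -> holo ph w'.
  by move=> /hs h; apply: holoB h (holo_cst _ _).
have nsec : sec u (pt v0 w) = u by rewrite -Fu; case: (secP u).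
(* If the zeros of [gl - gl y] accumulate at [u], then [u] is in [Z] after all; otherwise a
   punctured neighbourhood of [u] avoids [Z]. *)
have [acc|nacc] := pselect (forall t, 0 < t -> exists w', [/\ w' != w, md (w' - w) < t & ph w' = 0]).
  have [t t0 ht] := isolated_zeros s0 phh acc.
  case: nZ; split => //; apply: filterS (over_near Fu t0) => u' h /h[w' [wt _ ->]].
  by apply/eqP; rewrite -subr_eq0; apply/eqP; exact: ht.
have [t t0 nt] : exists2 t, 0 < t & ~ exists w', [/\ w' != w, md (w' - w) < t & ph w' = 0].
  by apply: contrapT => nt; apply: nacc => t t0; apply: contrapT => h; apply: nt; exists t.
apply: filterS (over_near Fu t0) => u' h ou'; have [w' [wt Fu' uE]] := h ou'.
move=> Zu'; have E := Zgl _ ou' Zu'.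
have [ww|ww] := eqVneq w' w.
  by apply: nZ; move: Zu'; rewrite uE ww nsec.
by apply: nt; exists w'; split => //; rewrite /ph -uE E subrr.
Unshelve. all: by end_near. Qed.

Lemma limit_embedding (D : set (CP1 R)) : connected D ->
  biholomorphic (induced_space 1 (over v0)) (induced_space 1 D) -> embedding v0 gl.
Proof.
move=> cD vD; split.
- exact: limit_injective cD vD.
- exact: gl1.
- have F2 : F p2 = pt v0 0 by rewrite pt0.
  have h := glP F2 (fun e => p12 (esym e)).
  refine (ulim_uniq h _); refine (ulim_eq _ (ulim_cst _)).
  by apply: filterS gP => i [_ [[_ _ g2 _ _] _ _ _ _]] /=; rewrite (sec_base secP Fp2) g2.
- move=> x z Fx x1; have [s s0 hs] := limit_holo Fx x1.
  by apply: hs; rewrite subrr md0.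
- by exists (Q 0)^-1; exact: limit_pole_hd.
Qed.

(** The factors converge separately: [al] by the formula [P 0 = al^-1], and the derivatives at [p2]
    by [hd_ulim]. [bb] stands for the values of b along the family. *)
Lemma residue_limit (D : set (CP1 R)) : connected D ->
  biholomorphic (induced_space 1 (over v0)) (induced_space 1 D) ->
  exists2 b, residue F q sec p1 p2 v0 b &
   forall bb, U [set i | forall b, residue F q sec p1 p2 (vv i) b -> b = bb i] -> ulim U bb b.
Proof.
move=> cD vD; have eg := limit_embedding cD vD.
have F2 : F p2 = pt v0 0 by rewrite pt0.
have p21 : p2 <> p1 by move=> e; exact: p12.
have [_ _ _ gh _] := eg; have [be hbe] := gh _ _ F2 p21.
have [s [M [s0 M0 _ hU hl]]] := limit_chart F2 p21.
have hU' : U [set i | forall w, md (w - 0) < s ->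
    holo (fun w => g i (sec p2 (pt (vv i) w))) w /\ md (g i (sec p2 (pt (vv i) w))) <= M].
  by apply: filterS hU => i h w /h[].
exists ((Q 0)^-1 * be); first by exists gl, (Q 0)^-1, be; split => //; exact: limit_pole_hd.
have zz : md (0 - 0 : C) < s by rewrite subrr md0.
have [bi hbi] : exists bi : I -> C, U [set i | hd (fun w => g i (sec p2 (pt (vv i) w))) 0 (bi i)].
  have h i : exists b, (exists d, hd (fun w => g i (sec p2 (pt (vv i) w))) 0 d) -> hd (fun w => g i (sec p2 (pt (vv i) w))) 0 b.
    have [[d hd0]|nd] := pselect (exists d, hd (fun w => g i (sec p2 (pt (vv i) w))) 0 d); first by exists d.
    by exists 0 => /nd.
  have [bi hb] := choice h; exists bi.
  by apply: filterS hU' => i /(_ 0 zz)[hh _]; exact: hb.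
have lb : ulim U bi be by exact: (hd_ulim M0 hU' hl zz hbi hbe).
move=> bb hbb; pose proof (ulimM al_limit lb) as h; refine (ulim_eq _ h).
apply: filterS (filterI (filterI hbb hbi) gP) => i [[/= h1 h2] [_ [egi hal _ _ _]]].
by apply: h1; exists (g i), (al i), (bi i).
Qed.

End LimitMap.

Theorem residue_ulim (D : set (CP1 R)) : connected D ->
  biholomorphic (induced_space 1 (over v0)) (induced_space 1 D) ->
  exists2 b, residue F q sec p1 p2 v0 b &
   forall bb, U [set i | forall b, residue F q sec p1 p2 (vv i) b -> b = bb i] -> ulim U bb b.
Proof.
move=> cD vD; have [Q [Qh Qn QP]] := pole_limit_ex.
have [gl [gl1 glP]] := limit_ex.
exact: residue_limit gl1 glP Q Qh Qn QP D cD vD.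
Qed.

End Limit.

(** * The contradiction from the winding of b *)

Theorem theorem1p1 (R : realType) (n : nat) (hn : (2 <= n)%N)
    (X : chartedSpace R n) (hX : complex_manifold X)
    (hconn : connected [set: X])
    (F : X -> Cspace R n) (hF : local_biholomorphism F)
    (q : Cspace R n) (hq : range F q)
    (hlines : forall l : set (Cspace R n), complex_line l -> l q ->
      exists2 D : set (CP1 R), rigid_domain D &
        biholomorphic (induced_space 1 (F @^-1` l)) (induced_space 1 D)) :
  exists p : X, F @^-1` [set q] = [set p].
Proof.
have gX := complex_manifold_good hX; have [hausX _ _ _ _] := hX.
have [p1 _ Fp1] := hq; exists p1; apply/seteqP; split=> [p2 Fp2|_ ->]; last exact: Fp1.
apply: contrapT => p21; have p12 : p1 <> p2 by move=> e; apply: p21.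
have n0 : (0 < n)%N by apply: leq_trans hn.
have [sec secP] := choice (local_section gX hF).
have H (v : 'rV[Cplx R]_n) : v != 0 -> exists2 D : set (CP1 R), rigid_domain D &
    biholomorphic (induced_space 1 (over F q v)) (induced_space 1 D).
  move=> v0; apply: hlines; first by exists q, v.
  by exists 0 => //; rewrite scale0r addr0.
have hb0 (v : 'rV[Cplx R]_n) : exists b, v != 0 -> residue F q sec p1 p2 v b.
  have [->|v0] := eqVneq v 0; first by exists 0.
  have [D _ vD] := H v v0; have [b hb] := residue_exists secP Fp1 Fp2 p12 vD.
  by exists b.
have [b hb] := choice hb0.
have bE v b' : v != 0 -> residue F q sec p1 p2 v b' -> b' = b v.
  move=> v0 hb'; have [D rD vD] := H v v0.
  exact: (residue_unique gX hausX hF n0 secP Fp1 Fp2 p12 v0 rD vD hb' (hb v v0)).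
pose i0 : 'I_n := Ordinal n0; pose i1 : 'I_n := Ordinal hn.
pose e0 : 'rV[Cplx R]_n := delta_mx 0 i0; pose e1 : 'rV[Cplx R]_n := delta_mx 0 i1.
(* The contraction of the loop [cis t *: e0] to the constant [e1]. It avoids 0 because the two
   coordinates never vanish together; the second coordinate exists by [hn]. *)
pose vec (s t : R) : 'rV[Cplx R]_n := (rc (1 - s) * cis t) *: e0 + rc s *: e1.
have vec0 s t : vec s t 0 i0 = rc (1 - s) * cis t.
  by rewrite !mxE !eqxx mulr1 (_ : i0 == i1 = false) // andbF mulr0 addr0.
have vec1 s t : vec s t 0 i1 = rc s.
  by rewrite !mxE !eqxx mulr1 (_ : i1 == i0 = false) // andbF mulr0 add0r.
have vecn s t : vec s t != 0.
  apply/eqP => e; have := vec0 s t; have := vec1 s t; rewrite e !mxE.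
  move=> /esym/eqP; rewrite rc_eq0 => /eqP ->; rewrite subr0 rc1 mul1r => /esym/eqP.
  by rewrite (negbTE (cis_neq0 t)).
apply: (@no_winding_homotopy R (fun s t => b (vec s t))).
(* Discontinuity would give parameters [p k] tending to [(s, t)] whose values of [b] stay [e] away
   from the one at [(s, t)], against [residue_ulim]. *)
- move=> s t hs ht e ep; apply: contrapT => nd.
  have hbad (k : nat) : exists p : R * R, [/\ 0 <= p.1 <= 1, `|p.1 - s| < k.+1%:R^-1,
      `|p.2 - t| < k.+1%:R^-1 & e <= md (b (vec p.1 p.2) - b (vec s t))].
    apply: contrapT => nk; apply: nd; exists k.+1%:R^-1; first by rewrite invr_gt0.
    move=> s' t' hs' ht' s's t't; rewrite ltNge; apply/negP => le; apply: nk.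
    by exists (s', t').
  have [p hp] := choice hbad.
  have [U [UU hU]] := @ultraFilterLemma nat \oo _.
  have PU := @ultra_proper _ _ UU.
  pose vv k := vec (p k).1 (p k).2.
  have lim A : nbhs (vec s t) A -> U [set k | A (vv k)].
    move=> hA.
    have cvgf : (u.1 *: e0 + u.2 *: e1) @[u --> ((rc (1 - s) * cis t, rc s) : Cplx R * Cplx R)]
        --> (rc (1 - s) * cis t) *: e0 + rc s *: e1.
      by apply: cvgD; apply: cvgZr_tmp; [exact: cvg_fst|exact: cvg_snd].
    have [[A1 A2] /= [/nbhs_md[r1 r10 h1] /nbhs_md[r2 r20 h2]] h] := cvgf _ hA.
    pose r := Num.min r1 r2; have r0 : 0 < r by rewrite lt_min r10.
    have rr1 : r <= r1 by rewrite ge_min lexx.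
    have rr2 : r <= r2 by rewrite ge_min lexx orbT.
    (* The first coordinate of [vec] moves by at most the change of [s] plus 16 times that of
       [t]. *)
    apply: hU; exists (Num.truncn (17 / r)) => // k hk /=.
    have small : 17 * k.+1%:R^-1 < r.
      rewrite -[17 * _]/(17 / k.+1%:R) ltr_pdivrMr// mulrC -ltr_pdivrMr//.
      by apply: lt_le_trans (truncnS_gt _) _; rewrite ler_nat ltnS.
    have [hs' d1 d2 _] := hp k.
    apply: (h (rc (1 - (p k).1) * cis (p k).2, rc (p k).1)); split => /=.
      apply: h1; apply: lt_le_trans rr1.
      rewrite (_ : _ - _ = rc (s - (p k).1) * cis (p k).2 + rc (1 - s) * (cis (p k).2 - cis t)); last first.
        by rewrite !rcB rc1; ring.
      apply: le_lt_trans (mdD _ _) _; rewrite !mdM md_cis !md_rc mulr1 distrC.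
      have le16 : `|1 - s| * md (cis (p k).2 - cis t) <= 16 * `|(p k).2 - t|.
        apply: le_trans (cis_lip _ _); apply: ler_piMl; first exact: md_ge0.
        by rewrite ler_norml; lra.
      move: d1 d2 small le16; set m := _^-1; set x := _ * md _; lra.
    apply: h2; apply: lt_le_trans rr2.
    move: d1 small; rewrite -rcB md_rc distrC; have := normr_ge0 ((p k).1 - s).
    by set m := _^-1; lra.
  have nq : nbhs (pt q (vec s t) 0) (sec_dom F sec p1).
    by rewrite pt0 -Fp1; exact: near_sec_dom.
  have [r r0 rd] := pt_cvg nq.
  have rd' : \forall v \near vec s t, forall w, md w < r -> sec_dom F sec p1 (pt q v w).
    by apply: filterS rd => v hv w wr; apply: hv; rewrite subr0.
  (* Dummy data are chosen where the disc of radius [r] is not in the domain of the section, which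
     is excluded for almost all [k]. *)
  have hN (k : nat) : exists x : (X -> Cplx R) * Cplx R * (Cplx R -> Cplx R) * Cplx R,
      (forall w, md w < r -> sec_dom F sec p1 (pt q (vv k) w)) ->
      normalised F q sec p1 p2 (vv k) r x.1.1.1 x.1.1.2 x.1.2 x.2.
    have [h|nh] := pselect (forall w, md w < r -> sec_dom F sec p1 (pt q (vv k) w)); last first.
      by exists (fun=> 0, 0, id, 0) => /nh.
    have [D _ vD] := H (vv k) (vecn _ _).
    have [g [al [P [z0 hN]]]] := normalised_exists secP Fp1 Fp2 p12 (vecn _ _) r0 vD h.
    by exists (g, al, P, z0).
  have [x hx] := choice hN.
  have [D [_ cD _] vD] := H (vec s t) (vecn s t).
  have gP : U [set k | vv k != 0 /\ normalised F q sec p1 p2 (vv k) r (x k).1.1.1 (x k).1.1.2 (x k).1.2 (x k).2].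
    by apply: filterS (lim _ rd') => k hk; split; [exact: vecn|exact: hx].
  have [b0 hb0' hlim] := residue_ulim gX hausX hF secP Fp1 Fp2 p12 (vecn s t) lim r0 rd' gP cD vD.
  have := hlim (fun k => b (vv k)) _; rewrite (bE _ _ (vecn s t) hb0').
  have all : U [set k | forall b', residue F q sec p1 p2 (vv k) b' -> b' = b (vv k)].
    by apply: filterS filterT => k _ b'; apply: bE; exact: vecn.
  move=> /(_ all e ep) /filter_ex[k /=]; have [_ _ _ le] := hp k.
  by rewrite ltNge le.
- move=> s t _ _.
  exact: (residue_neq0 secP Fp1 Fp2 p12 (vecn s t) (hb _ (vecn s t))).
- by move=> s; rewrite /vec cis0 cis1.
- by move=> t; rewrite /vec subrr rc0 !mul0r.
- move=> t.
  (* At [s = 0] the loop consists of multiples of one vector, so [residue_scale] gives the double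
     winding. *)
  have -> : vec 0 t = cis t *: vec 0 0.
    by rewrite /vec rc0 !scale0r !addr0 subr0 rc1 cis0 !mul1r scale1r.
  apply/esym/bE; first by rewrite scaler_eq0 negb_or cis_neq0 vecn.
  exact: (residue_scale (cis_neq0 t) (hb _ (vecn 0 0))).
Qed.
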